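(* Let $q_E\colon E\to M$ be a smooth vector bundle and $\Delta\colon \Gamma(TM\oplus E^* )\times\Gamma(E\oplus T^*M)\to\Gamma(E\oplus T^*M)$ a Dorfman connection. The dull bracket $[\![\cdot,\cdot]\!]_\Delta$ associated to $\Delta$ is skew-symmetric if and only if the image $L_\Delta=\Sigma^\Delta((TM\oplus E^* )\times_ME)$ of $\Sigma^\Delta$ is maximally isotropic in $TE\oplus T^*E$ (relative to the canonical pairing). In that case the corresponding splitting $$TE\oplus T^*E\cong\big(T^{q_E}E\oplus (T^{q_E}E)^\circ\big)\oplus L_\Delta$$ is the direct sum of the Dirac structure $T^{q_E}E\oplus (T^{q_E}E)^\circ$ and the linear almost Dirac structure $L_\Delta$.
   Context: Everything is smooth. $TM\oplus E^*$ is anchored by $\mathrm{pr}_{TM}$ and paired with $E\oplus T^*M$ by $\langle (X,\varepsilon),(e,\theta)\rangle=\langle\varepsilon,e\rangle+\langle\theta,X\rangle$. A Dorfman connection here is an $\mathbb R$-bilinear map $\Delta\colon \Gamma(TM\oplus E^* )\times\Gamma(E\oplus T^*M)\to\Gamma(E\oplus T^*M)$ such that for all $f\in C^\infty(M)$, $\nu=(X,\varepsilon)$, $\tau$: (a) $\Delta_{f\nu}\tau=f\Delta_\nu\tau+\langle\nu,\tau\rangle(0,\mathbf df)$; (b) $\Delta_\nu(f\tau)=f\Delta_\nu\tau+X(f)\tau$; (c) $\Delta_\nu(0,\mathbf df)=(0,\mathbf d(X(f)))$. Its dual (dull) bracket $[\![\cdot,\cdot]\!]_\Delta$ on $\Gamma(TM\oplus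 E^* )$ is defined by $\langle[\![\nu_1,\nu_2]\!]_\Delta,\tau\rangle=\mathrm{pr}_{TM}(\nu_1)\langle\nu_2,\tau\rangle-\langle\nu_2,\Delta_{\nu_1}\tau\rangle$. For $\varepsilon\in\Gamma(E^* )$, $\ell_\varepsilon(e_m)=\langle\varepsilon(m),e_m\rangle$. For $(e,\theta)\in\Gamma(E\oplus T^*M)$, $(e,\theta)^\uparrow(e'_m)=\big(\tfrac{d}{dt}|_{t=0}(e'_m+te(m)),\ (T_{e'_m}q_E)^t\theta(m)\big)$. The linear splitting $\Sigma^\Delta\colon(TM\oplus E^* )\times_ME\to TE\oplus T^*E$ is $\Sigma^\Delta((X,\varepsilon)(m),e(m))=(T_me\,X(m),\mathbf d_{e(m)}\ell_\varepsilon)-(\Delta_{(X,\varepsilon)}(e,0))^\uparrow(e(m))$ for $(X,\varepsilon)\in\Gamma(TM\oplus E^* )$, $e\in\Gamma(E)$; its image $L_\Delta$ is a vector subbundle of $TE\oplus T^*E\to E$. $T^{q_E}E=\ker Tq_E\subseteq TE$ and $(T^{q_E}E)^\circ\subseteq T^*E$ is its annihilator. The canonical pairing is $\langle(v,\theta),(w,\eta)\rangle=\theta(w)+\eta(v)$; the Courant–Dorfman bracket is $[\![(X,\theta),(Y,\eta)]\!]=([X,Y],\pounds_X\eta-\mathbf i_Y\mathbf d\theta)$. An almost Dirac structure is a subbundle $D$ of $TE\oplus T^*E\to E$ with $D=D^\perp$; it is a Dirac structure if moreover $\Gamma(D)$ is closed under the Courant–Dorfman bracket. A subbundle of $TE\oplus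 T^*E\to E$ is linear if it projects to a subbundle of $TM\oplus E^*$ under $\Phi_E=(Tq_E,r_E)$, where $\langle r_E(\theta_{e_m}),e'_m\rangle=\langle\theta_{e_m},\tfrac{d}{dt}|_{t=0}(e_m+te'_m)\rangle$, and is closed under the addition of $TE\oplus T^*E$ as a vector bundle over $TM\oplus E^*$ (on $TE\to TM$ this is the tangent of the addition of $E$; on $T^*E\to E^*$, covectors $\theta_{e_m},\omega_{e'_m}$ with the same image under $r_E$ add to the element of $T^*_{e_m+e'_m}E$ given by $\langle\theta_{e_m}+\omega_{e'_m},v+_{TM}w\rangle=\langle\theta_{e_m},v\rangle+\langle\omega_{e'_m},w\rangle$ for $Tq_Ev=Tq_Ew$). *)

(* Defs.v *)
From HB Require Import structures.
From mathcomp Require Import all_boot all_order all_algebra.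
From mathcomp Require Import all_classical all_reals all_analysis.

Set Implicit Arguments.
Unset Strict Implicit.
Unset Printing Implicit Defensive.

Import Order.TTheory GRing.Theory Num.Theory.
Import numFieldNormedType.Exports.

Local Open Scope classical_set_scope.
Local Open Scope ring_scope.

(* Definite description, for objects characterised by a property; [x0] is a   *)
(* junk value used only when no object has the property.                      *)
Definition the (T : Type) (x0 : T) (P : T -> Prop) : T :=
  if pselect (exists x, P x) is left h then projT1 (cid h) else x0.

Section Euclidean.
Context {R : realType}.

(* C^k and C^oo on an open set [U].                                           *)
Fixpoint Ck {V W : normedModType R} (k : nat) (U : set V) (f : V -> W) : Prop :=
  if k is k'.+1 then
    (forall x, U x -> differentiable f x) /\
    (forall v, Ck k' U (fun x => 'd f x v))
  else forall x, U x -> {for x, continuous f}.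

Definition Cinf {V W : normedModType R} (U : set V) (f : V -> W) : Prop :=
  forall k, Ck k U f.

Definition dual_space (V : vectType R) : vectType R := 'Hom(V, R^o).

End Euclidean.

(* Smooth manifolds, as sets with an atlas (the atlas determines the          *)
(* topology).  A chart is a pair of total functions, meaningful on [cdom] and *)
(* on its image.  The data come with a preferred chart at each point, which   *)
(* serves to model the tangent space; the axioms are in [is_manifold].        *)
Record chart (R : realType) (T : Type) (n : nat) := Chart {
  cdom : set T;
  cmap : T -> 'rV[R]_n;
  cinv : 'rV[R]_n -> T }.

Record premanifold (R : realType) (n : nat) := PreManifold {
  pt :> Type;
  atlas : set (chart R pt n);
  chart_at : pt -> chart R pt n }.
Arguments atlas {R n} _.
Arguments chart_at {R n} _ _.

Section Manifold.
Context {R : realType} {n : nat} (M : premanifold R n).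

Definition mopen (U : set M) : Prop :=
  forall c, atlas M c -> open (cmap c @` (cdom c `&` U)).

Definition smooth_on {W : normedModType R} (U : set M) (f : M -> W) : Prop :=
  forall c, atlas M c -> Cinf (cmap c @` (cdom c `&` U)) (f \o cinv c).

Definition smooth_fun (f : M -> R) : Prop := smooth_on (W := R^o) setT f.

Definition is_manifold : Prop :=
  [/\ forall x, atlas M (chart_at M x) /\ cdom (chart_at M x) x,
      (forall c x, atlas M c -> cdom c x -> cinv c (cmap c x) = x),
      (forall c d, atlas M c -> atlas M d ->
         open (cmap c @` (cdom c `&` cdom d)) /\
         Cinf (cmap c @` (cdom c `&` cdom d)) (cmap d \o cinv c)),
      (forall x y : M, x <> y -> exists U V : set M,
         [/\ mopen U, mopen V, U x, V y & U `&` V = set0]) &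
      exists B : nat -> set M, (forall i, mopen (B i)) /\
        forall U x, mopen U -> U x -> exists i, B i x /\ B i `<=` U].

End Manifold.

(* Vector bundles: a family of vector spaces with smoothly compatible local   *)
(* trivialisations, fibrewise linear isomorphisms onto R^k.                   *)
Record triv (R : realType) (T : Type) (F : T -> vectType R) (k : nat) := Triv {
  tdom : set T;
  tmap : forall m, 'Hom(F m, 'rV[R]_k) }.

Record prebundle (R : realType) (n : nat) (M : premanifold R n) := PreBundle {
  rank : nat;
  fib :> M -> vectType R;
  trivs : set (triv fib rank);
  triv_at : M -> triv fib rank }.
Arguments rank {R n M} _.
Arguments trivs {R n M} _.
Arguments triv_at {R n M} _ _.

Section Bundle.
Context {R : realType} {n : nat} {M : premanifold R n}.

Definition section (E : prebundle M) : Type := forall m : M, E m.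

Definition is_vbundle (E : prebundle M) : Prop :=
  [/\ forall m, trivs E (triv_at E m) /\ tdom (triv_at E m) m,
      (forall t, trivs E t -> mopen (tdom t)),
      (forall t m, trivs E t -> tdom t m ->
         bijective (tmap t m)) &
      (forall t s w, trivs E t -> trivs E s ->
         smooth_on (tdom t `&` tdom s)
           (fun m => tmap s m ((tmap t m)^-1%VF w)))].

Definition smooth_section_on (E : prebundle M) (U : set M) (s : section E) :
    Prop :=
  forall t, trivs E t ->
    smooth_on (U `&` tdom t) (fun m => tmap t m (s m)).

Definition smooth_section (E : prebundle M) (s : section E) : Prop :=
  smooth_section_on setT s.

Definition dual_triv (F : M -> vectType R) k (t : triv F k) :
    triv (fun m => dual_space (F m)) k :=
  Triv (tdom t) (fun m => linfun (fun phi : dual_space (F m) =>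
    \row_i (phi : 'Hom(F m, R^o)) ((tmap t m)^-1%VF (delta_mx 0 i)))).

Definition dual (E : prebundle M) : prebundle M :=
  PreBundle [set dual_triv t | t in trivs E]
            (fun m => dual_triv (triv_at E m)).

Definition dsum_fib (F G : M -> vectType R) (m : M) : vectType R :=
  (F m * G m)%type.

Definition dsum_triv (F G : M -> vectType R) k l
    (t : triv F k) (s : triv G l) : triv (dsum_fib F G) (k + l) :=
  Triv (tdom t `&` tdom s) (fun m => linfun (fun v : dsum_fib F G m =>
    row_mx (tmap t m v.1) (tmap s m v.2))).

Definition dsum (E F : prebundle M) : prebundle M :=
  PreBundle [set dsum_triv t s | t in trivs E & s in trivs F]
            (fun m => dsum_triv (triv_at E m) (triv_at F m)).

(* Subbundles, as families of subsets of the fibres, given by local frames.   *)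
Definition is_subbundle (E : prebundle M) (D : forall m, set (E m)) : Prop :=
  exists r : nat, forall m, exists (U : set M) (s : 'I_r -> section E),
    [/\ mopen U, U m, forall i, smooth_section_on U (s i) &
        forall y, U y ->
          free [seq s i y | i <- enum 'I_r] /\
          D y = [set w | w \in <<[seq s i y | i <- enum 'I_r]>>%VS]].

(* Total space, as a manifold of dimension n + rank E.                        *)
Record total (F : M -> vectType R) := Tot { base : M; vec : F base }.

Definition tot_chart (F : M -> vectType R) k
    (c : chart R M n) (t : triv F k) : chart R (total F) (n + k) :=
  Chart [set x | cdom c (base x) /\ tdom t (base x)]
        (fun x => row_mx (cmap c (base x)) (tmap t (base x) (vec x)))
        (fun y => let m := cinv c (lsubmx y) in
                  Tot ((tmap t m)^-1%VF (rsubmx y))).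

Definition tot (E : prebundle M) : premanifold R (n + rank E) :=
  PreManifold [set tot_chart c t | c in atlas M & t in trivs E]
    (fun x => tot_chart (chart_at M (base x)) (triv_at E (base x))).

End Bundle.

(* Tangent and cotangent bundles.  T_xM is R^n, a vector being identified     *)
(* with its coordinates in the preferred chart at x; a chart c then           *)
(* trivialises TM through the derivative of the change of coordinates.        *)
Section Tangent.
Context {R : realType}.

Definition T_ {n} (M : premanifold R n) (x : M) : vectType R := 'rV[R]_n.

Definition tangent_triv {n} (M : premanifold R n) (c : chart R M n) :
    triv (T_ (M := M)) n :=
  Triv (cdom c) (fun x => linfun
    ('d (cmap c \o cinv (chart_at M x)) (cmap (chart_at M x) x)
       : 'rV[R]_n -> 'rV[R]_n)).

Definition TB {n} (M : premanifold R n) : prebundle M :=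
  PreBundle [set tangent_triv c | c in atlas M]
            (fun x => tangent_triv (chart_at M x)).

Definition TsB {n} (M : premanifold R n) : prebundle M := dual (TB M).

Definition tangent_map {n p} {M : premanifold R n} {N : premanifold R p}
    (F : M -> N) (x : M) : 'Hom(TB M x, TB N (F x)) :=
  linfun ('d (cmap (chart_at N (F x)) \o F \o cinv (chart_at M x))
             (cmap (chart_at M x) x) : 'rV[R]_n -> 'rV[R]_p).

Definition differential {n} {M : premanifold R n} (f : M -> R) (x : M) :
    TsB M x :=
  linfun ('d (f \o cinv (chart_at M x) : 'rV[R]_n -> R^o)
             (cmap (chart_at M x) x) : 'rV[R]_n -> R^o).

(* velocity at time 0 of a curve with [gamma 0 = x]                           *)
Definition velocity {n} {M : premanifold R n} (x : M) (gamma : R -> M) :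
    TB M x :=
  derive1 (cmap (chart_at M x) \o gamma : R -> 'rV[R]_n) 0.

Definition ev {V : vectType R} (phi : dual_space V) (v : V) : R :=
  (phi : 'Hom(V, R^o)) v.

(* X(f) *)
Definition lie_fun {n} {M : premanifold R n} (X : section (TB M)) (f : M -> R) :
    M -> R :=
  fun x => ev (differential f x) (X x).

End Tangent.

(* Lie bracket, exterior derivative of a 1-form and Courant-Dorfman bracket,  *)
(* at x in the coordinates of the preferred chart c at x, in which the        *)
(* identification of T_xM with R^n is the identity:                           *)
(* [X,Y] = dY(X) - dX(Y),  d theta (u,v) = u(theta(v)) - v(theta(u))          *)
(* for u and v with constant coordinates.                                     *)
Section Courant.
Context {R : realType} {n : nat} {M : premanifold R n}.

Definition local_vf (c : chart R M n) (X : section (TB M)) :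
    'rV[R]_n -> 'rV[R]_n :=
  fun y => tmap (tangent_triv c) (cinv c y) (X (cinv c y)).

Definition local_form (c : chart R M n) (theta : section (TsB M))
    (v : 'rV[R]_n) : 'rV[R]_n -> R^o :=
  fun y => ev (theta (cinv c y)) ((tmap (tangent_triv c) (cinv c y))^-1%VF v).

Definition lie_bracket (X Y : section (TB M)) : section (TB M) :=
  fun x => let c := chart_at M x in
    'd (local_vf c Y) (cmap c x) (X x : 'rV[R]_n)
    - 'd (local_vf c X) (cmap c x) (Y x : 'rV[R]_n).

Definition extd (theta : section (TsB M)) (x : M) (u v : TB M x) : R :=
  let c := chart_at M x in
  'd (local_form c theta v) (cmap c x) (u : 'rV[R]_n)
  - 'd (local_form c theta u) (cmap c x) (v : 'rV[R]_n).

Definition interior_extd (X : section (TB M)) (theta : section (TsB M)) :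
    section (TsB M) :=
  fun x => linfun (fun v : TB M x => extd theta (X x) v : R^o).

(* Cartan's formula *)
Definition lie_form (X : section (TB M)) (theta : section (TsB M)) :
    section (TsB M) :=
  fun x => interior_extd X theta x
           + differential (fun y => ev (theta y) (X y)) x.

Definition CB : prebundle M := dsum (TB M) (TsB M).

Definition courant_bracket (s1 s2 : section CB) : section CB :=
  let X := fun x => (s1 x).1 in let theta := fun x => (s1 x).2 in
  let Y := fun x => (s2 x).1 in let eta := fun x => (s2 x).2 in
  fun x => (lie_bracket X Y x, lie_form X eta x - interior_extd Y theta x).

Definition cpair {x : M} (w1 w2 : CB x) : R := ev w1.2 w2.1 + ev w2.2 w1.1.

Definition orth (D : forall x, set (CB x)) (x : M) : set (CB x) :=
  [set w | forall w', D x w' -> cpair w w' = 0].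
Arguments orth D x _ : clear implicits.

Definition isotropic (D : forall x, set (CB x)) : Prop :=
  forall x, D x `<=` orth D x.

Definition maximally_isotropic (D : forall x, set (CB x)) : Prop :=
  isotropic D /\
  forall x (W : {vspace CB x}),
    (forall w w', w \in W -> w' \in W -> cpair w w' = 0) ->
    D x `<=` [set w | w \in W] -> [set w | w \in W] `<=` D x.

Definition is_almost_dirac (D : forall x, set (CB x)) : Prop :=
  is_subbundle D /\ forall x, D x = orth D x.

Definition is_dirac (D : forall x, set (CB x)) : Prop :=
  is_almost_dirac D /\
  forall s1 s2 : section CB, smooth_section s1 -> smooth_section s2 ->
    (forall x, D x (s1 x)) -> (forall x, D x (s2 x)) ->
    forall x, D x (courant_bracket s1 s2 x).

Definition direct_sum (D1 D2 : forall x, set (CB x)) : Prop :=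
  forall x (w : CB x), exists! ab : CB x * CB x,
    [/\ D1 x ab.1, D2 x ab.2 & w = ab.1 + ab.2].

End Courant.
Arguments CB {R n} M.

Section Dorfman.
Context {R : realType} {n : nat} {M : premanifold R n} (E : prebundle M).

(* TM + E^* and E + T^*M, with their pairing                                  *)
Definition AB : prebundle M := dsum (TB M) (dual E).
Definition BB : prebundle M := dsum E (TsB M).

Definition pairing {m : M} (nu : AB m) (tau : BB m) : R :=
  ev nu.2 tau.1 + ev tau.2 nu.1.

Definition anchor (nu : section AB) : section (TB M) := fun m => (nu m).1.

Definition exact (f : M -> R) : section BB := fun m => (0, differential f m).

(* [Delta] is only constrained on smooth sections.                            *)
Definition is_dorfman (Delta : section AB -> section BB -> section BB) : Prop :=
  [/\ forall nu tau, smooth_section nu -> smooth_section tau ->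
        smooth_section (Delta nu tau),
      (forall (a : R) nu nu' tau tau',
         smooth_section nu -> smooth_section nu' ->
         smooth_section tau -> smooth_section tau' ->
         (forall m, Delta (fun m => a *: nu m + nu' m) tau m
                    = a *: Delta nu tau m + Delta nu' tau m) /\
         (forall m, Delta nu (fun m => a *: tau m + tau' m) m
                    = a *: Delta nu tau m + Delta nu tau' m)),
      (forall f nu tau, smooth_fun f ->
         smooth_section nu -> smooth_section tau ->
         forall m, Delta (fun m => f m *: nu m) tau m
                   = f m *: Delta nu tau m
                     + pairing (nu m) (tau m) *: exact f m),
      (forall f nu tau, smooth_fun f ->
         smooth_section nu -> smooth_section tau ->
         forall m, Delta nu (fun m => f m *: tau m) m
                   = f m *: Delta nu tau m
                     + lie_fun (anchor nu) f m *: tau m) &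
      (forall f nu, smooth_fun f -> smooth_section nu ->
         forall m, Delta nu (exact f) m = exact (lie_fun (anchor nu) f) m)].

Variable Delta : section AB -> section BB -> section BB.

Definition dull_bracket (nu1 nu2 : section AB) : section AB :=
  the (fun m => 0) (fun beta => smooth_section beta /\
    forall tau, smooth_section tau -> forall m,
      pairing (beta m) (tau m)
      = lie_fun (anchor nu1) (fun m => pairing (nu2 m) (tau m)) m
        - pairing (nu2 m) (Delta nu1 tau m)).

Definition dull_skew : Prop :=
  forall nu1 nu2, smooth_section nu1 -> smooth_section nu2 ->
    forall m, dull_bracket nu1 nu2 m = - dull_bracket nu2 nu1 m.

(* q_E, the linear function l_eps, and vertical lifts                         *)
Definition proj (x : tot E) : M := base x.

Definition ell (eps : section (dual E)) (x : tot E) : R :=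
  ev (eps (base x)) (vec x).

Definition vlift {m : M} (e' e : E m) : TB (tot E) (Tot e') :=
  velocity (Tot e' : tot E) (fun t : R => Tot (e' + t *: e)).

Definition core_lift {m : M} (tau : BB m) (e' : E m) : CB (tot E) (Tot e') :=
  (vlift e' tau.1,
   ((tau.2 : 'Hom(TB M m, R^o)) \o tangent_map proj (Tot e' : tot E))%VF).

Definition sigma_value (nu : section AB) (e : section E) (m : M) :
    CB (tot E) (Tot (e m)) :=
  (tangent_map (fun y => Tot (e y) : tot E) m (nu m).1,
   differential (ell (fun y => (nu y).2)) (Tot (e m) : tot E))
  - core_lift (Delta nu (fun y => (e y, 0)) m) (e m).

(* Sigma^Delta, determined by its values on sections through (u, e0)          *)
Definition Sigma {m : M} (u : AB m) (e0 : E m) : CB (tot E) (Tot e0) :=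
  the (0 : CB (tot E) (Tot e0)) (fun w => forall (nu : section AB) (e : section E),
    smooth_section nu -> smooth_section e -> nu m = u -> e m = e0 ->
    w = sigma_value nu e m).

Definition L_Delta (x : tot E) : set (CB (tot E) x) :=
  match x with Tot m e => range (fun u : AB m => Sigma u e) end.

(* T^qE + (T^qE)^o                                                            *)
Definition vertical (x : tot E) : set (TB (tot E) x) :=
  [set v | tangent_map proj x v = 0].

Definition vertical_sum_ann (x : tot E) : set (CB (tot E) x) :=
  [set w | vertical w.1 /\ forall v, vertical v -> ev w.2 v = 0].

(* Phi_E = (Tq_E, r_E)                                                        *)
Definition r_E {m : M} {e : E m} (theta : TsB (tot E) (Tot e)) : dual E m :=
  linfun (fun e' : E m => ev theta (vlift e e') : R^o).

Definition Phi_E {m : M} {e : E m} (w : CB (tot E) (Tot e)) : AB m :=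
  (tangent_map proj (Tot e : tot E) w.1, r_E w.2).

(* The fibred product of E with itself over M is the total space of E + E,    *)
(* and the addition of TE -> TM is T(add), read through (T fst, T snd).       *)
Definition fadd (x : tot (dsum E E)) : tot E :=
  Tot ((vec x : E (base x) * E (base x)).1
       + (vec x : E (base x) * E (base x)).2).
Definition ffst (x : tot (dsum E E)) : tot E :=
  Tot (vec x : E (base x) * E (base x)).1.
Definition fsnd (x : tot (dsum E E)) : tot E :=
  Tot (vec x : E (base x) * E (base x)).2.

Definition fpair {m : M} (e e' : E m) : tot (dsum E E) :=
  Tot (F := dsum E E) (base := m) (e, e').

Definition is_tangent_sum {m : M} (e e' : E m) (v : TB (tot E) (Tot e))
    (w : TB (tot E) (Tot e')) (u : TB (tot E) (Tot (e + e'))) : Prop :=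
  exists z : TB (tot (dsum E E)) (fpair e e'),
    [/\ tangent_map ffst (fpair e e') z = v,
        tangent_map fsnd (fpair e e') z = w &
        tangent_map fadd (fpair e e') z = u].

Definition is_cotangent_sum {m : M} (e e' : E m) (theta : TsB (tot E) (Tot e))
    (omega : TsB (tot E) (Tot e')) (sigma : TsB (tot E) (Tot (e + e'))) : Prop :=
  forall v w u, is_tangent_sum v w u -> ev sigma u = ev theta v + ev omega w.

Definition is_linear_subbundle (D : forall x : tot E, set (CB (tot E) x)) :
    Prop :=
  [/\ is_subbundle D,
      is_subbundle (E := AB) (fun m => [set u | exists (e : E m)
        (w : CB (tot E) (Tot e)), D (Tot e) w /\ Phi_E w = u]) &
      forall m (e e' : E m) (w : CB (tot E) (Tot e))
             (w' : CB (tot E) (Tot e')) (s : CB (tot E) (Tot (e + e'))),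
        D (Tot e) w -> D (Tot e') w' -> Phi_E w = Phi_E w' ->
        is_tangent_sum w.1 w'.1 s.1 -> is_cotangent_sum w.2 w'.2 s.2 ->
        D (Tot (e + e')) s].

End Dorfman.

(* Main.v *)
From HB Require Import structures.
Require Import Defs.
From mathcomp Require Import all_boot all_order all_algebra.
From mathcomp Require Import all_classical all_reals all_analysis.
From mathcomp Require Import finmap ring lra.
Set Implicit Arguments.
Unset Strict Implicit.
Unset Printing Implicit Defensive.
Import Order.TTheory GRing.Theory Num.Theory.
Import numFieldNormedType.Exports.
Local Open Scope classical_set_scope.
Local Open Scope ring_scope.

(** Fix a point m of M, sections nu1 = (X1, eps1) and nu2 = (X2, eps2) of TM + E^* and
    a section e of E. In a chart, the tangent part of Sigma (nu, e) is X together with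
    the derivative of e along X minus the E-part of Delta_nu (e, 0), and its cotangent
    part is d ell_eps minus the pull-back of the T^*M-part of Delta_nu (e, 0). When two
    such elements are paired, the derivatives of e and of the eps_i recombine, by the
    Leibniz rule, into X2 <nu1, (e, 0)> + X1 <nu2, (e, 0)>, and the result is
    [cpair_sigma]:
      < Sigma (nu1, e), Sigma (nu2, e) > = < [[nu1, nu2]] + [[nu2, nu1]], (e, 0) >.
    So L_Delta is isotropic if the dull bracket is skew-symmetric. Conversely, isotropy
    says that B = [[nu1, nu2]] + [[nu2, nu1]] pairs to zero with all (e, 0). The other
    elements (0, theta) of E + T^*M are, at m, of the form (0, df), and on these the
    rule Delta_nu (0, df) = (0, d(X(f))) turns the pairing with [[nu1, nu2]] into
    X1(X2(f)) - X2(X1(f)), so that B pairs to zero with them as well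
    ([dull_fun_exact]); as the pairing is non-degenerate, B = 0. This is [skew_isotropic].

    Sigma and the dull bracket are both characterised through global sections, and one
    must know that the values at a point depend only on the values of the sections at
    that point. This is the tensoriality principle [tensorial], proved with bump
    functions; by the rules for Delta_(f nu) and Delta_nu (f tau), the derivatives of
    the scaling functions cancel.

    The rest is linear algebra in each fibre. The map Phi_E has the linear section
    Sigma ( . , e) ([Phi_E_Sigma]), and its kernel is the sum of the vertical space and
    its annihilator; this kernel consists of the core lifts. Hence L_Delta is a
    complement of the kernel. Core lifts are adjoint to Phi_E, in the sense that
      < core_lift tau, w > = < Phi_E w, tau >   ([cpair_core_lift]),
    so the kernel is its own orthogonal. If L_Delta is isotropic and w is orthogonal
    to it, then Sigma (Phi_E w) - w is a core lift orthogonal to L_Delta, hence zero: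
    L_Delta is its own orthogonal as well ([L_orth]), in particular maximally isotropic.

    It remains to check what involves smoothness. In charts of E that come from a
    trivialisation, the sections of the vertical structure are those whose components
    in fixed positions vanish identically, which the Courant-Dorfman bracket preserves
    ([vertical_dirac]); Delta_nu (e, 0) is linear in the constant coordinates of e, so that L_Delta has
    smooth frames ([smooth_Sigma]); and the addition over TM + E^* adds the fibre
    components, while Sigma (nu, e) is linear in e in the same coordinates
    ([L_add_closed]). *)

(** * Calculus of smooth maps between normed spaces *)

Section Calculus.
Context {R : realType}.

(** The basis for locality: adding a function that vanishes near x leaves the
    differential at x unchanged. *)
Lemma is_diff_near0 (V W : normedModType R) (h : V -> W) (x : V) :
  (\forall y \near x, h y = 0) -> is_diff x h 0.
Proof.
move=> hz.
have hx : h x = 0 by exact: nbhs_singleton hz.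
have E : h \o shift x = cst (h x) + \0 +o_ 0 id.
  apply/eqaddoP => _/posnumP[e].
  have := hz; rewrite (near_shift 0) subr0 => hz'.
  near=> y; rewrite /= hx /cst/= !fctE addr0 subr0.
  have -> : h (y + x) = 0 by near: y; exact: hz'.
  by rewrite normr0 mulr_ge0.
have D : 'd h x = \0 :> (V -> W) by apply: diff_unique => //; exact: cst_continuous.
apply: DiffDef => //; apply/diff_locallyP; rewrite D; split => //.
exact: cst_continuous.
Unshelve. all: by end_near. Qed.

Lemma near_eq_is_diff (V W : normedModType R) (f g : V -> W) (x : V) :
  (\forall y \near x, f y = g y) -> differentiable f x ->
  is_diff x g ('d f x).
Proof.
move=> fg df.
have h0 : is_diff x (g - f) 0.
  apply: is_diff_near0; apply: filterS fg => y E.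
  by rewrite !fctE E subrr.
have -> : g = f + (g - f) by rewrite addrC subrK.
have Hf : is_diff x f ('d f x) by apply: DiffDef.
have := is_diffD Hf h0; rewrite addr0; exact.
Qed.

Lemma is_diff_coord (V : normedModType R) n (f : V -> 'rV[R]_n) x i :
  differentiable f x ->
  is_diff x (fun y => f y ord0 i : R^o) (fun v => 'd f x v ord0 i).
Proof.
move=> df.
have @c : {linear 'rV[R]_n -> R^o}.
  by exists (fun N : 'rV[R]_n => N ord0 i); do 2![eexists]; do ?[constructor];
     rewrite ?mxE// => ? *; rewrite ?mxE//; move=> ?; rewrite !mxE.
have cc : continuous c by move=> y; exact: coord_continuous.
have Hf : is_diff x f ('d f x) by apply: DiffDef.
have Hc : is_diff (f x) c c.
  by apply: DiffDef; [exact: linear_differentiable|exact: diff_lin].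
exact: (@is_diff_comp _ _ _ _ f ('d f x) c c x).
Qed.

Lemma diff_coord (V : normedModType R) n (f : V -> 'rV[R]_n) x i v :
  differentiable f x ->
  'd f x v ord0 i = 'd (fun y => f y ord0 i : R^o) x v.
Proof. by move=> df; have H := is_diff_coord i df; rewrite diff_val. Qed.

Lemma row_decomp (V : normedModType R) n (f : V -> 'rV[R]_n) :
  f = \sum_(i < n) (fun y => (f y ord0 i : R) *: (delta_mx 0 i : 'rV[R]_n)).
Proof.
apply/funext => y; rewrite fct_sumE.
by rewrite [LHS]row_sum_delta.
Qed.

Lemma differentiable_rV (V : normedModType R) n (f : V -> 'rV[R]_n) x :
  (forall i, differentiable (fun y => f y ord0 i : R^o) x) ->
  differentiable f x.
Proof.
move=> df; rewrite (row_decomp f); apply: differentiable_sum => i.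
by apply: differentiableZl; apply: df.
Qed.

Lemma continuous_rV (V : normedModType R) n (f : V -> 'rV[R]_n) x :
  (forall i, {for x, continuous (fun y => f y ord0 i : R^o)}) ->
  {for x, continuous f}.
Proof.
move=> cf; rewrite (row_decomp f).
rewrite (_ : \sum_(_ < _) _ = fun y => \sum_(i < n) (f y ord0 i : R) *:
    (delta_mx 0 i : 'rV[R]_n)); last first.
  by apply/funext => y; rewrite fct_sumE.
rewrite /prop_for /continuous_at; apply: cvg_big; first exact: add_continuous.
by move=> i _; apply: cvgZr_tmp; exact: cf.
Qed.

Lemma Ck_sub (V W : normedModType R) k (U U' : set V) (f : V -> W) :
  U `<=` U' -> Ck k U' f -> Ck k U f.
Proof.
elim: k f => [|k IH] f UU' /=; first by move=> H x /UU'; exact: H.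
by move=> [H1 H2]; split=> [x /UU'|v]; [exact: H1|exact: IH].
Qed.

Lemma Ck_local (V W : normedModType R) k (U : set V) (f : V -> W) :
  (forall x, U x -> exists2 U', U' x & Ck k U' f) -> Ck k U f.
Proof.
elim: k f => [|k IH] f H /=; first by move=> x /H[U' U'x]; exact.
split=> [x /H[U' U'x] [] + _|v]; first exact.
by apply: IH => x /H[U' U'x] [] _ /(_ v) ?; exists U'.
Qed.

Lemma eq_Ck (V W : normedModType R) k (U : set V) (f g : V -> W) :
  open U -> (forall x, U x -> f x = g x) -> Ck k U f -> Ck k U g.
Proof.
move=> oU; elim: k f g => [|k IH] f g fg /=.
  move=> cf x Ux; have := cf x Ux; rewrite /prop_for /continuous_at /= -(fg x Ux).
  apply: cvg_trans; apply: near_eq_cvg.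
  by near=> y; rewrite fg//; near: y; exact: open_nbhs_nbhs.
move=> [H1 H2].
have H x : U x -> is_diff x g ('d f x).
  move=> Ux; apply: near_eq_is_diff; last exact: H1.
  by near=> y; rewrite fg//; near: y; exact: open_nbhs_nbhs.
split=> [x /H[]//|v].
apply: IH (H2 v) => x /H dg; by rewrite diff_val.
Unshelve. all: by end_near. Qed.

Lemma CkS (V W : normedModType R) k (U : set V) (f : V -> W) :
  Ck k.+1 U f -> Ck k U f.
Proof.
elim: k f => [|k IH] f [H1 H2] /=.
  by move=> x Ux; apply: differentiable_continuous; exact: H1.
by split => // v; apply: IH.
Qed.

Lemma Ck_cst (V W : normedModType R) k (U : set V) (a : W) :
  Ck k U (fun _ : V => a).
Proof.
elim: k a => [|k IH] a /=; first by move=> x _; exact: cst_continuous.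
split=> [x _|v]; first exact: differentiable_cst.
have -> : (fun x : V => 'd (fun _ : V => a) x v) = (fun=> 0).
  by apply/funext => x; rewrite diff_cst.
exact: IH.
Qed.

Lemma CkD (V W : normedModType R) k (U : set V) (f g : V -> W) :
  open U -> Ck k U f -> Ck k U g -> Ck k U (fun x => f x + g x).
Proof.
move=> oU; elim: k f g => [|k IH] f g /=.
  by move=> cf cg x Ux; apply: cvgD; [exact: cf|exact: cg].
move=> [f1 f2] [g1 g2]; split=> [x Ux|v].
  by apply: differentiableD; [exact: f1|exact: g1].
apply: eq_Ck (IH _ _ (f2 v) (g2 v)) => // x Ux.
by rewrite [RHS](congr1 (fun h => h v) (diffD (f1 x Ux) (g1 x Ux))).
Qed.

Lemma Ck_sum (V W : normedModType R) k (U : set V) I (r : seq I) (P : pred I)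
    (f : I -> V -> W) :
  open U -> (forall i, P i -> Ck k U (f i)) ->
  Ck k U (fun x => \sum_(i <- r | P i) f i x).
Proof.
move=> oU cf.
have -> : (fun x => \sum_(i <- r | P i) f i x) = \sum_(i <- r | P i) f i.
  by apply/funext => x; rewrite fct_sumE.
elim/big_rec : _ => [|i g Pi cg]; first exact: Ck_cst.
by apply: CkD => //; exact: cf.
Qed.

Lemma is_diff_scale (V W : normedModType R) (f : V -> R^o) (g : V -> W) x :
  differentiable f x -> differentiable g x ->
  is_diff x (fun y => f y *: g y)
    (fun v => f x *: 'd g x v + 'd f x v *: g x).
Proof.
move=> df dg.
have bl : bilinear_for
    (GRing.Scale.Law.clone _ _ *:%R _) (GRing.Scale.Law.clone _ _ *:%R _)
    (fun (a : R^o) (w : W) => a *: w).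
  split=> [u'|u] a y z /=; first by rewrite scalerDl -scalerA.
  by rewrite scalerDr !scalerA mulrC.
pose bM := bilinear_isBilinear.Build R R^o W W _ _ (fun (a : R^o) (w : W) => a *: w) bl.
pose B : {bilinear R^o -> W -> W} := HB.pack (fun (a : R^o) (w : W) => a *: w) bM.
have cB : continuous (fun p : R^o * W => B p.1 p.2) by exact: scale_continuous.
have Hp := is_diff_pair (differentiableP df) (differentiableP dg).
have HB : is_diff (f x, g x) (fun p : R^o * W => B p.1 p.2)
   (fun q => B (f x) q.2 + B q.1 (g x)).
  by apply: DiffDef; [exact: differentiable_bilin|exact: diff_bilin].
exact: (@is_diff_comp _ _ _ _ _ _ _ _ x Hp HB).
Qed.

Lemma CkZ (V W : normedModType R) k (U : set V) (f : V -> R^o) (g : V -> W) :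
  open U -> Ck k U f -> Ck k U g -> Ck k U (fun x => f x *: g x).
Proof.
move=> oU; elim: k f g => [|k IH] f g.
  by move=> cf cg x Ux; apply: cvgZ; [exact: cf|exact: cg].
move=> Cf Cg; have := Cf; have := Cg; move=> [g1 g2] [f1 f2]; split=> [x Ux|v].
  by have [] := is_diff_scale (f1 x Ux) (g1 x Ux).
have := CkD oU (IH _ _ (CkS Cf) (g2 v)) (IH _ _ (f2 v) (CkS Cg)).
apply: eq_Ck => // x Ux.
by have H := is_diff_scale (f1 x Ux) (g1 x Ux); rewrite diff_val.
Qed.

Lemma CkM (V : normedModType R) k (U : set V) (f g : V -> R^o) :
  open U -> Ck k U f -> Ck k U g -> Ck k U (fun x => f x * g x : R^o).
Proof. exact: CkZ. Qed.

Lemma Ck_rV (V : normedModType R) k (U : set V) n (f : V -> 'rV[R]_n) :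
  open U ->
  Ck k U f <-> forall i, Ck k U (fun x => f x ord0 i : R^o).
Proof.
move=> oU; elim: k f => [|k IH] f.
  split=> [cf i x Ux|cf x Ux]; last by apply: continuous_rV => i; exact: cf.
  apply: (@continuous_comp _ _ _ f (fun v : 'rV_n => v ord0 i)); first exact: cf.
  exact: coord_continuous.
split=> [[f1 f2] i|cf].
  split=> [x Ux|v]; first by have [] := is_diff_coord i (f1 x Ux).
  have [H _] := IH (fun x => 'd f x v).
  apply: eq_Ck (H (f2 v) i) => // x Ux.
  by rewrite diff_coord//; exact: f1.
have df x : U x -> differentiable f x.
  by move=> Ux; apply: differentiable_rV => i; have [+ _] := cf i; exact.
split=> // v; apply/IH => i.
have [_ /(_ v) H] := cf i.
by apply: eq_Ck H => // x Ux; rewrite -diff_coord//; exact: df.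
Qed.

Lemma linear_row (W : lmodType R) n (f : {linear 'rV[R]_n -> W}) v :
  f v = \sum_(i < n) v ord0 i *: f (delta_mx 0 i).
Proof. by rewrite {1}[v]row_sum_delta linear_sum; under eq_bigr do rewrite linearZ. Qed.

Lemma linear_rV_continuous (W : normedModType R) n (f : {linear 'rV[R]_n -> W}) :
  continuous f.
Proof.
move=> x.
have -> : (f : _ -> _) = (fun v : 'rV[R]_n => \sum_(i < n) v ord0 i *: f (delta_mx 0 i)).
  by apply/funext => v; rewrite linear_row.
apply: (@cvg_big _ _ _ _ _ _ _ (nbhs (x : 'rV[R]_n))) => [|i _]; first exact: add_continuous.
by apply: cvgZr_tmp; exact: coord_continuous.
Qed.

Lemma is_diff_linear (W : normedModType R) n (f : {linear 'rV[R]_n -> W}) x :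
  is_diff x f f.
Proof.
have cf := @linear_rV_continuous _ _ f.
by apply: DiffDef; [exact: linear_differentiable|exact: diff_lin].
Qed.

Lemma Ck_linear (W : normedModType R) n k U (f : {linear 'rV[R]_n -> W}) : Ck k U f.
Proof.
case: k => [|k]; first by move=> x _; exact: linear_rV_continuous.
split=> [x _|v]; first by have [] := is_diff_linear f x.
have -> : (fun x => 'd f x v) = fun=> f v; last exact: Ck_cst.
by apply/funext => x; have H := is_diff_linear f x; rewrite diff_val.
Qed.

(** By the chain rule the derivative of g \o f along v is the sum over i of the
    i-th coordinate of 'd f x v times 'd g (f x) 'e_i, so that the induction goes
    through products of lower-order maps. *)
Lemma Ck_comp (V : normedModType R) k n (U : set V) (U' : set 'rV[R]_n)
    (W : normedModType R) (f : V -> 'rV[R]_n) (g : 'rV[R]_n -> W) :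
  open U -> (forall x, U x -> U' (f x)) ->
  Ck k U f -> Ck k U' g -> Ck k U (g \o f).
Proof.
move=> oU UU'; elim: k g => [|k IH] g.
  move=> cf cg x Ux; apply: continuous_comp; first exact: cf.
  by apply: cg; exact: UU'.
move=> Cf [g1 g2]; have [f1 f2] := Cf; split=> [x Ux|v].
  by apply: differentiable_comp; [exact: f1|apply: g1; exact: UU'].
apply: (@eq_Ck _ _ _ _ (fun x => \sum_(i < n) ('d f x v ord0 i *: 'd g (f x)
    (delta_mx 0 i)))) => //.
  move=> x Ux.
  rewrite [RHS](congr1 (fun h => h v) (diff_comp (f1 x Ux) (g1 _ (UU' _ Ux)))).
  by rewrite [RHS]/= linear_row.
apply: Ck_sum => // i _; apply: CkZ => //.
  by have /(Ck_rV _ _ oU) := f2 v; exact.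
exact: (IH (fun y => 'd g y (delta_mx 0 i)) (CkS Cf) (g2 _)).
Qed.

Lemma Ck_comp1 (V : normedModType R) k (U : set V) (f : V -> R^o) (g : R^o -> R^o) :
  open U -> Ck k U f -> Ck k setT g -> Ck k U (g \o f).
Proof.
move=> oU; elim: k g => [|k IH] g.
  move=> cf cg x Ux; apply: continuous_comp; first exact: cf.
  exact: cg.
move=> Cf [g1 g2]; have [f1 f2] := Cf; split=> [x Ux|v].
  by apply: differentiable_comp; [exact: f1|exact: g1].
apply: (@eq_Ck _ _ _ _ (fun x => ('d f x v * 'd g (f x) 1))) => //.
  move=> x Ux; rewrite [RHS](congr1 (fun h => h v) (diff_comp (f1 x Ux) (g1 _ I))).
  rewrite [RHS]/=; transitivity ('d g (f x) ('d f x v *: (1 : R^o))).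
    by rewrite linearZ.
  by congr ('d g (f x) _); exact: mulr1.
apply: CkM => //.
  exact: f2.
exact: (IH (fun y => 'd g y 1) (CkS Cf) (g2 _)).
Qed.

(** * Smooth functions of small support on R^n *)

(** The family x^-k exp(-1/x), extended by 0: it is stable under differentiation,
    as (flat k)' = flat (k+2) - k flat (k+1), and smoothness of all its members
    follows by one induction. *)
Definition flat (k : nat) (x : R) : R :=
  if 0 < x then (x^-1) ^+ k * expR (- x^-1) else 0.

Lemma flat0 k x : x <= 0 -> flat k x = 0.
Proof. by rewrite /flat ltNge => ->. Qed.

Lemma flat_ge0 k x : 0 <= flat k x.
Proof.
rewrite /flat; case: ifPn => // x0.
by rewrite mulr_ge0 ?expR_ge0// exprn_ge0// invr_ge0 ltW.
Qed.

Lemma flat_gt0 x : 0 < x -> 0 < flat 0 x.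
Proof. by move=> x0; rewrite /flat x0 expr0 mul1r expR_gt0. Qed.

Lemma flat_le x y : x <= y -> flat 0 x <= flat 0 y.
Proof.
move=> xy; rewrite {1}/flat; case: ifPn => [x0|_]; last exact: flat_ge0.
rewrite /flat (lt_le_trans x0 xy) !expr0 !mul1r ler_expR lerN2 lef_pV2//.
by rewrite posrE (lt_le_trans x0 xy).
Qed.

(** The bound y^(k+2)/(k+2)! <= exp y, at y = 1/x, gives a quadratic decay at 0,
    hence a vanishing derivative there. *)
Lemma flat_quadratic k : {C : R | 0 < C & forall x, `|flat k x| <= C * `|x| ^+ 2}.
Proof.
exists ((k.+2)`!%:R); first by rewrite ltr0n fact_gt0.
move=> x; rewrite ger0_norm ?flat_ge0//.
have [x0|x0] := leP x 0; first by rewrite flat0// mulr_ge0// exprn_ge0.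
rewrite /flat x0 gtr0_norm//.
set y := x^-1.
have y0 : 0 < y by rewrite invr_gt0.
have E : y ^+ k.+2 / (k.+2)`!%:R <= expR y.
  by apply: le_trans (expR_ge1Dxn k.+1 (ltW y0)); rewrite lerDr.
have p0 : 0 < y ^+ k.+2 / (k.+2)`!%:R by rewrite divr_gt0 ?exprn_gt0// ltr0n fact_gt0.
have E2 : expR (- y) <= (k.+2)`!%:R / y ^+ k.+2.
  by rewrite expRN -invf_div lef_pV2// posrE ?expR_gt0.
apply: le_trans (ler_wpM2l _ E2) _; first by rewrite exprn_ge0// ltW.
move: {E p0 E2} (_`!%:R) => C.
rewrite -(addn2 k) exprD le_eqVlt; apply/orP; left; apply/eqP.
have yk : y ^+ k != 0 by rewrite expf_eq0 gt_eqF// andbF.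
have -> : x = y^-1 by rewrite invrK.
by field; rewrite yk gt_eqF.
Qed.

Lemma is_diff_quadratic (h : R^o -> R^o) C :
  0 < C -> (forall x, `|h x| <= C * `|x| ^+ 2) -> is_diff (0 : R^o) h 0.
Proof.
move=> C0 hC.
have h0 : h 0 = 0.
  by apply/eqP; rewrite -normr_le0; apply: le_trans (hC 0) _; rewrite normr0 expr0n mulr0.
have E : h \o shift 0 = cst (h 0) + \0 +o_ (0 : R^o) id.
  apply/eqaddoP => _/posnumP[e].
  near=> y.
  have -> : (h \o shift (0 : R^o) - (cst (h 0) + \0)) y = h y.
    by rewrite !fctE /= h0 !addr0 subr0.
  apply: le_trans (hC y) _; rewrite expr2 mulrA ler_wpM2r//.
  rewrite -ler_pdivlMl//.
  near: y; apply: (@nbhs0_le _ R^o); by rewrite mulr_gt0 ?invr_gt0.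
have D : 'd h (0 : R^o) = \0 :> (R^o -> R^o) by apply: diff_unique => //; exact: cst_continuous.
apply: DiffDef => //; apply/diff_locallyP; rewrite D; split => //.
exact: cst_continuous.
Unshelve. all: by end_near. Qed.

Lemma is_derive1_is_diff (f : R^o -> R^o) (x d : R) :
  is_derive (x : R^o) 1 f d -> is_diff (x : R^o) f (fun v : R^o => v * d : R^o).
Proof.
move=> H.
have dx : derivable f x 1 by [].
apply: DiffDef; first exact/derivable1_diffP.
by rewrite deriv1E// derive1E derive_val.
Qed.

Lemma is_diff_flat k x :
  is_diff (x : R^o) (flat k : R^o -> R^o)
    (fun v : R^o => v * (flat k.+2 x - k%:R * flat k.+1 x) : R^o).
Proof.
have [x0|x0|->] := ltgtP x 0; last 1 first.
- have [C C0 hC] := flat_quadratic k.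
  have := is_diff_quadratic C0 hC; rewrite !flat0// mulr0 subrr.
  by congr (is_diff_def _ _ _); apply/funext => v; rewrite mulr0.
- rewrite !flat0 ?(ltW x0)// mulr0 subrr.
  have : is_diff (x : R^o) (flat k : R^o -> R^o) 0.
    apply: is_diff_near0; near=> y; apply: flat0; apply: ltW; near: y.
    exact: lt_nbhsl.
  by congr (is_diff_def _ _ _); apply/funext => v; rewrite mulr0.
- set d := flat k.+2 x - k%:R * flat k.+1 x.
  have xn0 : x != 0 by rewrite gt_eqF.
  have H : is_derive (x : R^o) 1 (fun y : R^o => (y^-1) ^+ k * expR (- y^-1) : R^o) d.
    have xV : is_derive (x : R) 1 (fun y : R => y^-1) (- x ^- 2).
      have := @is_deriveV _ id x 1 1 xn0 (is_derive_id _ _).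
      by move=> H; apply: (is_derive_eq H); rewrite /GRing.scale/= mulr1.
    have xN : is_derive (x : R) 1 (fun y : R => - y^-1) (x ^- 2).
      by have := is_deriveN xV; rewrite opprK.
    have xE := @is_derive1_comp _ expR (fun y => - y^-1) x _ _ (is_derive_expR (- x^-1)) xN.
    have xk := is_deriveX k xV.
    have := is_deriveM xk xE.
    have -> : ((fun y : R => y^-1) ^+ k) * (expR \o (fun y : R => - y^-1)) =
      (fun y : R => (y^-1) ^+ k * expR (- y^-1)).
      by apply/funext => y; rewrite !fctE.
    move=> H; apply: (is_derive_eq H).
    rewrite /d /flat x0 !fctE /GRing.scale/= -!exprVn; set z := x^-1.
    case: (k) => [|k'] /=; rewrite ?exprS; ring.
  have H2 := is_derive1_is_diff H.
  rewrite -(@diff_val _ _ _ _ _ _ _ H2).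
  apply: near_eq_is_diff; last by have [] := H2.
  near=> y; rewrite /flat; suff -> : 0 < y by [].
  near: y; exact: lt_nbhsr.
Unshelve. all: by end_near. Qed.

Lemma Ck_flat n k : Ck n setT (flat k : R^o -> R^o).
Proof.
elim: n k => [|n IH] k.
  move=> x _; apply: differentiable_continuous.
  by have [] := is_diff_flat k x.
split=> [x _|v]; first by have [] := is_diff_flat k x.
rewrite (_ : (fun x => _) = fun x => v * (flat k.+2 x + (- k%:R) * flat k.+1 x)).
  apply: CkM; [exact: openT|exact: Ck_cst|].
  apply: CkD; [exact: openT|exact: IH|].
  apply: CkM; [exact: openT|exact: Ck_cst|exact: IH].
apply/funext => x; have H := is_diff_flat k x; rewrite diff_val.
by rewrite mulNr.
Qed.

(** With Q the squared distance to a, the function flat 0 (Q - r^2) vanishes for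
    Q < r^2 and is at least c = flat 0 (r^2) for Q >= 2 r^2; composing c minus this
    function with flat 0, and normalising, gives a function that is 1 near a and
    vanishes away from a. *)
Lemma rV_bump n (a : 'rV[R]_n) (U : set 'rV[R]_n) : open U -> U a ->
  exists (b : 'rV[R]_n -> R^o) (V K : set 'rV[R]_n),
    [/\ open V, V a, compact K, K `<=` U &
      [/\ forall y, V y -> b y = 1, forall y, ~ K y -> b y = 0 & Cinf setT b]].
Proof.
move=> oU Ua.
have /nbhs_ballP[e /= e0 eU] : nbhs a U by exact: open_nbhs_nbhs.
(* a box of half-width 2 r around a then lies in the ball of radius e *)
pose r := e / 4.
have r0 : 0 < r by rewrite divr_gt0.
pose Q (y : 'rV[R]_n) : R^o := \sum_(i < n) (y ord0 i - a ord0 i) * (y ord0 i - a ord0 i).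
have CQ : Cinf setT Q.
  move=> k; apply: Ck_sum => [|i _]; first exact: openT.
  have H : Ck k setT (fun y : 'rV[R]_n => y ord0 i - a ord0 i : R^o).
    apply: CkD; [exact: openT| |exact: Ck_cst].
    have := @Ck_linear _ n k setT (idfun : {linear 'rV[R]_n -> 'rV[R]_n}).
    by move/(Ck_rV _ _ openT); exact.
  by apply: CkM => //; exact: openT.
pose c := flat 0 (r ^+ 2).
have c0 : 0 < c by rewrite flat_gt0// exprn_gt0.
have fc0 : flat 0 c != 0 by rewrite gt_eqF// flat_gt0.
have Qa : Q a = 0 by rewrite /Q big1// => i _; rewrite subrr mulr0.
exists (fun y => flat 0 (c - flat 0 (Q y - r ^+ 2)) / flat 0 c).
exists [set y | Q y < r ^+ 2].
exists [set y : 'rV[R]_n | forall i, `[a ord0 i - 2 * r, a ord0 i + 2 * r]%classic (y ord0 i)].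
split.
- apply: (@open_comp _ _ Q [set z | z < r ^+ 2]); last exact: open_lt.
  by move=> y _; exact: (CQ 0).
- by rewrite /= Qa exprn_gt0.
- apply: (@rV_compact _ _ (fun i => `[a ord0 i - 2 * r, a ord0 i + 2 * r]%classic)) => i;
    exact: segment_compact.
- move=> y /= yK; apply: eU; split=> // i j; rewrite (ord1 i) /ball/=.
  have := yK j; rewrite /= in_itv/= => /andP[y1 y2].
  rewrite distrC ltr_distl; apply/andP; split.
    apply: lt_le_trans y1; rewrite ltrD2l ltrN2 /r; lra.
  apply: le_lt_trans y2 _; rewrite ltrD2l /r; lra.
- split.
  + move=> y /= Qy; rewrite [X in c - X]flat0 ?subr_le0 ?ltW// subr0 divff//.
  + move=> y /=.
    move=> /existsNP[i]; rewrite /= in_itv/= => /negP yi.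
    rewrite flat0 ?mul0r// subr_le0; apply: flat_le.
    rewrite lerBrDl -mulr2n.
    apply: (@le_trans _ _ ((y ord0 i - a ord0 i) * (y ord0 i - a ord0 i))).
      have [h|h] := leP (a ord0 i - 2 * r) (y ord0 i).
        move: yi; rewrite h /= -ltNge => h2; nra.
      nra.
    rewrite /Q (bigD1 i)//= lerDl sumr_ge0// => j _.
    by rewrite -expr2 sqr_ge0.
  + move=> k; apply: CkM; [exact: openT| |exact: Ck_cst].
    have CN (f : 'rV[R]_n -> R^o) : Ck k setT f -> Ck k setT (fun y => - f y : R^o).
      move=> Cf; rewrite (_ : (fun y => _) = (fun y => (-1) * f y)).
        by apply: CkM => //; [exact: openT|exact: Ck_cst].
      by apply/funext => y; rewrite mulN1r.
    apply: (Ck_comp1 (g := flat 0)); [exact: openT| |exact: Ck_flat].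
    apply: CkD; [exact: openT|exact: Ck_cst|].
    apply: CN; apply: (Ck_comp1 (g := flat 0)); [exact: openT| |exact: Ck_flat].
    apply: CkD; [exact: openT|exact: CQ|exact: Ck_cst].
Qed.

(** * Rules for C^oo maps, and differentials in coordinates *)

Section CinfTheory.
Context {V W : normedModType R}.
Implicit Types (U : set V).

Lemma Cinf_sub U U' (f : V -> W) : U `<=` U' -> Cinf U' f -> Cinf U f.
Proof. by move=> UU' H k; apply: Ck_sub UU' (H k). Qed.

Lemma Cinf_local U (f : V -> W) :
  (forall x, U x -> exists2 U', U' x & Cinf U' f) -> Cinf U f.
Proof. by move=> H k; apply: Ck_local => x /H[U' U'x /(_ k)]; exists U'. Qed.

Lemma eq_Cinf U (f g : V -> W) :
  open U -> (forall x, U x -> f x = g x) -> Cinf U f -> Cinf U g.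
Proof. by move=> oU fg H k; apply: eq_Ck (H k). Qed.

Lemma Cinf_cst U (a : W) : Cinf U (fun=> a).
Proof. by move=> k; exact: Ck_cst. Qed.

Lemma CinfD U (f g : V -> W) : open U ->
  Cinf U f -> Cinf U g -> Cinf U (fun x => f x + g x).
Proof. by move=> oU Cf Cg k; apply: CkD. Qed.

Lemma CinfZ U (f : V -> R^o) (g : V -> W) : open U ->
  Cinf U f -> Cinf U g -> Cinf U (fun x => f x *: g x).
Proof. by move=> oU Cf Cg k; apply: CkZ. Qed.

Lemma CinfN U (g : V -> W) : open U -> Cinf U g -> Cinf U (fun x => - g x).
Proof.
move=> oU Cg; have := CinfZ oU (fun k => @Ck_cst V R^o k U (-1)) Cg.
by apply: eq_Cinf => // x _; rewrite scaleN1r.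
Qed.

Lemma Cinf_sum U I (r : seq I) (P : pred I) (f : I -> V -> W) : open U ->
  (forall i, P i -> Cinf U (f i)) ->
  Cinf U (fun x => \sum_(i <- r | P i) f i x).
Proof. by move=> oU H k; apply: Ck_sum => // i /H. Qed.

Lemma Cinf_differentiable U (f : V -> W) x :
  Cinf U f -> U x -> differentiable f x.
Proof. by move=> /(_ 1%N)[+ _]; exact. Qed.

Lemma Cinf_continuous U (f : V -> W) x :
  Cinf U f -> U x -> {for x, continuous f}.
Proof. by move=> /(_ 0%N); exact. Qed.

Lemma Cinf_diff U (f : V -> W) v : Cinf U f -> Cinf U (fun x => 'd f x v).
Proof. by move=> Cf k; have [_] := Cf k.+1; exact. Qed.

End CinfTheory.

Lemma Cinf_rV (V : normedModType R) (U : set V) n (f : V -> 'rV[R]_n) :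
  open U -> Cinf U f <-> forall i, Cinf U (fun x => f x ord0 i : R^o).
Proof.
move=> oU; split=> [H i k|H k]; first by have /(Ck_rV _ _ oU) := H k; exact.
by apply/(Ck_rV _ _ oU) => i; exact: H.
Qed.

Lemma Cinf_linear (W : normedModType R) n U (f : {linear 'rV[R]_n -> W}) : Cinf U f.
Proof. by move=> k; exact: Ck_linear. Qed.

Lemma Cinf_id n U : Cinf U (fun x : 'rV[R]_n => x).
Proof. exact: (Cinf_linear U idfun). Qed.

Lemma Cinf_comp (V W : normedModType R) n (U : set V) (U' : set 'rV[R]_n)
    (f : V -> 'rV[R]_n) (g : 'rV[R]_n -> W) :
  open U -> (forall x, U x -> U' (f x)) ->
  Cinf U f -> Cinf U' g -> Cinf U (g \o f).
Proof. by move=> oU H Cf Cg k; apply: Ck_comp (Cf k) (Cg k). Qed.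

Lemma Cinf_lsubmx n m U : Cinf U (fun x : 'rV[R]_(n + m) => lsubmx x).
Proof. exact: (Cinf_linear U (lsubmx : {linear 'rV[R]_(n + m) -> 'rV[R]_n})). Qed.

Lemma Cinf_rsubmx n m U : Cinf U (fun x : 'rV[R]_(n + m) => rsubmx x).
Proof. exact: (Cinf_linear U (rsubmx : {linear 'rV[R]_(n + m) -> 'rV[R]_m})). Qed.

Lemma Cinf_row_mx (V : normedModType R) n m (U : set V)
    (f : V -> 'rV[R]_n) (g : V -> 'rV[R]_m) : open U ->
  Cinf U f -> Cinf U g -> Cinf U (fun x => row_mx (f x) (g x)).
Proof.
move=> oU /(Cinf_rV _ oU) Cf /(Cinf_rV _ oU) Cg; apply/(Cinf_rV _ oU) => i.
have [j ->|j ->] := split_ordP i.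
  by apply: eq_Cinf (Cf j) => // x _; rewrite row_mxEl.
by apply: eq_Cinf (Cg j) => // x _; rewrite row_mxEr.
Qed.

Lemma diff_row_mx (V : normedModType R) n m
    (f : V -> 'rV[R]_n) (g : V -> 'rV[R]_m) x v :
  differentiable f x -> differentiable g x ->
  'd (fun y => row_mx (f y) (g y)) x v = row_mx ('d f x v) ('d g x v).
Proof.
move=> df dg.
have dr : differentiable (fun y => row_mx (f y) (g y)) x.
  apply: differentiable_rV => i; have [j ->|j ->] := split_ordP i.
    under eq_fun do rewrite row_mxEl.
    by have [] := is_diff_coord j df.
  under eq_fun do rewrite row_mxEr.
  by have [] := is_diff_coord j dg.
apply/rowP => i; rewrite diff_coord//; have [j ->|j ->] := split_ordP i.
  by under eq_fun do rewrite row_mxEl; rewrite row_mxEl diff_coord.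
by under eq_fun do rewrite row_mxEr; rewrite row_mxEr diff_coord.
Qed.

Lemma diff_lin_comp (V W : normedModType R) n (f : V -> 'rV[R]_n)
    (g : {linear 'rV[R]_n -> W}) x v :
  differentiable f x -> 'd (fun y => g (f y)) x v = g ('d f x v).
Proof.
move=> df; have Hf := differentiableP df; have Hg := is_diff_linear g (f x).
have H := @is_diff_comp _ _ _ _ _ _ _ _ x Hf Hg.
by rewrite -[LHS]/('d (g \o f) x v) diff_val.
Qed.

Lemma eq_diff (V W : normedModType R) (U : set V) (f g : V -> W) x v :
  open U -> U x -> (forall y, U y -> f y = g y) -> differentiable f x ->
  'd f x v = 'd g x v.
Proof.
move=> oU Ux fg df.
have H : is_diff x g ('d f x).
  by apply: near_eq_is_diff => //; exact: filterS (open_nbhs_nbhs (conj oU Ux)).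
by rewrite [in RHS]diff_val.
Qed.

Lemma diff_chain (U V W : normedModType R) (f : U -> V) (g : V -> W) x y v :
  f x = y -> differentiable f x -> differentiable g y ->
  'd (g \o f) x v = 'd g y ('d f x v).
Proof. by move=> <- df dg; rewrite diff_comp. Qed.

Lemma open_preimage (V W : normedModType R) (U : set V) (U' : set W) (f : V -> W) :
  open U -> (forall x, U x -> {for x, continuous f}) -> open U' ->
  open (U `&` f @^-1` U').
Proof.
move=> oU cf oU'; rewrite openE => x [Ux U'x].
apply: filterI; first exact: open_nbhs_nbhs.
by apply: (cf x Ux); exact: open_nbhs_nbhs.
Qed.

End Calculus.

(** * Atlases, open sets and smooth functions *)

Section ManifoldTheory.
Context {R : realType} {n : nat} (M : premanifold R n).

(** The axioms of a manifold that concern charts only: they pass directly to total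
    spaces, and carry all of the calculus in coordinates. *)
Definition is_atlas : Prop :=
  [/\ forall x, atlas M (chart_at M x) /\ cdom (chart_at M x) x,
      (forall c x, atlas M c -> cdom c x -> cinv c (cmap c x) = x) &
      (forall c d, atlas M c -> atlas M d ->
         open (cmap c @` (cdom c `&` cdom d)) /\
         Cinf (cmap c @` (cdom c `&` cdom d)) (cmap d \o cinv c))].

Lemma manifold_atlas : is_manifold M -> is_atlas.
Proof. by case. Qed.

Hypothesis aM : is_atlas.
Implicit Types (U V : set M) (c d : chart R M n) (x y : M).

Lemma atlas_chart_at x : atlas M (chart_at M x).
Proof. by have [H _ _] := aM; case: (H x). Qed.

Lemma cdom_chart_at x : cdom (chart_at M x) x.
Proof. by have [H _ _] := aM; case: (H x). Qed.

Lemma cmapK c x : atlas M c -> cdom c x -> cinv c (cmap c x) = x.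
Proof. by have [_ H _] := aM; exact: H. Qed.

Definition cimg c U := cmap c @` (cdom c `&` U).

Lemma cimgP c U z : atlas M c ->
  cimg c U z <-> [/\ cdom c (cinv c z), U (cinv c z) & cmap c (cinv c z) = z].
Proof.
move=> ac; split=> [[x [cx Ux] <-]|[h1 h2 h3]]; first by rewrite cmapK.
by exists (cinv c z).
Qed.

Lemma cimg_cmap c U x : cdom c x -> U x -> cimg c U (cmap c x).
Proof. by move=> cx Ux; exists x. Qed.

Lemma cimg_sub c U V : U `<=` V -> cimg c U `<=` cimg c V.
Proof. by move=> UV _ [x [cx /UV Vx] <-]; exists x. Qed.

Lemma cimgI c U V : atlas M c -> cimg c (U `&` V) = cimg c U `&` cimg c V.
Proof.
move=> ac; apply/seteqP; split=> z.
  by move=> /(cimgP _ _ ac)[h1 [h2 h3] h4]; split; apply/cimgP.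
by case=> /(cimgP _ _ ac)[h1 h2 h3] /(cimgP _ _ ac)[h4 h5 h6]; apply/cimgP.
Qed.

Lemma mopen_cdom d : atlas M d -> mopen (cdom d).
Proof. by move=> ad c ac; have [_ _ /(_ c d ac ad)[]] := aM. Qed.

Lemma mopenT : mopen [set: M].
Proof.
move=> c ac; rewrite setIT; have := mopen_cdom ac ac; by rewrite setIid.
Qed.

Lemma mopenI U V : mopen U -> mopen V -> mopen (U `&` V).
Proof.
by move=> oU oV c ac; rewrite -[X in open X]/(cimg c _) cimgI//; apply: openI;
    [exact: oU|exact: oV].
Qed.

Lemma mopen_local U :
  (forall x, U x -> exists V, [/\ mopen V, V x & V `<=` U]) -> mopen U.
Proof.
move=> H c ac; rewrite openE => _ [x [cx Ux] <-].
have [V [oV Vx VU]] := H x Ux.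
have : nbhs (cmap c x) (cimg c V).
  by apply: open_nbhs_nbhs; split; [exact: oV|exact: cimg_cmap].
by apply: filterS; exact: cimg_sub.
Qed.

Definition cpre c (B : set 'rV[R]_n) : set M := cdom c `&` cmap c @^-1` B.

Lemma cchange c d : atlas M c -> atlas M d ->
  Cinf (cimg c (cdom d)) (cmap d \o cinv c).
Proof. by move=> ac ad; have [_ _ /(_ c d ac ad)[]] := aM. Qed.

Lemma open_cimg c U : atlas M c -> mopen U -> open (cimg c U).
Proof. by move=> ac; exact. Qed.

Lemma mopen_cpre d (B : set 'rV[R]_n) : atlas M d -> open B -> mopen (cpre d B).
Proof.
move=> ad oB c ac; rewrite -[X in open X]/(cimg c _).
have oW : open (cimg c (cdom d)) by exact: mopen_cdom.
have := open_preimage oW (fun z => Cinf_continuous (cchange ac ad)) oB.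
congr open; apply/seteqP; split=> z.
  case=> /(cimgP _ _ ac)[h1 h2 h3] h4; apply/cimgP => //.
by move=> /(cimgP _ _ ac)[h1 [h2 h4] h3]; split => //; apply/cimgP.
Qed.

Section Smooth.
Context {W : normedModType R}.
Implicit Types f g : M -> W.

(** Changes of charts are smooth, so one chart around each point suffices. *)
Lemma smooth_on_chart U f : mopen U ->
  (forall x, U x -> exists c V, [/\ atlas M c, mopen V, cdom c x, V x &
     Cinf (cimg c V) (f \o cinv c)]) -> smooth_on U f.
Proof.
move=> oU H d ad; apply: Cinf_local => z /(cimgP _ _ ad)[h1 h2 h3].
have [c [V [ac oV cx Vx Cf]]] := H _ h2.
exists (cimg d (U `&` (V `&` cdom c))); first by apply/cimgP.
have oW : open (cimg d (U `&` (V `&` cdom c))).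
  apply: open_cimg => //; apply: mopenI => //; apply: mopenI => //.
  exact: mopen_cdom.
apply: (@eq_Cinf _ _ _ _ ((f \o cinv c) \o (cmap c \o cinv d))) => //.
  by move=> y /(cimgP _ _ ad)[k1 [_ [_ k2]] k3] /=; rewrite cmapK.
apply: (Cinf_comp (U' := cimg c V)) => //.
  move=> y /(cimgP _ _ ad)[k1 [_ [k4 k2]] k3] /=.
  exact: cimg_cmap.
apply: Cinf_sub (cchange ad ac); apply: cimg_sub => y [_ []] //.
Qed.

Lemma smooth_on_sub U V f : V `<=` U -> smooth_on U f -> smooth_on V f.
Proof. by move=> VU H c ac; apply: Cinf_sub (H c ac); exact: cimg_sub. Qed.

Lemma smooth_on_local U f : mopen U ->
  (forall x, U x -> exists V, [/\ mopen V, V x & smooth_on V f]) -> smooth_on U f.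
Proof.
move=> oU H; apply: smooth_on_chart => // x /H[V [oV Vx Cf]].
exists (chart_at M x), V; split => //.
- exact: atlas_chart_at.
- exact: cdom_chart_at.
- by apply: Cf; exact: atlas_chart_at.
Qed.

Lemma eq_smooth_on U f g : mopen U -> (forall x, U x -> f x = g x) ->
  smooth_on U f -> smooth_on U g.
Proof.
move=> oU fg H c ac; apply: eq_Cinf (H c ac); first exact: oU.
by move=> z /(cimgP _ _ ac)[h1 h2 h3]; exact: fg.
Qed.

Lemma smooth_on_cst U (a : W) : smooth_on U (fun=> a).
Proof. by move=> c ac; exact: Cinf_cst. Qed.

Lemma smooth_onD U f g : mopen U -> smooth_on U f -> smooth_on U g ->
  smooth_on U (fun x => f x + g x).
Proof. by move=> oU Sf Sg c ac; apply: CinfD; [exact: oU|exact: Sf|exact: Sg]. Qed.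

Lemma smooth_onN U f : mopen U -> smooth_on U f -> smooth_on U (fun x => - f x).
Proof. by move=> oU Sf c ac; apply: CinfN; [exact: oU|exact: Sf]. Qed.

Lemma smooth_onZ U (a : M -> R^o) f : mopen U -> smooth_on U a -> smooth_on U f ->
  smooth_on U (fun x => a x *: f x).
Proof. by move=> oU Sf Sg c ac; apply: CinfZ; [exact: oU|exact: Sf|exact: Sg]. Qed.

Lemma smooth_on_sum U I (r : seq I) (P : pred I) (f : I -> M -> W) : mopen U ->
  (forall i, P i -> smooth_on U (f i)) ->
  smooth_on U (fun x => \sum_(i <- r | P i) f i x).
Proof.
move=> oU H c ac; apply: (@Cinf_sum _ _ _ _ _ _ _ (fun i => f i \o cinv c)).
  exact: oU.
by move=> i Pi; exact: H.
Qed.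

End Smooth.

Lemma smooth_onM U (f g : M -> R^o) : mopen U -> smooth_on U f -> smooth_on U g ->
  smooth_on U (fun x => f x * g x : R^o).
Proof. exact: smooth_onZ. Qed.

Lemma smooth_on_rV U p (f : M -> 'rV[R]_p) : mopen U ->
  smooth_on U f <-> forall i, smooth_on U (fun x => f x ord0 i : R^o).
Proof.
move=> oU; split=> [H i c ac|H c ac].
  by have := H c ac; move=> /(Cinf_rV _ (oU c ac))/(_ i).
by apply/(Cinf_rV _ (oU c ac)) => i; exact: H.
Qed.

Lemma smooth_on_linear U (W : normedModType R) p (f : M -> 'rV[R]_p)
    (g : {linear 'rV[R]_p -> W}) : mopen U ->
  smooth_on U f -> smooth_on U (fun x => g (f x)).
Proof.
move=> oU Sf c ac; apply: (Cinf_comp (U' := setT)) (Sf c ac) _ => //; first exact: oU.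
exact: Cinf_linear.
Qed.

Lemma smooth_on_row_mx U p q (f : M -> 'rV[R]_p) (g : M -> 'rV[R]_q) : mopen U ->
  smooth_on U f -> smooth_on U g -> smooth_on U (fun x => row_mx (f x) (g x)).
Proof.
by move=> oU Sf Sg c ac; apply: Cinf_row_mx (Sf c ac) (Sg c ac); exact: oU.
Qed.

Lemma smooth_on_comp_chart U c (W : normedModType R) (g : 'rV[R]_n -> W)
   (B : set 'rV[R]_n) : mopen U -> atlas M c -> U `<=` cpre c B ->
  Cinf B g -> smooth_on U (g \o cmap c).
Proof.
move=> oU ac UB Cg; apply: smooth_on_chart => // x Ux.
exists c, U; split => //; first by have [] := UB _ Ux.
have oc : open (cimg c U) by exact: oU.
have : Cinf (cimg c U) g.
  by apply: Cinf_sub Cg => z [y [cy /UB[_ By]] <-].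
apply: eq_Cinf => // z /(cimgP _ _ ac)[h1 h2 h3] /=; by rewrite h3.
Qed.

End ManifoldTheory.

(** * Bump functions on a manifold *)

Section Bump.
Context {R : realType} {n : nat} (M : premanifold R n).
Hypothesis hM : is_manifold M.
Let aM := manifold_atlas hM.

(** The Hausdorff property separates a point outside a compact set from each of its
    points, and finitely many of the neighbourhoods so obtained suffice. *)
Lemma mopen_compact_compl c (K : set 'rV[R]_n) : atlas M c -> compact K ->
  K `<=` cimg c setT -> mopen (~` cpre c K).
Proof.
move=> ac cK KT; apply: mopen_local => y nKy.
have [_ _ _ hH _] := hM.
have H (x : M) : exists UV : set M * set M, cpre c K x ->
   [/\ mopen UV.1, mopen UV.2, UV.1 x, UV.2 y & UV.1 `&` UV.2 = set0].
  have [Kx|nKx] := pselect (cpre c K x); last by exists (set0, set0).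
  have xy : x <> y by move=> E; apply: nKy; rewrite -E.
  by have [U [V H]] := hH x y xy; exists (U, V).
have [F HF] := choice H.
have HK z : K z -> cmap c (cinv c z) = z /\ cpre c K (cinv c z).
  move=> Kz; have /(cimgP aM _ _ ac)[h1 _ h3] := KT _ Kz.
  by split => //; split => //; rewrite /= h3.
have := cK; rewrite compact_cover => /(_ _ K (fun z => cimg c (F (cinv c z)).1)).
case.
- by move=> z /HK[_ /HF[/(_ _ ac)]].
- move=> z Kz; exists z => //; have [h1 h2] := HK _ Kz.
  by apply/(cimgP aM _ _ ac); split => //; [case: h2|have [] := HF _ h2].
move=> D DK Dc.
have HD z : z \in D -> cpre c K (cinv c z).
  by move=> /DK /set_mem /HK[].
exists (\bigcap_(z in [set` D]) (F (cinv c z)).2); split.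
- rewrite bigcap_fset big_seq.
  elim/big_rec : _ => [|z A zD oA]; first exact: mopenT.
  by apply: (mopenI aM) => //; have [] := HF _ (HD _ zD).
- by move=> z zD; have [] := HF _ (HD _ zD).
- move=> w Hw Kw; have [z zD Fz] := Dc _ (Kw.2).
  have [_ _ _ _ E] := HF _ (HD _ zD).
  have : ((F (cinv c z)).1 `&` (F (cinv c z)).2) w.
    split; last exact: Hw.
    by move/(cimgP aM _ _ ac) : Fz => [_ + _]; rewrite (cmapK aM)//; case: Kw.
  by rewrite E.
Qed.

(** A bump function with compact support in a chart, extended by 0: the extension is
    smooth because the complement of the support is open. *)
Lemma bump U (m : M) : mopen U -> U m ->
  exists (chi : M -> R) (V K : set M),
    [/\ smooth_fun chi, mopen V, V m, (forall y, V y -> chi y = 1) &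
      [/\ V `<=` K, K `<=` U, mopen (~` K) & forall y, ~ K y -> chi y = 0]].
Proof.
move=> oU Um; set c := chart_at M m.
have ac : atlas M c by exact: (atlas_chart_at aM).
have cm : cdom c m by exact: (cdom_chart_at aM).
have oB : open (cimg c U) by exact: oU.
have [b [V [K [oV Vm cK KU [b1 b0 Cb]]]]] := rV_bump oB (cimg_cmap cm Um).
have VK : V `<=` K.
  move=> z Vz; apply: contrapT => /b0; rewrite b1// => /eqP; by rewrite oner_eq0.
have KT : K `<=` cimg c setT by move=> z /KU; exact: cimg_sub.
have oK := mopen_compact_compl ac cK KT.
exists (fun y => if pselect (cdom c y) then b (cmap c y) else 0).
exists (cpre c V), (cpre c K); split => //.
- apply: (smooth_on_local aM); first exact: mopenT.
  move=> x _; have [Kx|nKx] := pselect (cpre c K x).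
    exists (cdom c); split; [exact: mopen_cdom|by case: Kx|].
    apply: (@eq_smooth_on _ _ _ aM _ _ (b \o cmap c)).
    - exact: mopen_cdom.
    - by move=> y cy /=; case: pselect.
    by apply: (smooth_on_comp_chart aM (B := setT)) => //; exact: mopen_cdom.
  exists (~` cpre c K); split => //.
  apply: (@eq_smooth_on _ _ _ aM _ _ (fun=> 0)) => //; last exact: smooth_on_cst.
  move=> y nKy; case: (pselect (cdom c y)) => // cy; rewrite b0// => Ky; exact: nKy.
- exact: mopen_cpre.
- by move=> y [cy Vy]; case: (pselect (cdom c y)) => // ?; exact: b1.
- split => //.
  + by move=> y [cy Vy]; split => //; exact: VK.
  + by move=> y [cy /= /KU/(cimgP aM _ _ ac)[_ + _]]; rewrite cmapK.
  + by move=> y nKy; case: (pselect (cdom c y)) => // cy; rewrite b0// => Ky; exact: nKy.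
Qed.

Lemma smooth_on_cut U K (W : normedModType R) (chi : M -> R) (f : M -> W) :
  mopen U -> K `<=` U -> mopen (~` K) -> (forall y, ~ K y -> chi y = 0) ->
  smooth_fun chi -> smooth_on U f -> smooth_on setT (fun y => chi y *: f y).
Proof.
move=> oU KU oK chi0 Cchi Cf; apply: (smooth_on_local aM); first exact: mopenT.
move=> x _; have [Ux|nUx] := pselect (U x).
  exists U; split => //; apply: smooth_onZ => //.
  exact: smooth_on_sub Cchi.
exists (~` K); split => //; first by move=> /KU.
apply: (@eq_smooth_on _ _ _ aM _ _ (fun=> 0)) => //; last exact: smooth_on_cst.
by move=> y /chi0 ->; rewrite scale0r.
Qed.

End Bump.

(** * Vector bundles, their duals and sums, and smooth sections *)

Section LinearAlgebra.
Context {R : realType}.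

Lemma linfunE (V W : vectType R) (f : V -> W) : linear f ->
  forall v, linfun f v = f v.
Proof.
move=> lf v.
pose fM := GRing.isLinear.Build R V W _ f lf.
pose fL : {linear V -> W} := HB.pack f fM.
by rewrite -[f]/(fL : _ -> _) lfunE.
Qed.

Lemma lfun_bijK (V W : vectType R) (f : 'Hom(V, W)) : bijective f -> cancel f f^-1%VF.
Proof. by move=> /bij_inj/lker0P/lker0_lfunK. Qed.

Lemma lfun_bijVK (V W : vectType R) (f : 'Hom(V, W)) : bijective f -> cancel f^-1%VF f.
Proof. by move=> bf w; have [g fg gf] := bf; rewrite -(gf w) (lfun_bijK bf). Qed.

Lemma lfun_rowE n (w : 'rV[R]_n) (V : vectType R) (f : 'Hom('rV[R]_n, V)) :
  f w = \sum_(i < n) w ord0 i *: f (delta_mx 0 i).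
Proof. exact: (linear_row f). Qed.

End LinearAlgebra.

Section BundleTheory.
Context {R : realType} {n : nat} {M : premanifold R n}.
Hypothesis aM : is_atlas M.
Implicit Types (U V : set M).

Section OneBundle.
Variable E : prebundle M.
Hypothesis hE : is_vbundle E.
Implicit Types (s : section E).

Lemma trivs_at m : trivs E (triv_at E m).
Proof. by have [H _ _ _] := hE; case: (H m). Qed.

Lemma tdom_at m : tdom (triv_at E m) m.
Proof. by have [H _ _ _] := hE; case: (H m). Qed.

Lemma mopen_tdom t : trivs E t -> mopen (tdom t).
Proof. by have [_ H _ _] := hE; exact: H. Qed.

Lemma tmap_bij t m : trivs E t -> tdom t m -> bijective (tmap t m).
Proof. by have [_ _ H _] := hE; exact: H. Qed.

Lemma tmapK t m : trivs E t -> tdom t m -> cancel (tmap t m) (tmap t m)^-1%VF.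
Proof. by move=> tt tm; apply: lfun_bijK; exact: tmap_bij. Qed.

Lemma tmapVK t m : trivs E t -> tdom t m -> cancel (tmap t m)^-1%VF (tmap t m).
Proof. by move=> tt tm; apply: lfun_bijVK; exact: tmap_bij. Qed.

Lemma tmap_inj t m : trivs E t -> tdom t m -> injective (tmap t m).
Proof. by move=> tt tm; apply: bij_inj; exact: tmap_bij. Qed.

Lemma smooth_transition t t' w : trivs E t -> trivs E t' ->
  smooth_on (tdom t `&` tdom t') (fun m => tmap t' m ((tmap t m)^-1%VF w)).
Proof. by have [_ _ _ H] := hE; exact: H. Qed.

(** A change of trivialisation multiplies the coordinates by a matrix with smooth
    entries, so one trivialisation around each point suffices. *)
Lemma smooth_section_on_triv U s : mopen U ->
  (forall x, U x -> exists t V, [/\ trivs E t, tdom t x, mopen V, V x &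
     smooth_on (V `&` tdom t) (fun m => tmap t m (s m))]) ->
  smooth_section_on U s.
Proof.
move=> oU H t' tt'; apply: smooth_on_local => //.
  by apply: mopenI => //; exact: mopen_tdom.
move=> x [Ux t'x]; have [t [V [tt tx oV Vx Ss]]] := H x Ux.
pose N := (V `&` tdom t) `&` (tdom t `&` tdom t').
have oN : mopen N by do !(apply: mopenI => //); exact: mopen_tdom.
exists N; split => //.
apply: (@eq_smooth_on _ _ _ aM _ _ (fun m => \sum_(i < rank E)
    tmap t m (s m) ord0 i *: tmap t' m ((tmap t m)^-1%VF (delta_mx 0 i)))) => //.
  move=> y [[Vy ty] [_ t'y]].
  rewrite -[in RHS](tmapK tt ty (s y)).
  have -> : tmap t' y ((tmap t y)^-1%VF (tmap t y (s y))) =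
     (tmap t' y \o (tmap t y)^-1)%VF (tmap t y (s y)) by rewrite comp_lfunE.
  rewrite lfun_rowE; apply: eq_bigr => i _; by rewrite comp_lfunE.
apply: smooth_on_sum => // i _; apply: smooth_onZ => //.
  have /(smooth_on_rV _ oN) : smooth_on N (fun m => tmap t m (s m)).
    by apply: smooth_on_sub Ss => y [].
  exact.
by apply: smooth_on_sub (smooth_transition _ tt tt') => y [].
Qed.

Lemma smooth_section_on_sub U V s : V `<=` U -> smooth_section_on U s ->
  smooth_section_on V s.
Proof. by move=> VU H t tt; apply: smooth_on_sub (H t tt) => y [/VU]. Qed.

Lemma smooth_section_on_local U s : mopen U ->
  (forall x, U x -> exists V, [/\ mopen V, V x & smooth_section_on V s]) ->
  smooth_section_on U s.
Proof.
move=> oU H; apply: smooth_section_on_triv => // x /H[V [oV Vx Ss]].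
exists (triv_at E x), V; split => //; [exact: trivs_at|exact: tdom_at|].
by apply: Ss; exact: trivs_at.
Qed.

Lemma eq_smooth_section_on U s s' : mopen U -> (forall x, U x -> s x = s' x) ->
  smooth_section_on U s -> smooth_section_on U s'.
Proof.
move=> oU ss' H t tt; apply: (eq_smooth_on aM) (H t tt).
  by apply: mopenI => //; exact: mopen_tdom.
by move=> x [Ux _]; rewrite ss'.
Qed.

Lemma smooth_section_on0 U : smooth_section_on U (fun m => 0 : E m).
Proof.
move=> t tt; rewrite (_ : (fun m => _) = fun=> 0); first exact: smooth_on_cst.
by apply/funext => m; rewrite linear0.
Qed.

Lemma smooth_section_onD U s s' : mopen U -> smooth_section_on U s ->
  smooth_section_on U s' -> smooth_section_on U (fun m => s m + s' m).
Proof.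
move=> oU H H' t tt; rewrite (_ : (fun m => _) = fun m => tmap t m (s m) + tmap t m (s' m)).
  by apply: smooth_onD; [apply: mopenI => //; exact: mopen_tdom|exact: H|exact: H'].
by apply/funext => m; rewrite linearD.
Qed.

Lemma smooth_section_onZ U (f : M -> R) s : mopen U -> smooth_on (W := R^o) U f ->
  smooth_section_on U s -> smooth_section_on U (fun m => f m *: s m).
Proof.
move=> oU Cf H t tt; rewrite (_ : (fun m => _) = fun m => f m *: tmap t m (s m)).
  apply: smooth_onZ; [apply: mopenI => //; exact: mopen_tdom| |exact: H].
  by apply: smooth_on_sub Cf => y [].
by apply/funext => m; rewrite linearZ.
Qed.

Lemma smooth_section_on_sum U I (r : seq I) (P : pred I) (f : I -> section E) :
  mopen U -> (forall i, P i -> smooth_section_on U (f i)) ->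
  smooth_section_on U (fun x => \sum_(i <- r | P i) f i x).
Proof.
move=> oU H t tt.
rewrite (_ : (fun m => _) = fun m => \sum_(i <- r | P i) tmap t m (f i m)).
  apply: smooth_on_sum; first by apply: mopenI => //; exact: mopen_tdom.
  by move=> i Pi; exact: H.
by apply/funext => m; rewrite linear_sum.
Qed.

Lemma smooth_section0 : smooth_section (fun m => 0 : E m).
Proof. exact: smooth_section_on0. Qed.

Lemma smooth_sectionD s s' : smooth_section s -> smooth_section s' ->
  smooth_section (fun m => s m + s' m).
Proof. by apply: smooth_section_onD; exact: mopenT. Qed.

Lemma smooth_sectionZ f s : smooth_fun f -> smooth_section s ->
  smooth_section (fun m => f m *: s m).
Proof. by apply: smooth_section_onZ; exact: mopenT. Qed.

Lemma smooth_sectionZc (a : R) s : smooth_section s ->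
  smooth_section (fun m => a *: s m).
Proof. by apply: smooth_sectionZ; exact: smooth_on_cst. Qed.

Lemma smooth_section_sum I (r : seq I) (f : I -> section E) :
  (forall i, smooth_section (f i)) ->
  smooth_section (fun x => \sum_(i <- r) f i x).
Proof.
by move=> Cf; apply: smooth_section_on_sum => [|i _]; [exact: mopenT|exact: Cf].
Qed.

Lemma smooth_section_on_cst t w : trivs E t ->
  smooth_section_on (tdom t) (fun m => (tmap t m)^-1%VF w).
Proof. by move=> tt t' tt'; exact: smooth_transition. Qed.

Lemma smooth_tmap t U s : trivs E t -> U `<=` tdom t -> smooth_section_on U s ->
  smooth_on U (fun m => tmap t m (s m)).
Proof. by move=> tt Ut H; apply: smooth_on_sub (H t tt) => y Uy; split => //; exact: Ut. Qed.

End OneBundle.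

Section Dual.
Variable E : prebundle M.
Hypothesis hE : is_vbundle E.

Lemma dual_trivE k (t : triv E k) m (phi : dual E m) i :
  tmap (dual_triv t) m phi ord0 i = ev phi ((tmap t m)^-1%VF (delta_mx 0 i)).
Proof.
rewrite /dual_triv /= linfunE ?mxE// => a x y; apply/rowP => j; rewrite !mxE.
by rewrite add_lfunE scale_lfunE.
Qed.

Lemma ev_triv t m (phi : dual E m) v : trivs E t -> tdom t m ->
  ev phi v = \sum_(i < rank E) tmap (dual_triv t) m phi ord0 i * tmap t m v ord0 i.
Proof.
move=> tt tm; rewrite -[in LHS](tmapK hE tt tm v).
have -> : ev phi ((tmap t m)^-1%VF (tmap t m v)) =
   ((phi : 'Hom(E m, R^o)) \o (tmap t m)^-1)%VF (tmap t m v) by rewrite comp_lfunE.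
rewrite lfun_rowE; apply: eq_bigr => i _; rewrite comp_lfunE dual_trivE mulrC.
by [].
Qed.

Lemma dual_triv_bij t m : trivs E t -> tdom t m -> bijective (tmap (dual_triv t) m).
Proof.
move=> tt tm.
pose g (w : 'rV[R]_(rank E)) : dual E m :=
  linfun (fun v : E m => \sum_(i < rank E) w ord0 i * tmap t m v ord0 i : R^o).
have gE w v : ev (g w) v = \sum_(i < rank E) w ord0 i * tmap t m v ord0 i.
  rewrite /ev /g linfunE// => a x y; rewrite scaler_sumr -big_split/=.
  by apply: eq_bigr => i _; rewrite linearP !mxE /GRing.scale/=; ring.
exists g.
  move=> phi; apply/lfunP => v; rewrite -[LHS]/(ev _ _) gE -[RHS]/(ev _ _).
  by rewrite (ev_triv _ _ tt tm).
move=> w; apply/rowP => i; rewrite dual_trivE gE (bigD1 i)//=.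
rewrite (tmapVK hE tt tm) big1 ?addr0 => [|j ji].
  by rewrite mxE !eqxx mulr1.
by rewrite mxE eqxx/= (negbTE ji) mulr0.
Qed.

(** The transition matrices of the dual bundle are the transposes of those of E, in
    the opposite direction. *)
Lemma dual_vbundle : is_vbundle (dual E).
Proof.
split.
- move=> m; split; last exact: (tdom_at hE).
  by exists (triv_at E m) => //; exact: (trivs_at hE).
- by move=> _ [t tt <-]; exact: (mopen_tdom hE).
- by move=> _ m [t tt <-] tm; exact: dual_triv_bij.
- move=> _ _ w [t tt <-] [s ts <-].
  have oU : mopen (tdom t `&` tdom s) by apply: mopenI => //; exact: (mopen_tdom hE).
  apply: (iffRL (smooth_on_rV _ oU)) => i.
  apply: (@eq_smooth_on _ _ _ aM _ _ (fun m => \sum_(j < rank E)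
     w ord0 j * tmap t m ((tmap s m)^-1%VF (delta_mx 0 i)) ord0 j : R^o)) => //.
    move=> m [tm sm]; rewrite dual_trivE (ev_triv _ _ tt tm).
    by rewrite lfun_bijVK//; exact: dual_triv_bij.
  apply: smooth_on_sum => // j _; apply: smooth_onM => //; first exact: smooth_on_cst.
  have := smooth_transition hE (delta_mx 0 i) ts tt; rewrite setIC.
  by move=> /(smooth_on_rV _ oU); exact.
Qed.

Lemma smooth_ev U (phi : section (dual E)) (s : section E) : mopen U ->
  smooth_section_on U phi -> smooth_section_on U s ->
  smooth_on (W := R^o) U (fun m => ev (phi m) (s m)).
Proof.
move=> oU Hphi Hs; apply: (smooth_on_local aM) => // x Ux.
pose t := triv_at E x.
have tt : trivs E t by exact: (trivs_at hE).
have oN : mopen (U `&` tdom t) by apply: mopenI => //; exact: (mopen_tdom hE).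
exists (U `&` tdom t); split => //; first by split => //; exact: (tdom_at hE).
apply: (@eq_smooth_on _ _ _ aM _ _ (fun m => \sum_(i < rank E)
   tmap (dual_triv t) m (phi m) ord0 i * tmap t m (s m) ord0 i : R^o)) => //.
  by move=> y [_ ty]; rewrite (ev_triv _ _ tt ty).
apply: smooth_on_sum => // j _; apply: smooth_onM => //.
  have : smooth_on (U `&` tdom t) (fun m => tmap (dual_triv t) m (phi m)).
    have td : trivs (dual E) (dual_triv t) by exists t.
    exact: (Hphi _ td).
  by move=> /(smooth_on_rV _ oN); exact.
have : smooth_on (U `&` tdom t) (fun m => tmap t m (s m)) by exact: Hs.
by move=> /(smooth_on_rV _ oN); exact.
Qed.

End Dual.

Section DirectSum.
Variables E F : prebundle M.
Hypotheses (hE : is_vbundle E) (hF : is_vbundle F).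

Lemma dsum_trivE k l (t : triv E k) (s : triv F l) m (v : dsum E F m) :
  tmap (dsum_triv t s) m v = row_mx (tmap t m v.1) (tmap s m v.2).
Proof.
rewrite /dsum_triv /= linfunE// => a x y /=.
by rewrite !linearP /= scale_row_mx add_row_mx.
Qed.

Lemma dsum_triv_inv t s m w : trivs E t -> trivs F s -> tdom t m -> tdom s m ->
  (tmap (dsum_triv t s) m)^-1%VF w =
  ((tmap t m)^-1%VF (lsubmx w), (tmap s m)^-1%VF (rsubmx w)) :> (E m * F m).
Proof.
move=> tt ts tm sm.
have K v : tmap (dsum_triv t s) m v = w -> (tmap (dsum_triv t s) m)^-1%VF w = v.
  move=> <-; apply: lfun_bijK.
  exists (fun w => ((tmap t m)^-1%VF (lsubmx w), (tmap s m)^-1%VF (rsubmx w))).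
    move=> u; rewrite dsum_trivE row_mxKl row_mxKr (tmapK hE)// (tmapK hF)//.
    by rewrite -surjective_pairing.
  by move=> u; rewrite dsum_trivE /= (tmapVK hE)// (tmapVK hF)// hsubmxK.
by apply: K; rewrite dsum_trivE /= (tmapVK hE)// (tmapVK hF)// hsubmxK.
Qed.

Lemma dsum_triv_bij t s m : trivs E t -> trivs F s -> tdom t m -> tdom s m ->
  bijective (tmap (dsum_triv t s) m).
Proof.
move=> tt ts tm sm.
exists (fun w => ((tmap t m)^-1%VF (lsubmx w), (tmap s m)^-1%VF (rsubmx w))).
  move=> u; rewrite dsum_trivE row_mxKl row_mxKr (tmapK hE)// (tmapK hF)//.
  by rewrite -surjective_pairing.
by move=> u; rewrite dsum_trivE /= (tmapVK hE)// (tmapVK hF)// hsubmxK.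
Qed.

Lemma dsum_vbundle : is_vbundle (dsum E F).
Proof.
split.
- move=> m; split; last by split; [exact: (tdom_at hE)|exact: (tdom_at hF)].
  by exists (triv_at E m); [exact: (trivs_at hE)|exists (triv_at F m) => //; exact: (trivs_at hF)].
- move=> _ [t tt [s ts <-]]; apply: mopenI => //.
    exact: (mopen_tdom hE).
  exact: (mopen_tdom hF).
- by move=> _ m [t tt [s ts <-]] [tm sm]; exact: dsum_triv_bij.
- move=> _ _ w [t tt [s ts <-]] [t' tt' [s' ts' <-]] /=.
  have oU : mopen (tdom t `&` tdom s `&` (tdom t' `&` tdom s')).
    by do !(apply: mopenI => //); solve [exact: (mopen_tdom hE)|exact: (mopen_tdom hF)].
  apply: (@eq_smooth_on _ _ _ aM _ _ (fun m => row_mx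
    (tmap t' m ((tmap t m)^-1%VF (lsubmx w))) (tmap s' m ((tmap s m)^-1%VF (rsubmx w))))) => //.
    by move=> m [[tm sm] [tm' sm']]; rewrite dsum_trivE dsum_triv_inv.
  apply: smooth_on_row_mx => //.
    by apply: smooth_on_sub (smooth_transition hE _ tt tt') => y [[? ?] []].
  by apply: smooth_on_sub (smooth_transition hF _ ts ts') => y [[? ?] []].
Qed.

Lemma smooth_section_on_dsum U (s : section (dsum E F)) : mopen U ->
  smooth_section_on U s <->
  smooth_section_on (E := E) U (fun m => (s m).1) /\
  smooth_section_on (E := F) U (fun m => (s m).2).
Proof.
move=> oU; split.
  move=> H; split.
    apply: (smooth_section_on_triv hE) => // x Ux.
    pose t := triv_at E x; pose t' := triv_at F x.
    exists t, (U `&` tdom t'); split; [exact: (trivs_at hE)|exact: (tdom_at hE)| |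
       by split => //; exact: (tdom_at hF)|].
      by apply: mopenI => //; apply: (mopen_tdom hF); exact: (trivs_at hF).
    have tt : trivs (dsum E F) (dsum_triv t t').
      by exists t; [exact: (trivs_at hE)|exists t' => //; exact: (trivs_at hF)].
    have := smooth_on_linear (lsubmx : {linear 'rV[R]_(rank E + rank F) -> 'rV[R]_(rank E)})
        _ (H _ tt).
    rewrite [U `&` tdom t' `&` tdom t](_ : _ = U `&` tdom (dsum_triv t t')); last first.
      by rewrite /= [tdom t `&` _]setIC setIA.
    move=> H2; have oV : mopen (U `&` tdom (dsum_triv t t')).
      by apply: mopenI => //; apply: (mopen_tdom dsum_vbundle).
    apply: (eq_smooth_on aM oV) (H2 oV) => y _.
    by rewrite dsum_trivE /= row_mxKl.
  apply: (smooth_section_on_triv hF) => // x Ux.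
  pose t := triv_at E x; pose t' := triv_at F x.
  exists t', (U `&` tdom t); split; [exact: (trivs_at hF)|exact: (tdom_at hF)| |
     by split => //; exact: (tdom_at hE)|].
    by apply: mopenI => //; apply: (mopen_tdom hE); exact: (trivs_at hE).
  have tt : trivs (dsum E F) (dsum_triv t t').
    by exists t; [exact: (trivs_at hE)|exists t' => //; exact: (trivs_at hF)].
  have := smooth_on_linear (rsubmx : {linear 'rV[R]_(rank E + rank F) -> 'rV[R]_(rank F)}) _
      (H _ tt).
  rewrite [U `&` tdom t `&` tdom t'](_ : _ = U `&` tdom (dsum_triv t t')); last first.
    by rewrite /= setIA.
  move=> H2; have oV : mopen (U `&` tdom (dsum_triv t t')).
    by apply: mopenI => //; apply: (mopen_tdom dsum_vbundle).
  apply: (eq_smooth_on aM oV) (H2 oV) => y _.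
  by rewrite dsum_trivE /= row_mxKr.
move=> [H1 H2] _ [t tt [t' tt' <-]].
have oV : mopen (U `&` tdom (dsum_triv t t')).
  apply: mopenI => //; apply: (mopen_tdom dsum_vbundle).
  by exists t => //; exists t'.
apply: (@eq_smooth_on _ _ _ aM _ _ (fun m => row_mx (tmap t m (s m).1) (tmap t' m (s m).2))) => //.
  by move=> y _; rewrite dsum_trivE.
apply: smooth_on_row_mx => //.
  by apply: smooth_on_sub (H1 t tt) => y [? []].
by apply: smooth_on_sub (H2 t' tt') => y [? []].
Qed.

End DirectSum.

End BundleTheory.

(** * Extension of local sections and tensoriality *)

Section Tensoriality.
Context {R : realType} {n : nat} {M : premanifold R n}.
Hypothesis hM : is_manifold M.
Let aM := manifold_atlas hM.
Variable E : prebundle M.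
Hypothesis hE : is_vbundle E.

Lemma smooth_section_cut (U K : set M) (chi : M -> R) (s : section E) :
  mopen U -> K `<=` U -> mopen (~` K) -> (forall y, ~ K y -> chi y = 0) ->
  smooth_fun chi -> smooth_section_on U s -> smooth_section (fun y => chi y *: s y).
Proof.
move=> oU KU oK chi0 Cchi Cs; apply: (smooth_section_on_local aM hE); first exact: mopenT.
move=> x _; have [Ux|nUx] := pselect (U x).
  exists U; split => //; apply: (smooth_section_onZ aM hE) => //.
  exact: smooth_on_sub Cchi.
exists (~` K); split => //; first by move=> /KU.
apply: (@eq_smooth_section_on _ _ _ aM _ hE _ (fun=> 0)) => //.
  by move=> y /chi0 ->; rewrite scale0r.
exact: smooth_section_on0.
Qed.

Lemma extend_sections (U : set M) m (I : Type) (s : I -> section E) :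
  mopen U -> U m -> (forall i, smooth_section_on U (s i)) ->
  exists (V : set M) (s' : I -> section E), [/\ mopen V, V m, V `<=` U,
    forall i, smooth_section (s' i) & forall i y, V y -> s' i y = s i y].
Proof.
move=> oU Um Hs.
have [chi [V [K [Cchi oV Vm chi1 [VK KU oK chi0]]]]] := bump hM oU Um.
exists V, (fun i y => chi y *: s i y); split => //.
- by move=> y /VK/KU.
- by move=> i; apply: smooth_section_cut oU KU oK chi0 Cchi (Hs i).
- by move=> i y /chi1 ->; rewrite scale1r.
Qed.

(** These sections replace local frames, while being defined on all of M: connections
    and brackets only accept global sections. *)
Lemma cst_sections m t : trivs E t -> tdom t m ->
  exists (V : set M) (s : 'rV[R]_(rank E) -> section E), [/\ mopen V, V m,
    V `<=` tdom t, forall w, smooth_section (s w) &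
    forall w y, V y -> s w y = (tmap t y)^-1%VF w].
Proof.
move=> tt tm; apply: extend_sections => //; first exact: (mopen_tdom hE).
by move=> w; exact: smooth_section_on_cst.
Qed.

Lemma section_through m (v : E m) :
  exists s : section E, smooth_section s /\ s m = v.
Proof.
have tt := trivs_at hE m; have tm := tdom_at hE m.
have [V [s [oV Vm Vt Cs sE]]] := cst_sections tt tm.
exists (s (tmap (triv_at E m) m v)); split => //.
by rewrite sE// (tmapK hE).
Qed.

(** A section that vanishes at m is, near m, a combination of a local frame with
    coefficients that vanish at m. Cutting off both the coefficients and the frame
    turns this into an equality of global sections, for chi^2 d instead of d; as
    chi m = 1, this does not change the value of Phi. *)
Lemma tensorial m (W : lmodType R) (Phi : section E -> W) :
  (forall a s s', smooth_section s -> smooth_section s' ->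
     Phi (fun y => a *: s y + s' y) = a *: Phi s + Phi s') ->
  (forall f s, smooth_fun f -> smooth_section s ->
     Phi (fun y => f y *: s y) = f m *: Phi s) ->
  forall s s', smooth_section s -> smooth_section s' -> s m = s' m -> Phi s = Phi s'.
Proof.
move=> Plin Pf s s' Cs Cs' ss'.
have C0 : smooth_section (fun y => 0 : E y) by exact: smooth_section_on0.
have P0 : Phi (fun y => 0) = 0.
  have := Plin 1 _ _ C0 C0; rewrite scale1r.
  rewrite (_ : (fun y => _ *: _ + _) = (fun y => 0 : E y)); last first.
    by apply: functional_extensionality_dep => y; rewrite scaler0 addr0.
  by move=> /eqP; rewrite -subr_eq subrr => /eqP.
have Psum I (r : seq I) (g : I -> section E) : (forall i, smooth_section (g i)) ->
    Phi (fun y => \sum_(i <- r) g i y) = \sum_(i <- r) Phi (g i).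
  move=> Cg; elim: r => [|i r IH].
    rewrite big_nil -[RHS]P0; congr Phi.
    by apply: functional_extensionality_dep => y; rewrite big_nil.
  rewrite big_cons -IH -[Phi (g i)]scale1r -Plin//; last first.
    exact: (smooth_section_sum aM hE).
  congr Phi; apply: functional_extensionality_dep => y.
  by rewrite big_cons scale1r.
pose d : section E := fun y => (-1) *: s' y + s y.
have Cd : smooth_section d.
  by apply: (smooth_sectionD aM hE) => //; apply: (smooth_sectionZc aM hE).
suff Pd : Phi d = 0.
  move: Pd; rewrite Plin// scaleN1r addrC => /eqP; rewrite subr_eq0 => /eqP; exact.
have dm : d m = 0 by rewrite /d ss' scaleN1r addNr.
have tt := trivs_at hE m; have tm := tdom_at hE m.
set t := triv_at E m in tt tm.
have oU := mopen_tdom hE tt.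
have [chi [V [K [Cchi oV Vm chi1 [VK KU oK chi0]]]]] := bump hM oU tm.
pose b (j : 'I_(rank E)) : section E :=
  fun y => chi y *: (tmap t y)^-1%VF (delta_mx 0 j).
pose f (j : 'I_(rank E)) : M -> R := fun y => chi y * tmap t y (d y) ord0 j.
have Cb j : smooth_section (b j).
  apply: smooth_section_cut oU KU oK chi0 Cchi _.
  exact: smooth_section_on_cst.
have Cf j : smooth_fun (f j).
  apply: (smooth_on_cut hM (W := R^o) oU KU oK chi0 Cchi).
  by have /(smooth_on_rV _ oU) := smooth_tmap tt (fun _ => id) (smooth_section_on_sub
      (fun _ _ => I) Cd); exact.
have Ps j : Phi (fun y => f j y *: b j y) = 0.
  by rewrite Pf// /f dm linear0 mxE mulr0 scale0r.
have Cfb j : smooth_section (fun y => f j y *: b j y).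
  exact: (smooth_sectionZ aM hE).
(* chi enters twice: through the coefficients f j and through the sections b j *)
have E1 : (fun y => \sum_(j < rank E) f j y *: b j y) = (fun y => chi y *: (chi y *: d y)).
  apply: functional_extensionality_dep => y.
  have [ty|nty] := pselect (tdom t y); last first.
    have -> : chi y = 0 by apply: chi0 => /KU.
    by rewrite !scale0r big1// => j _; rewrite /b /f chi0 ?mul0r ?scale0r// => /KU.
  rewrite -[in RHS](tmapK hE tt ty (d y)) lfun_rowE !scaler_sumr.
  apply: eq_bigr => j _; rewrite /f /b !scalerA; congr (_ *: _).
  by rewrite mulrAC.
have := Psum _ (index_enum 'I_(rank E)) _ Cfb; rewrite E1.
rewrite Pf//; last exact: (smooth_sectionZ aM hE).
by rewrite Pf// !chi1// !scale1r => ->; rewrite big1.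
Qed.

End Tensoriality.

(** * Tangent bundle and tangent maps *)

Section TangentBundle.
Context {R : realType} {n : nat} {M : premanifold R n}.
Hypothesis aM : is_atlas M.
Implicit Types (c d : chart R M n).

Definition jac c d (x : M) : 'rV[R]_n -> 'rV[R]_n :=
  'd (cmap d \o cinv c) (cmap c x).

Lemma differentiable_change c d x : atlas M c -> atlas M d -> cdom c x -> cdom d x ->
  differentiable (cmap d \o cinv c) (cmap c x).
Proof.
move=> ac ad cx dx; apply: (Cinf_differentiable (cchange aM ac ad)).
exact: cimg_cmap.
Qed.

Lemma diff_change (W : normedModType R) c d x (U : set M) (f : M -> W) v :
  atlas M c -> atlas M d -> cdom c x -> cdom d x -> mopen U -> U x ->
  smooth_on U f ->
  'd (f \o cinv c) (cmap c x) v = 'd (f \o cinv d) (cmap d x) (jac c d x v).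
Proof.
move=> ac ad cx dx oU Ux Cf.
have dfd : differentiable (f \o cinv d) (cmap d x).
  by apply: Cinf_differentiable (Cf _ ad) _; exact: cimg_cmap.
have dcd := differentiable_change ac ad cx dx.
have E : (cmap d \o cinv c) (cmap c x) = cmap d x by rewrite /= (cmapK aM).
apply: (etrans _ (diff_chain v E dcd dfd)); symmetry.
have oN : open (cimg c (U `&` cdom d)).
  by apply: open_cimg => //; apply: mopenI => //; exact: mopen_cdom.
apply: (eq_diff v oN).
- by apply: cimg_cmap.
- by move=> z /(cimgP aM _ _ ac)[k1 [_ k2] k3] /=; rewrite (cmapK aM).
- by apply: differentiable_comp => //; rewrite E.
Qed.

Lemma jac_comp c d e x v : atlas M c -> atlas M d -> atlas M e ->
  cdom c x -> cdom d x -> cdom e x -> jac d e x (jac c d x v) = jac c e x v.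
Proof.
move=> ac ad ae cx dx ex; rewrite /jac; symmetry.
apply: (diff_change (U := cdom e)) => //; first exact: mopen_cdom.
move=> k ak; apply: Cinf_sub (cchange aM ak ae) => z [y [? ?] <-].
by exists y.
Qed.

Lemma jac_id c x v : atlas M c -> cdom c x -> jac c c x v = v.
Proof.
move=> ac cx; rewrite /jac.
have oN : open (cimg c (cdom c)) by apply: open_cimg => //; exact: mopen_cdom.
have H := is_diff_linear (idfun : {linear 'rV[R]_n -> 'rV[R]_n}) (cmap c x).
transitivity ('d (idfun : 'rV[R]_n -> 'rV[R]_n) (cmap c x) v); last first.
  by rewrite diff_val.
symmetry; apply: (eq_diff v oN); first exact: cimg_cmap.
- by move=> z /(cimgP aM _ _ ac)[k1 k2 k3] /=.
- by have [] := H.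
Qed.

Lemma jac_bij c d x : atlas M c -> atlas M d -> cdom c x -> cdom d x ->
  bijective (jac c d x).
Proof.
move=> ac ad cx dx; exists (jac d c x) => v; rewrite jac_comp//; exact: jac_id.
Qed.

Lemma tangent_trivE c x v : tmap (tangent_triv c) x v = jac (chart_at M x) c x v.
Proof. by rewrite /tangent_triv /= lfunE. Qed.

Lemma tangent_triv_bij c x : atlas M c -> cdom c x -> bijective (tmap (tangent_triv c) x).
Proof.
move=> ac cx; have := jac_bij (atlas_chart_at aM x) ac (cdom_chart_at aM x) cx.
by move=> /eq_bij; apply => v; rewrite tangent_trivE.
Qed.

Lemma tangent_triv_inv c x v : atlas M c -> cdom c x ->
  (tmap (tangent_triv c) x)^-1%VF v = jac c (chart_at M x) x v.
Proof.
move=> ac cx; have bt := tangent_triv_bij ac cx.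
have a0 := atlas_chart_at aM x; have c0 := cdom_chart_at aM x.
rewrite -[X in (_)^-1%VF X](_ : tmap (tangent_triv c) x (jac c (chart_at M x) x v) = v).
  by rewrite lfun_bijK.
by rewrite tangent_trivE jac_comp// jac_id.
Qed.

Lemma tangent_transition c d x v : atlas M c -> atlas M d -> cdom c x -> cdom d x ->
  tmap (tangent_triv d) x ((tmap (tangent_triv c) x)^-1%VF v) = jac c d x v.
Proof.
move=> ac ad cx dx; rewrite tangent_triv_inv// tangent_trivE jac_comp//.
  exact: atlas_chart_at.
exact: cdom_chart_at.
Qed.

Lemma tangent_triv_at x v : tmap (tangent_triv (chart_at M x)) x v = v.
Proof.
rewrite tangent_trivE jac_id//; [exact: atlas_chart_at|exact: cdom_chart_at].
Qed.

Lemma TB_vbundle : is_vbundle (TB M).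
Proof.
split.
- move=> x; split; last exact: (cdom_chart_at aM).
  by exists (chart_at M x) => //; exact: (atlas_chart_at aM).
- by move=> _ [c ac <-]; exact: mopen_cdom.
- by move=> _ x [c ac <-] cx; exact: tangent_triv_bij.
- move=> _ _ w [c ac <-] [d ad <-].
  have oU : mopen (cdom c `&` cdom d) by apply: mopenI => //; exact: mopen_cdom.
  apply: (@eq_smooth_on _ _ _ aM _ _ (fun x => jac c d x w)) => //.
    by move=> x [cx dx]; rewrite tangent_transition.
  apply: (smooth_on_comp_chart aM (c := c) (B := cimg c (cdom d))
     (g := fun z => 'd (cmap d \o cinv c) z w)) => //.
    by move=> x [cx dx]; split => //; exact: cimg_cmap.
  by apply: Cinf_diff; exact: cchange.
Qed.

Lemma differentialE c x (U : set M) (f : M -> R) v : atlas M c -> cdom c x ->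
  mopen U -> U x -> smooth_on (W := R^o) U f ->
  ev (differential f x) v =
  'd (f \o cinv c : 'rV[R]_n -> R^o) (cmap c x) (tmap (tangent_triv c) x v).
Proof.
move=> ac cx oU Ux Cf; rewrite /ev /differential lfunE /= tangent_trivE.
apply: (diff_change (W := R^o) (U := U)) => //.
  exact: atlas_chart_at.
exact: cdom_chart_at.
Qed.

Lemma smooth_differential (U : set M) (f : M -> R) : mopen U ->
  smooth_on (W := R^o) U f -> smooth_section_on (E := TsB M) U (differential f).
Proof.
move=> oU Cf; apply: (smooth_section_on_triv aM (dual_vbundle aM TB_vbundle)) => // x Ux.
set c := chart_at M x.
have ac : atlas M c by exact: atlas_chart_at.
exists (dual_triv (tangent_triv c)), U; split => //.
- by exists (tangent_triv c) => //; exists c.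
- exact: cdom_chart_at.
have oN : mopen (U `&` cdom c) by apply: mopenI => //; exact: mopen_cdom.
apply: (iffRL (smooth_on_rV _ oN)) => i.
apply: (@eq_smooth_on _ _ _ aM _ _ ((fun z => 'd (f \o cinv c : 'rV[R]_n -> R^o) z
    (delta_mx 0 i)) \o cmap c)) => //.
  move=> y [Uy cy]; rewrite dual_trivE (@differentialE c _ U)//.
  rewrite lfun_bijVK//; exact: tangent_triv_bij.
apply: (smooth_on_comp_chart aM (c := c) (B := cimg c U)
     (g := fun z => 'd (f \o cinv c) z _)) => //.
  by move=> y [Uy cy]; split => //; exact: cimg_cmap.
by apply: Cinf_diff; exact: Cf.
Qed.

End TangentBundle.

Section TangentMaps.
Context {R : realType} {n p : nat} {M : premanifold R n} {N : premanifold R p}.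
Hypotheses (aM : is_atlas M) (aN : is_atlas N).

(** Tangent maps and differentials are defined in the preferred charts; by the chain
    rule any other charts give the same result. *)
Lemma tangent_mapE (F : M -> N) x (U : set M) (c : chart R M n) (d : chart R N p) v :
  atlas M c -> cdom c x -> atlas N d -> mopen U -> U x ->
  (forall y, U y -> cdom d (F y)) -> smooth_on U (cmap d \o F) ->
  tmap (tangent_triv d) (F x) (tangent_map F x v) =
  'd (cmap d \o F \o cinv c) (cmap c x) (tmap (tangent_triv c) x v).
Proof.
move=> ac cx ad oU Ux Ud Cf.
set c0 := chart_at M x; set d0 := chart_at N (F x).
have ac0 : atlas M c0 by exact: atlas_chart_at.
have ad0 : atlas N d0 by exact: atlas_chart_at.
have c0x : cdom c0 x by exact: cdom_chart_at.
have d0x : cdom d0 (F x) by exact: cdom_chart_at.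
rewrite !tangent_trivE//.
apply: etrans (diff_change aM v ac0 ac c0x cx oU Ux Cf).
rewrite /tangent_map lfunE.
have dF : differentiable (cmap d \o F \o cinv c0) (cmap c0 x).
  by apply: Cinf_differentiable (Cf _ ac0) _; exact: cimg_cmap.
have Ex : (cmap d \o F \o cinv c0) (cmap c0 x) = cmap d (F x) by rewrite /= (cmapK aM).
have dF2 : differentiable ((cmap d0 \o cinv d) \o (cmap d \o F \o cinv c0)) (cmap c0 x).
  apply: differentiable_comp => //; rewrite Ex.
  by apply: differentiable_change => //; exact: Ud.
pose O := cimg c0 U `&` (cmap d \o F \o cinv c0) @^-1` (cimg d (cdom d0)).
have oO : open O.
  apply: open_preimage; first exact: oU.
    by move=> z Uz; apply: (Cinf_continuous (Cf _ ac0)).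
  by apply: open_cimg => //; exact: mopen_cdom.
have Ox : O (cmap c0 x).
  split; first exact: cimg_cmap.
  by rewrite /preimage /mkset Ex; apply: cimg_cmap => //; exact: Ud.
have OE z : O z -> U (cinv c0 z) /\ cdom d0 (F (cinv c0 z)).
  move=> [/(cimgP aM _ _ ac0)[k1 k2 k3] /=].
  by move=> /(cimgP aN _ _ ad)[k4]; rewrite (cmapK aN)//; exact: Ud.
have dF3 : differentiable (cmap d0 \o F \o cinv c0) (cmap c0 x).
  have [] // := @near_eq_is_diff _ _ _ _ (cmap d0 \o F \o cinv c0) (cmap c0 x) _ dF2.
  apply: filterS (open_nbhs_nbhs (conj oO Ox)) => z /OE[Uz _] /=.
  by rewrite (cmapK aN)//; exact: Ud.
have Ex0 : (cmap d0 \o F \o cinv c0) (cmap c0 x) = cmap d0 (F x) by rewrite /= (cmapK aM).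
have djd := differentiable_change aN ad0 ad d0x (Ud _ Ux).
apply: (etrans (esym (diff_chain v Ex0 dF3 djd))).
apply: (eq_diff v oO Ox).
  by move=> z /OE[Uz dz] /=; rewrite (cmapK aN).
apply: differentiable_comp => //; by rewrite Ex0.
Qed.

End TangentMaps.

(** * The total space of a vector bundle *)

Section TotalSpace.
Context {R : realType} {n : nat} {M : premanifold R n}.
Hypothesis aM : is_atlas M.

Section Charts.
Variable E : prebundle M.
Hypothesis hE : is_vbundle E.
Implicit Types (c : chart R M n) (t : triv E (rank E)).

Lemma cinv_tot_chart c t m e : atlas M c -> trivs E t -> cdom c m -> tdom t m ->
  cinv (tot_chart c t) (row_mx (cmap c m) (tmap t m e)) = Tot e.
Proof.
move=> ac tt cm tm; rewrite /tot_chart /= row_mxKl row_mxKr.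
have := cmapK aM ac cm; move: (cinv c (cmap c m)) => m' E'; subst m'.
by rewrite (tmapK hE).
Qed.

Definition over (U : set M) : set (tot E) := [set x | U (base x)].

Lemma atlas_tot_chart c t : atlas M c -> trivs E t -> atlas (tot E) (tot_chart c t).
Proof. by move=> ac tt; exists c => //; exists t. Qed.

Lemma tot_cimg c t (U : set M) : atlas M c -> trivs E t ->
  cmap (tot_chart c t) @` (cdom (tot_chart c t) `&` over U) =
  [set z : 'rV[R]_(n + rank E) | cimg c (tdom t `&` U) (lsubmx z)].
Proof.
move=> ac tt; apply/seteqP; split=> z.
  move=> [[m e] [[/= cm tm] Um] <-]; rewrite /= row_mxKl; exact: cimg_cmap.
move=> /= /(cimgP aM _ _ ac)[k1 [k2 k4] k3].
exists (cinv (tot_chart c t) z); first by [].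
by rewrite /= k3 (tmapVK hE)// hsubmxK.
Qed.

Lemma open_lsubmx_preimage k (B : set 'rV[R]_n) : open B ->
  open [set z : 'rV[R]_(n + k) | B (lsubmx z)].
Proof.
move=> oB; have := @open_preimage _ _ _ _ _ (fun z : 'rV[R]_(n + k) => lsubmx z) openT _ oB.
by rewrite setTI; apply => x _; exact: (@Cinf_continuous _ _ _ setT _ _ (Cinf_lsubmx _)).
Qed.

(** A change of charts of the total space sends (z, v) to the change of charts of the
    base at z and the transition matrix at z applied to v: it is smooth in z, and
    linear in v. *)
Lemma tot_atlas : is_atlas (tot E).
Proof.
split.
- move=> x; split; last by split; [exact: (cdom_chart_at aM)|exact: (tdom_at hE)].
  by apply: atlas_tot_chart; [exact: (atlas_chart_at aM)|exact: (trivs_at hE)].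
- move=> _ [m e] [c ac [t tt <-]] [/= cm tm]; exact: (cinv_tot_chart e ac tt cm tm).
- move=> _ _ [c ac [t tt <-]] [d ad [s ts <-]].
  have -> : cdom (tot_chart d s) = over (cdom d `&` tdom s) by [].
  rewrite (tot_cimg _ ac tt).
  have oU : mopen (tdom t `&` (cdom d `&` tdom s)).
    by do !(apply: mopenI => //); [exact: (mopen_tdom hE)|exact: mopen_cdom|exact: (mopen_tdom hE)].
  have oC : open (cimg c (tdom t `&` (cdom d `&` tdom s))) by exact: oU.
  have oW := @open_lsubmx_preimage (rank E) _ oC.
  split => //.
  apply: (@eq_Cinf _ _ _ _ (fun z => row_mx ((cmap d \o cinv c) (lsubmx z))
     (\sum_(j < rank E) (rsubmx z) ord0 j *:
       ((fun m => tmap s m ((tmap t m)^-1%VF (delta_mx 0 j))) \o cinv c) (lsubmx z)))) => //.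
    move=> z /= /(cimgP aM _ _ ac)[k1 [k2 [k3 k4]] k5]; congr row_mx.
    have -> : tmap s (cinv c (lsubmx z)) ((tmap t (cinv c (lsubmx z)))^-1%VF (rsubmx z)) =
      (tmap s (cinv c (lsubmx z)) \o (tmap t (cinv c (lsubmx z)))^-1)%VF (rsubmx z).
      by rewrite comp_lfunE.
    by rewrite lfun_rowE; apply: eq_bigr => j _; rewrite comp_lfunE.
  apply: Cinf_row_mx => //.
    apply: (Cinf_comp (U' := cimg c (tdom t `&` (cdom d `&` tdom s)))) => //.
      exact: Cinf_lsubmx.
    by apply: Cinf_sub (cchange aM ac ad); apply: cimg_sub => y [_ []].
  apply: Cinf_sum => // j _; apply: CinfZ => //.
    have /(Cinf_rV _ oW) := @Cinf_rsubmx R n (rank E) [set z | cimg c (tdom t `&`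
        (cdom d `&` tdom s)) (lsubmx z)].
    exact.
  apply: (Cinf_comp (U' := cimg c (tdom t `&` (cdom d `&` tdom s)))) => //.
    exact: Cinf_lsubmx.
  apply: Cinf_sub (smooth_transition hE (delta_mx 0 j) tt ts ac).
  by apply: cimg_sub => y [? []].
Qed.

Lemma mopen_over U : mopen U -> mopen (over U).
Proof.
move=> oU _ [c ac [t tt <-]]; rewrite (tot_cimg _ ac tt).
apply: open_lsubmx_preimage; apply: open_cimg => //.
by apply: mopenI => //; exact: (mopen_tdom hE).
Qed.

Lemma smooth_on_over (W : normedModType R) U (f : tot E -> W) c t :
  mopen U -> atlas M c -> trivs E t -> U `<=` cdom c `&` tdom t ->
  Cinf [set z : 'rV[R]_(n + rank E) | cimg c U (lsubmx z)] (f \o cinv (tot_chart c t)) ->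
  smooth_on (over U) f.
Proof.
move=> oU ac tt Uct Cf; apply: (smooth_on_chart tot_atlas); first exact: mopen_over.
move=> x Ux; exists (tot_chart c t), (over U); split => //.
- exact: atlas_tot_chart.
- exact: mopen_over.
- exact: Uct.
- rewrite /cimg (tot_cimg _ ac tt); apply: Cinf_sub Cf => z /=.
  by apply: cimg_sub => y [].
Qed.

Lemma smooth_on_proj (W : normedModType R) U (f : M -> W) :
  mopen U -> smooth_on U f -> smooth_on (over U) (fun x => f (base x)).
Proof.
move=> oU Cf _ [c ac [t tt <-]]; rewrite (tot_cimg _ ac tt).
apply: (@Cinf_comp _ _ _ _ _ (cimg c (tdom t `&` U))
    (fun z : 'rV[R]_(n + rank E) => lsubmx z) (f \o cinv c)) => //.
- by apply: open_lsubmx_preimage; apply: open_cimg => //; apply: mopenI => //;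
    exact: (mopen_tdom hE).
- exact: Cinf_lsubmx.
- by apply: Cinf_sub (Cf c ac); apply: cimg_sub => y [].
Qed.

Lemma smooth_on_vec_triv t : trivs E t ->
  smooth_on (over (tdom t)) (fun x => tmap t (base x) (vec x)).
Proof.
move=> tt; apply: (smooth_on_local tot_atlas).
  by apply: mopen_over; exact: (mopen_tdom hE).
move=> x tx; pose c := chart_at M (base x).
have ac : atlas M c by exact: (atlas_chart_at aM).
have oU : mopen (cdom c `&` tdom t) by apply: mopenI => //;
    [exact: mopen_cdom|exact: (mopen_tdom hE)].
exists (over (cdom c `&` tdom t)); split; first exact: mopen_over.
  by split => //; exact: (cdom_chart_at aM).
apply: (smooth_on_over (c := c) (t := t)) => //.
have oW := @open_lsubmx_preimage (rank E) _ (open_cimg ac oU).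
apply: (@eq_Cinf _ _ _ _ (fun z => rsubmx z)) => //; last exact: Cinf_rsubmx.
by move=> z /= /(cimgP aM _ _ ac)[k1 [k2 k4] k3]; rewrite (tmapVK hE).
Qed.

Lemma smooth_ell U (eps : section (dual E)) : mopen U ->
  smooth_section_on U eps -> smooth_on (W := R^o) (over U) (ell eps).
Proof.
move=> oU Ceps; apply: (smooth_on_local tot_atlas); first exact: mopen_over.
move=> x Ux; pose t := triv_at E (base x).
have tt : trivs E t by exact: (trivs_at hE).
have td : trivs (dual E) (dual_triv t) by exists t.
have oV : mopen (U `&` tdom t) by apply: mopenI => //; exact: (mopen_tdom hE).
have oW := mopen_over oV.
exists (over (U `&` tdom t)); split => //; first by split => //; exact: (tdom_at hE).
apply: (@eq_smooth_on _ _ _ tot_atlas _ _ (fun x => \sum_(i < rank E)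
   tmap (dual_triv t) (base x) (eps (base x)) ord0 i * tmap t (base x) (vec x) ord0 i : R^o)) => //.
  by move=> y [_ ty]; rewrite /ell (ev_triv hE _ _ tt ty).
apply: smooth_on_sum => // i _; apply: smooth_onM => //.
  have Cc : smooth_on (U `&` tdom t) (fun m => tmap (dual_triv t) m (eps m)) by exact: (Ceps _ td).
  have := smooth_on_proj oV (iffLR (smooth_on_rV _ oV) Cc i).
  exact.
have := smooth_on_vec_triv tt => H.
have H2 : smooth_on (over (U `&` tdom t)) (fun x => tmap t (base x) (vec x)).
  by apply: smooth_on_sub H => y [].
exact: (iffLR (smooth_on_rV _ oW) H2 i).
Qed.

End Charts.

End TotalSpace.

(** * Coordinate formulas on the total space *)

Section Dot.
Context {R : realType}.

Definition dot k (u w : 'rV[R]_k) : R := \sum_(i < k) u ord0 i * w ord0 i.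

Lemma dotDl k (u u' w : 'rV[R]_k) : dot (u + u') w = dot u w + dot u' w.
Proof. by rewrite /dot -big_split; apply: eq_bigr => i _; rewrite mxE mulrDl. Qed.

Lemma dotDr k (u w w' : 'rV[R]_k) : dot u (w + w') = dot u w + dot u w'.
Proof. by rewrite /dot -big_split; apply: eq_bigr => i _; rewrite mxE mulrDr. Qed.

Lemma dotZl k a (u w : 'rV[R]_k) : dot (a *: u) w = a * dot u w.
Proof. by rewrite /dot mulr_sumr; apply: eq_bigr => i _; rewrite mxE mulrA. Qed.

Lemma dotZr k a (u w : 'rV[R]_k) : dot u (a *: w) = a * dot u w.
Proof. by rewrite /dot mulr_sumr; apply: eq_bigr => i _; rewrite mxE mulrCA. Qed.

Lemma dot0l k (w : 'rV[R]_k) : dot 0 w = 0.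
Proof. by rewrite -(scale0r 0) dotZl mul0r. Qed.

Lemma dot0r k (w : 'rV[R]_k) : dot w 0 = 0.
Proof. by rewrite -(scale0r 0) dotZr mul0r. Qed.

Lemma dotNr k (u w : 'rV[R]_k) : dot u (- w) = - dot u w.
Proof. by rewrite -scaleN1r dotZr mulN1r. Qed.

Lemma dot_row_mx k l (u w : 'rV[R]_k) (u' w' : 'rV[R]_l) :
  dot (row_mx u u') (row_mx w w') = dot u w + dot u' w'.
Proof.
rewrite /dot big_split_ord /=; congr (_ + _); apply: eq_bigr => i _.
  by rewrite !row_mxEl.
by rewrite !row_mxEr.
Qed.

Lemma dot_deltar k (u : 'rV[R]_k) j : dot u (delta_mx 0 j) = u ord0 j.
Proof.
rewrite /dot (bigD1 j)//= mxE !eqxx mulr1 big1 ?addr0// => i ij.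
by rewrite mxE (negbTE ij) andbF mulr0.
Qed.

Lemma dot_deltal k (u : 'rV[R]_k) j : dot (delta_mx 0 j) u = u ord0 j.
Proof.
rewrite /dot (bigD1 j)//= mxE !eqxx mul1r big1 ?addr0// => i ij.
by rewrite mxE (negbTE ij) andbF mul0r.
Qed.

Lemma is_diff_dot (V : normedModType R) k (f g : V -> 'rV[R]_k) x :
  differentiable f x -> differentiable g x ->
  is_diff x (fun y => dot (f y) (g y) : R^o)
    (fun v => dot ('d f x v) (g x) + dot (f x) ('d g x v) : R^o).
Proof.
move=> df dg.
have H i : is_diff x (fun y => f y ord0 i * g y ord0 i : R^o)
    (fun v => 'd f x v ord0 i * g x ord0 i + f x ord0 i * 'd g x v ord0 i : R^o).
  have Hf := is_diff_coord i df; have Hg := is_diff_coord i dg.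
  have [+ +] := is_diff_scale (ex_diff (is_diff_def := Hf)) (ex_diff (is_diff_def := Hg)).
  move=> h1 h2; apply: DiffDef => //; rewrite h2; apply/funext => v.
  rewrite (@diff_val _ _ _ _ _ _ _ Hf) (@diff_val _ _ _ _ _ _ _ Hg).
  by rewrite /GRing.scale /= addrC.
have Hs (r : seq 'I_k) : is_diff x (fun y => \sum_(i <- r) f y ord0 i * g y ord0 i : R^o)
    (fun v => \sum_(i <- r) ('d f x v ord0 i * g x ord0 i + f x ord0 i * 'd g x v ord0 i) : R^o).
  elim: r => [|i r IH].
    have := is_diff_cst (0 : R^o) x; congr (is_diff_def _ _ _); apply/funext => y.
      by rewrite big_nil.
    by rewrite big_nil.
  have := is_diffD (H i) IH; congr (is_diff_def _ _ _); apply/funext => y.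
    by rewrite big_cons.
  by rewrite big_cons.
have := Hs (index_enum 'I_k); congr (is_diff_def _ _ _); apply/funext => y.
by rewrite big_split.
Qed.

Lemma lim_dnbhs_cst (W : normedModType R) (g : R -> W) w :
  (forall h, h != 0 -> g h = w) -> lim (g @ 0^') = w.
Proof.
move=> H; apply: cvg_lim => //; apply: cvg_near_cst.
near=> h; apply: H; near: h; exact: nbhs_dnbhs_neq.
Unshelve. all: by end_near. Qed.

Lemma derive1_line (W : normedModType R) (f : R -> W) (w : W) :
  (forall h, f h = f 0 + h *: w) -> derive1 f 0 = w.
Proof.
move=> H; rewrite /derive1; apply: lim_dnbhs_cst => h h0.
by rewrite addr0 H addrAC subrr add0r scalerA mulVf// scale1r.
Qed.

Lemma diff_line (V W : normedModType R) (f : V -> W) z v (w : W) :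
  differentiable f z -> (forall h, f (h *: v + z) = f z + h *: w) -> 'd f z v = w.
Proof.
move=> df H; rewrite -deriveE// /derive; apply: lim_dnbhs_cst => h h0 /=.
by rewrite H addrAC subrr add0r scalerA mulVf// scale1r.
Qed.

End Dot.

Section Coordinates.
Context {R : realType} {n : nat} {M : premanifold R n}.
Hypothesis aM : is_atlas M.
Variable E : prebundle M.
Hypothesis hE : is_vbundle E.
Let aT := tot_atlas aM hE.

Lemma ev_dot t m (phi : dual E m) v : trivs E t -> tdom t m ->
  ev phi v = dot (tmap (dual_triv t) m phi) (tmap t m v).
Proof. exact: ev_triv. Qed.

Section InCharts.
Variables (c : chart R M n) (t : triv E (rank E)).
Hypotheses (ac : atlas M c) (tt : trivs E t).
Local Notation C := (tot_chart c t : chart R (tot E) (n + rank E)).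

Lemma tangent_projE m (e0 : E m) (v : TB (tot E) (Tot e0)) :
  cdom c m -> tdom t m ->
  tmap (tangent_triv c) m (tangent_map (@Defs.proj _ _ _ E) (Tot e0 : tot E) v) =
  lsubmx (tmap (tangent_triv C) (Tot e0) v).
Proof.
move=> cm tm.
have aC : atlas (tot E) C by exact: atlas_tot_chart.
have oU : mopen (over (E := E) (cdom c)) by apply: mopen_over => //; exact: mopen_cdom.
apply: etrans (tangent_mapE aT aM (F := @Defs.proj _ _ _ E) v aC _ ac oU _ _ _) _ => //.
  apply: (smooth_on_proj aM hE (f := cmap c)); first exact: mopen_cdom.
  apply: (smooth_on_comp_chart aM (c := c) (B := setT) (g := id)) => //.
    exact: mopen_cdom.
  exact: Cinf_id.
pose O := [set z : 'rV[R]_(n + rank E) | cimg c (tdom t) (lsubmx z)].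
have oO : open O by apply: open_lsubmx_preimage; apply: open_cimg => //; exact: (mopen_tdom hE).
set v' := tmap _ _ _.
have HL := is_diff_linear (lsubmx : {linear 'rV[R]_(n + rank E) -> 'rV[R]_n}) (cmap C (Tot e0)).
transitivity ('d (lsubmx : 'rV[R]_(n + rank E) -> 'rV[R]_n) (cmap C (Tot e0)) v'); last first.
  by rewrite diff_val.
symmetry; apply: (eq_diff v' oO).
- by rewrite /O /= row_mxKl; exact: cimg_cmap.
- by move=> z /= /(cimgP aM _ _ ac)[_ _ k3] /=; rewrite k3.
- by have [] := HL.
Qed.

Lemma tangent_sectionE m U (e : section E) (X : TB M m) :
  cdom c m -> tdom t m -> mopen U -> U m -> smooth_section_on U e ->
  tmap (tangent_triv C) (Tot (e m)) (tangent_map (fun y => Tot (e y) : tot E) m X) =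
  row_mx (tmap (tangent_triv c) m X)
   ('d ((fun y => tmap t y (e y)) \o cinv c) (cmap c m) (tmap (tangent_triv c) m X)).
Proof.
move=> cm tm oU Um Ce.
have aC : atlas (tot E) C by exact: atlas_tot_chart.
pose V := U `&` (cdom c `&` tdom t).
have oV : mopen V.
  do !(apply: mopenI => //); [exact: mopen_cdom|exact: (mopen_tdom hE)].
have Vm : V m by [].
have Cc : smooth_on V (cmap c).
  apply: (smooth_on_comp_chart aM (c := c) (B := setT) (g := id)) => //.
    by move=> y [_ [? _]].
  exact: Cinf_id.
have Cte : smooth_on V (fun y => tmap t y (e y)).
  by apply: smooth_on_sub (Ce t tt) => y [? []].
apply: etrans (tangent_mapE aM aT (F := fun y => Tot (e y) : tot E) X ac cm aC oV Vm _ _) _.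
- by move=> y [_ []].
- exact: (smooth_on_row_mx oV Cc Cte).
set X' := tmap _ _ X.
have dc : differentiable (cmap c \o cinv c) (cmap c m).
  by apply: Cinf_differentiable (Cc c ac) _; exact: cimg_cmap.
have de : differentiable ((fun y => tmap t y (e y)) \o cinv c) (cmap c m).
  by apply: Cinf_differentiable (Cte c ac) _; exact: cimg_cmap.
apply: etrans (diff_row_mx X' dc de) _.
by congr row_mx; exact: (jac_id aM).
Qed.

(** The curve e0 + h a is affine in each of the charts (c, t). *)
Lemma vliftE m (e0 a : E m) : cdom c m -> tdom t m ->
  tmap (tangent_triv C) (Tot e0) (vlift e0 a) = row_mx 0 (tmap t m a).
Proof.
move=> cm tm.
have aC : atlas (tot E) C by exact: atlas_tot_chart.
rewrite tangent_trivE.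
set C0 := chart_at (tot E) (Tot e0).
have aC0 : atlas (tot E) C0 by exact: (atlas_chart_at aT).
have C0x : cdom C0 (Tot e0) by exact: (cdom_chart_at aT).
have -> : vlift e0 a = row_mx 0 (tmap (triv_at E m) m a).
  apply: derive1_line => h /=.
  by rewrite scale0r addr0 linearD linearZ /= -[in LHS](addr0
      (cmap _ _)) -add_row_mx scale_row_mx scaler0.
apply: diff_line.
  by apply: (differentiable_change aT) => //; split.
move=> h.
have -> : h *: row_mx 0 (tmap (triv_at E m) m a) + cmap C0 (Tot e0) = cmap C0 (Tot (e0 + h *: a)).
  by rewrite /= scale_row_mx scaler0 add_row_mx add0r linearD linearZ /= addrC.
rewrite /comp (cmapK aT)// (cmapK aT)//= scale_row_mx scaler0 add_row_mx addr0.
by rewrite linearD linearZ.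
Qed.

(** In coordinates ell eps is the scalar product of eps(z) and v: its differential has
    one term for each factor. *)
Lemma diff_ellE m (e0 : E m) U (eps : section (dual E)) (v : TB (tot E) (Tot e0)) :
  cdom c m -> tdom t m -> mopen U -> U m -> smooth_section_on U eps ->
  ev (differential (ell eps) (Tot e0 : tot E)) v =
  dot ('d ((fun y => tmap (dual_triv t) y (eps y)) \o cinv c) (cmap c m)
         (lsubmx (tmap (tangent_triv C) (Tot e0) v))) (tmap t m e0)
  + dot (tmap (dual_triv t) m (eps m)) (rsubmx (tmap (tangent_triv C) (Tot e0) v)).
Proof.
move=> cm tm oU Um Ceps.
have aC : atlas (tot E) C by exact: atlas_tot_chart.
have td : trivs (dual E) (dual_triv t) by exists t.
have oU' := mopen_over aM hE oU.
apply: etrans (differentialE aT v aC _ oU' _ (smooth_ell aM hE oU Ceps)) _ => //.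
set v' := tmap _ _ _.
pose f := (fun y => tmap (dual_triv t) y (eps y)) \o cinv c.
have dlf : differentiable (fun z : 'rV[R]_(n + rank E) => f (lsubmx z)) (cmap C (Tot e0)).
  apply: (@differentiable_comp _ _ _ _ (fun z : 'rV[R]_(n + rank E) => lsubmx z) f).
    exact: differentiable_lsubmx.
  rewrite row_mxKl; apply: (Cinf_differentiable (U := cimg c (U `&` tdom t))).
    exact: (Ceps _ td c ac).
  exact: cimg_cmap.
have dr : differentiable (fun z : 'rV[R]_(n + rank E) => rsubmx z) (cmap C (Tot e0)).
  exact: differentiable_rsubmx.
have H := is_diff_dot dlf dr.
pose O := [set z : 'rV[R]_(n + rank E) | cimg c (tdom t) (lsubmx z)].
have oO : open O by apply: open_lsubmx_preimage; apply: open_cimg => //; exact: (mopen_tdom hE).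
have Ox : O (cmap C (Tot e0)) by rewrite /O /= row_mxKl; exact: cimg_cmap.
apply: etrans (esym (eq_diff v' oO Ox (f := fun z => dot (f (lsubmx z)) (rsubmx z) : R^o) _ _)) _.
- move=> z /= /(cimgP aM _ _ ac)[k1 k2 k3] /=.
  rewrite /ell /= (ev_dot _ _ tt)//; congr dot.
  by rewrite (tmapVK hE).
- by have [] := H.
have lC : lsubmx (cmap C (Tot e0)) = cmap c m by exact: row_mxKl.
have rC : rsubmx (cmap C (Tot e0)) = tmap t m e0 by exact: row_mxKr.
apply: etrans (congr1 (fun h => h v') (@diff_val _ _ _ _ _ _ _ H)) _; cbv beta.
have HL := is_diff_linear (lsubmx : {linear 'rV[R]_(n + rank E) -> 'rV[R]_n}) (cmap C (Tot e0)).
have HR := is_diff_linear (rsubmx : {linear 'rV[R]_(n + rank E) -> 'rV[R]_(rank E)}) (cmap C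
    (Tot e0)).
congr (_ + _); congr dot => //.
- apply: etrans (diff_chain v' lC (differentiable_lsubmx _) _) _.
    apply: (Cinf_differentiable (U := cimg c (U `&` tdom t))).
      exact: (Ceps _ td c ac).
    exact: cimg_cmap.
  by congr ('d _ _ _); exact: (congr1 (fun h => h v') (@diff_val _ _ _ _ _ _ _ HL)).
- by rewrite lC /f /comp (cmapK aM).
- exact: (congr1 (fun h => h v') (@diff_val _ _ _ _ _ _ _ HR)).
Qed.

End InCharts.
End Coordinates.

(** * The splitting Sigma and the projection Phi_E *)

Section Evaluation.
Context {R : realType} {V : vectType R}.
Implicit Types (phi psi : dual_space V) (u v : V).

Lemma evDl phi psi v : ev (phi + psi) v = ev phi v + ev psi v.
Proof. by rewrite /ev add_lfunE. Qed.

Lemma evZl a phi v : ev (a *: phi) v = a * ev phi v.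
Proof. by rewrite /ev scale_lfunE. Qed.

Lemma evNl phi v : ev (- phi) v = - ev phi v.
Proof. by rewrite /ev opp_lfunE. Qed.

Lemma ev0l v : ev 0 v = 0.
Proof. by rewrite /ev zero_lfunE. Qed.

Lemma evDr phi u v : ev phi (u + v) = ev phi u + ev phi v.
Proof. by rewrite /ev linearD. Qed.

Lemma evZr a phi v : ev phi (a *: v) = a * ev phi v.
Proof. by rewrite /ev linearZ. Qed.

Lemma evNr phi v : ev phi (- v) = - ev phi v.
Proof. by rewrite /ev linearN. Qed.

Lemma ev0r phi : ev phi 0 = 0.
Proof. by rewrite /ev linear0. Qed.

Lemma ev_inj phi psi : (forall v, ev phi v = ev psi v) -> phi = psi.
Proof. by move=> H; apply/lfunP => v; exact: H. Qed.

Lemma ev_linfun (f : V -> R) v : linear (f : V -> R^o) ->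
  ev (linfun (f : V -> R^o) : dual_space V) v = f v.
Proof. by move=> lf; rewrite /ev linfunE. Qed.

End Evaluation.

Section LocalExpression.
Context {R : realType} {n : nat} {M : premanifold R n}.
Hypothesis aM : is_atlas M.
Variable E : prebundle M.
Hypothesis hE : is_vbundle E.
Variables (c : chart R M n) (t : triv E (rank E)) (m : M).
Hypotheses (ac : atlas M c) (tt : trivs E t) (cm : cdom c m) (tm : tdom t m).

Definition loc (s : section E) : 'rV[R]_n -> 'rV[R]_(rank E) :=
  (fun y => tmap t y (s y)) \o cinv c.

Lemma loc_at s : loc s (cmap c m) = tmap t m (s m).
Proof. by rewrite /loc /comp (cmapK aM). Qed.

Lemma loc_differentiable U s : mopen U -> U m -> smooth_section_on U s ->
  differentiable (loc s) (cmap c m).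
Proof.
move=> oU Um Cs; apply: (Cinf_differentiable (U := cimg c (U `&` tdom t))).
  exact: (Cs t tt c ac).
exact: cimg_cmap.
Qed.

Lemma fun_differentiable (f : M -> R) : smooth_fun f ->
  differentiable (f \o cinv c : 'rV[R]_n -> R^o) (cmap c m).
Proof.
move=> Cf; apply: (Cinf_differentiable (U := cimg c setT)); first exact: Cf.
exact: cimg_cmap.
Qed.

End LocalExpression.

(** Locked: unification would otherwise unfold the differentials. *)
HB.lock Definition dloc (R : realType) (n : nat) (M : premanifold R n)
    (E : prebundle M) (t : triv E (rank E)) (m : M) (s : section E)
    (v : 'rV[R]_n) : 'rV[R]_(rank E) :=
  'd (loc (chart_at M m) t s) (cmap (chart_at M m) m) v.

Lemma differential_at {R : realType} {n} {M : premanifold R n} (f : M -> R) x v :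
  ev (differential f x) v =
  'd (f \o cinv (chart_at M x) : 'rV[R]_n -> R^o) (cmap (chart_at M x) x) v.
Proof. by rewrite /ev /differential lfunE. Qed.

Section LocalDerivative.
Context {R : realType} {n : nat} {M : premanifold R n}.
Hypothesis aM : is_atlas M.
Variable E : prebundle M.
Hypothesis hE : is_vbundle E.
Variables (t : triv E (rank E)) (m : M).
Hypotheses (tt : trivs E t) (tm : tdom t m).
Let ac := atlas_chart_at aM m.
Let cm := cdom_chart_at aM m.

Lemma dlocP s a u v : dloc t m s (a *: u + v) = a *: dloc t m s u + dloc t m s v.
Proof. by rewrite dloc.unlock linearP. Qed.

Lemma dloc0 s : dloc t m s 0 = 0.
Proof. by rewrite dloc.unlock linear0. Qed.

Lemma dloc_lin a s s' v : smooth_section s -> smooth_section s' ->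
  dloc t m (fun y => a *: s y + s' y) v = a *: dloc t m s v + dloc t m s' v.
Proof.
move=> Cs Cs'.
have ds := loc_differentiable ac tt cm tm (mopenT aM) I Cs.
have ds' := loc_differentiable ac tt cm tm (mopenT aM) I Cs'.
rewrite dloc.unlock.
have -> : loc (chart_at M m) t (fun y => a *: s y + s' y) =
    a *: loc (chart_at M m) t s + loc (chart_at M m) t s'.
  by apply/funext => z; rewrite /loc /comp !fctE linearP.
have H := is_diffD (is_diffZ a (differentiableP ds)) (differentiableP ds').
exact: (congr1 (fun h => h v) (@diff_val _ _ _ _ _ _ _ H)).
Qed.

Lemma dlocZ (f : M -> R) s v : smooth_fun f -> smooth_section s ->
  dloc t m (fun y => f y *: s y) v =
  f m *: dloc t m s v + ev (differential f m) v *: tmap t m (s m).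
Proof.
move=> Cf Cs.
have ds := loc_differentiable ac tt cm tm (mopenT aM) I Cs.
have df := fun_differentiable ac cm Cf.
rewrite dloc.unlock differential_at.
have -> : loc (chart_at M m) t (fun y => f y *: s y) =
    fun z => (f \o cinv (chart_at M m)) z *: loc (chart_at M m) t s z.
  by apply/funext => z; rewrite /loc /comp linearZ.
have H := is_diff_scale df ds.
apply: etrans (congr1 (fun h => h v) (@diff_val _ _ _ _ _ _ _ H)) _.
by rewrite (loc_at aM)// /comp (cmapK aM).
Qed.

Lemma differential_ev (phi : section (dual E)) (s : section E) v :
  smooth_section phi -> smooth_section s ->
  ev (differential (fun y => ev (phi y) (s y)) m) v =
  dot (dloc (E := dual E) (dual_triv t) m phi v) (tmap t m (s m))
  + dot (tmap (dual_triv t) m (phi m)) (dloc t m s v).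
Proof.
move=> Cphi Cs; rewrite differential_at !dloc.unlock.
have td : trivs (dual E) (dual_triv t) by exists t.
have ds := loc_differentiable ac tt cm tm (mopenT aM) I Cs.
have dp := loc_differentiable (E := dual E) ac td cm tm (mopenT aM) I Cphi.
have H := is_diff_dot dp ds.
have oN : open (cimg (chart_at M m) (tdom t)).
  by apply: open_cimg => //; exact: (mopen_tdom hE).
have NE : cimg (chart_at M m) (tdom t) (cmap (chart_at M m) m) by exact: cimg_cmap.
apply: etrans (esym (eq_diff v oN NE (f := fun z => dot (loc (E := dual E) (chart_at M m)
    (dual_triv t) phi z) (loc (chart_at M m) t s z) : R^o) _ _)) _.
- move=> z /(cimgP aM _ _ ac)[k1 k2 k3]; rewrite /comp (ev_dot hE _ _ tt k2) //.
- by have [] := H.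
apply: etrans (congr1 (fun h => h v) (@diff_val _ _ _ _ _ _ _ H)) _.
by rewrite (loc_at aM)// (loc_at (E := dual E) aM).
Qed.

End LocalDerivative.

Section SigmaTheory.
Context {R : realType} {n : nat} {M : premanifold R n}.
Hypothesis hM : is_manifold M.
Let aM := manifold_atlas hM.
Variable E : prebundle M.
Hypothesis hE : is_vbundle E.
Let aT := tot_atlas aM hE.
Let hT := TB_vbundle aM.
Let hd := dual_vbundle aM hE.

Local Notation c0 m := (chart_at M m).
Local Notation t0 m := (triv_at E m).
Let ac0 m : atlas M (c0 m) := atlas_chart_at aM m.
Let tt0 m : trivs E (t0 m) := trivs_at hE m.
Let cm0 m : cdom (c0 m) m := cdom_chart_at aM m.
Let tm0 m : tdom (t0 m) m := tdom_at hE m.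

Lemma tot_triv_at m (e0 : E m) (v : TB (tot E) (Tot e0)) :
  tmap (tangent_triv (tot_chart (c0 m) (t0 m) : chart R (tot E) (n + rank E))) (Tot e0) v = v.
Proof. exact: (@tangent_triv_at _ _ _ aT (Tot e0) v). Qed.

Lemma tangent_proj_at m (e0 : E m) (v : TB (tot E) (Tot e0)) :
  tangent_map (@Defs.proj _ _ _ E) (Tot e0 : tot E) v = lsubmx (v : 'rV[R]_(n + rank E)).
Proof.
have := tangent_projE aM hE (ac0 m) (tt0 m) v (cm0 m) (tm0 m).
by rewrite (tangent_triv_at aM) tot_triv_at.
Qed.

Lemma vlift_at m (e0 a : E m) :
  vlift e0 a = row_mx 0 (tmap (t0 m) m a) :> 'rV[R]_(n + rank E).
Proof.
apply: etrans (vliftE aM hE (ac0 m) (tt0 m) e0 a (cm0 m) (tm0 m)).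
by rewrite tot_triv_at.
Qed.

Lemma tangent_section_at m (e : section E) (X : TB M m) : smooth_section e ->
  tangent_map (fun y => Tot (e y) : tot E) m X =
  row_mx X (dloc (t0 m) m e X) :> 'rV[R]_(n + rank E).
Proof.
move=> Ce.
have := tangent_sectionE aM hE (ac0 m) (tt0 m) X (cm0 m) (tm0 m) (mopenT aM) I Ce.
rewrite (tangent_triv_at aM X) => H; rewrite dloc.unlock; apply: etrans H.
by rewrite tot_triv_at.
Qed.

Lemma diff_ell_at m (e0 : E m) (eps : section (dual E)) (v : TB (tot E) (Tot e0)) :
  smooth_section eps ->
  ev (differential (ell eps) (Tot e0 : tot E)) v =
  dot (dloc (E := dual E) (dual_triv (t0 m)) m eps
         (lsubmx (v : 'rV[R]_(n + rank E)))) (tmap (t0 m) m e0)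
  + dot (tmap (dual_triv (t0 m)) m (eps m)) (rsubmx (v : 'rV[R]_(n + rank E))).
Proof.
move=> Ceps.
have := diff_ellE aM hE (ac0 m) (tt0 m) v (cm0 m) (tm0 m) (mopenT aM) I Ceps.
by rewrite tot_triv_at dloc.unlock.
Qed.

Lemma smooth_pairE (nu : section (AB E)) : smooth_section nu <->
  smooth_section (E := TB M) (fun y => (nu y).1) /\
  smooth_section (E := dual E) (fun y => (nu y).2).
Proof. exact: (smooth_section_on_dsum aM hT hd _ (mopenT aM)). Qed.

Definition core (e : section E) : section (BB E) := fun y => (e y, 0).

Lemma smooth_core e : smooth_section e -> smooth_section (core e).
Proof.
move=> Ce; apply/(smooth_section_on_dsum aM hE (dual_vbundle aM hT) _ (mopenT aM)).
split => //; exact: smooth_section0.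
Qed.

Variable Delta : section (AB E) -> section (BB E) -> section (BB E).
Hypothesis hD : is_dorfman Delta.

Lemma DeltaPl a nu nu' tau m : smooth_section nu -> smooth_section nu' ->
  smooth_section tau ->
  Delta (fun m => a *: nu m + nu' m) tau m = a *: Delta nu tau m + Delta nu' tau m.
Proof. by move=> C C' Ct; have [_ H _ _ _] := hD; exact: (H a nu nu' tau tau C C' Ct Ct).1. Qed.

Lemma DeltaPr a nu tau tau' m : smooth_section nu -> smooth_section tau ->
  smooth_section tau' ->
  Delta nu (fun m => a *: tau m + tau' m) m = a *: Delta nu tau m + Delta nu tau' m.
Proof. by move=> C Ct Ct'; have [_ H _ _ _] := hD; exact: (H a nu nu tau tau' C C Ct Ct').2. Qed.

Lemma DeltaZl f nu tau m : smooth_fun f -> smooth_section nu -> smooth_section tau ->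
  Delta (fun m => f m *: nu m) tau m =
  f m *: Delta nu tau m + pairing (nu m) (tau m) *: exact E f m.
Proof. by move=> ? ? ?; have [_ _ H _ _] := hD; exact: H. Qed.

Lemma DeltaZr f nu tau m : smooth_fun f -> smooth_section nu -> smooth_section tau ->
  Delta nu (fun m => f m *: tau m) m =
  f m *: Delta nu tau m + lie_fun (anchor nu) f m *: tau m.
Proof. by move=> ? ? ?; have [_ _ _ H _] := hD; exact: H. Qed.

(** The fibre component of the tangent part of [sigma_value], see [sigma1E]. *)
Definition vpart (nu : section (AB E)) (e : section E) m : 'rV[R]_(rank E) :=
  dloc (t0 m) m e (nu m).1
  - tmap (t0 m) m (Delta nu (core e) m).1.

Lemma sigma1E nu e m : smooth_section e ->
  (sigma_value Delta nu e m).1 = row_mx (nu m).1 (vpart nu e m)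
  :> 'rV[R]_(n + rank E).
Proof.
move=> Ce; rewrite /sigma_value.
rewrite -[LHS]/((tangent_map (fun y => Tot (e y) : tot E) m (nu m).1 : 'rV[R]_(n + rank E))
  - (vlift (e m) (Delta nu (core e) m).1 : 'rV[R]_(n + rank E))).
by rewrite tangent_section_at// vlift_at opp_row_mx add_row_mx oppr0 addr0.
Qed.

Lemma sigma2E nu e m v : smooth_section nu ->
  ev (sigma_value Delta nu e m).2 v =
  dot (dloc (E := dual E) (dual_triv (t0 m)) m (fun y => (nu y).2)
         (lsubmx (v : 'rV[R]_(n + rank E)))) (tmap (t0 m) m (e m))
  + dot (tmap (dual_triv (t0 m)) m (nu m).2) (rsubmx (v : 'rV[R]_(n + rank E)))
  - ev (Delta nu (core e) m).2 (lsubmx (v : 'rV[R]_(n + rank E))).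
Proof.
move=> /smooth_pairE[_ Ceps].
rewrite /sigma_value.
rewrite -[LHS]/(ev (differential (ell (fun y => (nu y).2)) (Tot (e m) : tot E)
  - (core_lift (Delta nu (core e) m) (e m)).2) v).
rewrite evDl evNl diff_ell_at//; congr (_ - _).
by rewrite /core_lift /ev /= comp_lfunE tangent_proj_at.
Qed.

Lemma CB_ext (x : tot E) (w w' : CB (tot E) x) : w.1 = w'.1 ->
  (forall v, ev w.2 v = ev w'.2 v) -> w = w'.
Proof. by case: w w' => [a b] [a' b'] /= -> /ev_inj ->. Qed.

Lemma sigma_lin a nu nu' e m : smooth_section nu -> smooth_section nu' ->
  smooth_section e ->
  sigma_value Delta (fun y => a *: nu y + nu' y) e m =
  a *: sigma_value Delta nu e m + sigma_value Delta nu' e m.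
Proof.
move=> Cn Cn' Ce.
have hAB := dsum_vbundle aM hT hd.
have Cs : smooth_section (fun y => a *: nu y + nu' y).
  by apply: (smooth_sectionD aM hAB) => //; exact: (smooth_sectionZc aM hAB).
have /smooth_pairE[C1 C2] := Cn; have /smooth_pairE[C1' C2'] := Cn'.
have Cc := smooth_core Ce.
apply: CB_ext.
  rewrite sigma1E//.
  rewrite -[RHS]/(a *: ((sigma_value Delta nu e m).1 : 'rV[R]_(n + rank E)) +
      ((sigma_value Delta nu' e m).1 : 'rV[R]_(n + rank E))).
  rewrite !sigma1E// scale_row_mx add_row_mx; congr row_mx.
  rewrite /vpart DeltaPl// dlocP linearP opprD.
  by rewrite scalerBr addrACA.
move=> v; rewrite sigma2E//.
rewrite -[RHS]/(ev (a *: (sigma_value Delta nu e m).2 + (sigma_value Delta nu' e m).2) v).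
rewrite evDl evZl !sigma2E// DeltaPl//.
have td : trivs (dual E) (dual_triv (t0 m)) by exists (t0 m).
have := dloc_lin aM td (tm0 m) a (lsubmx (v : 'rV[R]_(n + rank E))) C2 C2'.
move=> H.
rewrite -[X in dot X _](esym H) dotDl dotZl.
have -> : tmap (dual_triv (t0 m)) m (a *: nu m + nu' m).2 =
    a *: tmap (dual_triv (t0 m)) m (nu m).2 + tmap (dual_triv (t0 m)) m (nu' m).2.
  by rewrite -linearP.
rewrite dotDl dotZl.
rewrite -[X in _ - X]/(ev (a *: (Delta nu (core e) m).2 + (Delta nu' (core e) m).2) _) evDl evZl.
ring.
Qed.

(** Delta_(f nu) (e, 0) exceeds f Delta_nu (e, 0) by <nu, (e, 0)> (0, df), which
    compensates the term ell_eps df in the differential of ell_(f eps). *)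
Lemma sigma_homog f nu e m : smooth_fun f -> smooth_section nu ->
  smooth_section e ->
  sigma_value Delta (fun y => f y *: nu y) e m = f m *: sigma_value Delta nu e m.
Proof.
move=> Cf Cn Ce.
have hAB := dsum_vbundle aM hT hd.
have Cs : smooth_section (fun y => f y *: nu y) by exact: (smooth_sectionZ aM hAB).
have /smooth_pairE[C1 C2] := Cn.
have Cc := smooth_core Ce.
have pE : pairing (nu m) (core e m) = ev (nu m).2 (e m).
  by rewrite /pairing /core /= ev0l addr0.
apply: CB_ext.
  rewrite sigma1E//.
  rewrite -[RHS]/(f m *: ((sigma_value Delta nu e m).1 : 'rV[R]_(n + rank E))).
  rewrite sigma1E// scale_row_mx; congr row_mx.
  rewrite /vpart DeltaZl// -[X in dloc _ _ _ X]addr0 dlocP dloc0 addr0.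
  have -> : (f m *: Delta nu (core e) m + pairing (nu m) (core e m) *: exact E f m).1 =
    f m *: (Delta nu (core e) m).1.
    rewrite -[LHS]/(f m *: (Delta nu (core e) m).1 + pairing (nu m) (core e m) *: (0 : E m)).
    by rewrite scaler0 addr0.
  by rewrite linearZ scalerBr.
move=> v; rewrite sigma2E//.
rewrite -[RHS]/(ev (f m *: (sigma_value Delta nu e m).2) v).
rewrite evZl sigma2E// DeltaZl//.
have td : trivs (dual E) (dual_triv (t0 m)) by exists (t0 m).
set u := lsubmx (v : 'rV[R]_(n + rank E)); set w := rsubmx (v : 'rV[R]_(n + rank E)).
have H := dlocZ aM td (tm0 m) u Cf C2.
rewrite -[X in dot X _ + _ - _](esym H) dotDl !dotZl.
rewrite [in X in _ + X - _]linearZ dotZl.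
rewrite -[X in _ - X]/(ev (f m *: (Delta nu (core e) m).2 + pairing (nu m)
    (core e m) *: differential f m) u).
rewrite evDl !evZl pE (ev_dot hE _ _ (tt0 m) (tm0 m)).
ring.
Qed.

Lemma Delta_core_lin a nu e e' m : smooth_section nu -> smooth_section e ->
  smooth_section e' ->
  Delta nu (core (fun y => a *: e y + e' y)) m =
  a *: Delta nu (core e) m + Delta nu (core e') m.
Proof.
move=> Cn Ce Ce'; rewrite -DeltaPr//; [|exact: smooth_core|exact: smooth_core].
congr (Delta nu _ m); apply: functional_extensionality_dep => y.
by rewrite /core; congr pair; rewrite /= scaler0 addr0.
Qed.

Lemma Delta_coreZ f nu e m : smooth_fun f -> smooth_section nu -> smooth_section e ->
  Delta nu (core (fun y => f y *: e y)) m =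
  f m *: Delta nu (core e) m + lie_fun (anchor nu) f m *: core e m.
Proof.
move=> Cf Cn Ce; rewrite -DeltaZr//; last exact: smooth_core.
congr (Delta nu _ m); apply: functional_extensionality_dep => y.
by rewrite /core; congr pair; rewrite /= scaler0.
Qed.

Lemma vpart_lin a nu s s' m : smooth_section nu -> smooth_section s ->
  smooth_section s' ->
  vpart nu (fun y => a *: s y + s' y) m = a *: vpart nu s m + vpart nu s' m.
Proof.
move=> Cn Cs Cs'; rewrite /vpart Delta_core_lin//.
rewrite (dloc_lin aM (tt0 m) (tm0 m))//.
have -> : (a *: Delta nu (core s) m + Delta nu (core s') m).1 =
  a *: (Delta nu (core s) m).1 + (Delta nu (core s') m).1 by [].
by rewrite linearP opprD scalerBr addrACA.
Qed.

(** The derivative of f e along X and Delta_nu (f e, 0) both contain X(f) e, by the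
    Leibniz rules; the two terms cancel. *)
Lemma vpart_indep nu e e' m : smooth_section nu -> smooth_section e ->
  smooth_section e' -> e m = e' m -> vpart nu e m = vpart nu e' m.
Proof.
move=> Cn Ce Ce'; apply: (tensorial hM hE (Phi := fun e => vpart nu e m)) => //.
  by move=> a s s' Cs Cs'; exact: vpart_lin.
move=> f s Cf Cs; rewrite /vpart Delta_coreZ//.
rewrite (dlocZ aM (tt0 m) (tm0 m))//.
have -> : (f m *: Delta nu (core s) m + lie_fun (anchor nu) f m *: core s m).1 =
  f m *: (Delta nu (core s) m).1 + lie_fun (anchor nu) f m *: s m by [].
rewrite linearP linearZ /lie_fun opprD scalerBr addrACA.
by rewrite subrr addr0.
Qed.

Lemma Delta2_indep nu e e' m : smooth_section nu -> smooth_section e ->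
  smooth_section e' -> e m = e' m ->
  (Delta nu (core e) m).2 = (Delta nu (core e') m).2.
Proof.
move=> Cn Ce Ce'; apply: (tensorial hM hE (Phi := fun e => (Delta nu (core e) m).2)) => //.
  by move=> a s s' Cs Cs'; rewrite Delta_core_lin.
move=> f s Cf Cs; rewrite Delta_coreZ//.
rewrite -[LHS]/(f m *: (Delta nu (core s) m).2 + lie_fun (anchor nu) f m *: 0).
by rewrite scaler0 addr0.
Qed.

Lemma sigma_indep nu nu' e e' m : smooth_section nu -> smooth_section nu' ->
  smooth_section e -> smooth_section e' -> nu m = nu' m -> e m = e' m ->
  sigma_value Delta nu e m = sigma_value Delta nu' e' m.
Proof.
move=> Cn Cn' Ce Ce' nn ee.
have hAB := dsum_vbundle aM hT hd.
have -> : sigma_value Delta nu e m = sigma_value Delta nu' e m.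
  apply: (tensorial hM hAB (Phi := fun nu => sigma_value Delta nu e m)) nn => //.
    by move=> a s s' Cs Cs'; exact: sigma_lin.
  by move=> f s Cf Cs; exact: sigma_homog.
apply: (@CB_ext (Tot (e m))).
  apply: etrans (sigma1E _ _ Ce) (etrans _ (esym (sigma1E _ _ Ce'))).
  by rewrite (vpart_indep _ _ _ ee).
move=> v; apply: etrans (@sigma2E nu' e m v Cn') (etrans _ (esym (@sigma2E nu' e' m v Cn'))).
by rewrite (Delta2_indep Cn' Ce Ce' ee) ee.
Qed.

(** By tensoriality in both arguments the description that defines [Sigma] has a
    unique solution. *)
Lemma SigmaE nu e m : smooth_section nu -> smooth_section e ->
  Sigma Delta (nu m) (e m) = sigma_value Delta nu e m.
Proof.
move=> Cn Ce; rewrite /Sigma /the; case: pselect => [h|[]].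
  by have := projT2 (cid h); apply.
exists (sigma_value Delta nu e m) => nu' e' Cn' Ce' nn ee.
by apply: sigma_indep.
Qed.

Lemma sections_through m (u : AB E m) (e0 : E m) :
  exists (nu : section (AB E)) (e : section E),
   [/\ smooth_section nu, smooth_section e, nu m = u & e m = e0].
Proof.
have hAB := dsum_vbundle aM hT hd.
have [nu [Cn <-]] := section_through hM hAB u.
by have [e [Ce <-]] := section_through hM hE e0; exists nu, e.
Qed.

Lemma Sigma_lin m a (u u' : AB E m) (e0 : E m) :
  Sigma Delta (a *: u + u') e0 = a *: Sigma Delta u e0 + Sigma Delta u' e0.
Proof.
have [nu [e [Cn Ce <- <-]]] := sections_through u e0.
have [nu' [_ [Cn' _ <- _]]] := sections_through u' e0.
have hAB := dsum_vbundle aM hT hd.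
rewrite !SigmaE// -sigma_lin//.
rewrite -(@SigmaE (fun y => a *: nu y + nu' y))//.
by apply: (smooth_sectionD aM hAB) => //; exact: (smooth_sectionZc aM hAB).
Qed.

Lemma r_EE m (e0 : E m) (theta : TsB (tot E) (Tot e0)) (a : E m) :
  ev (r_E theta) a = ev theta (vlift e0 a).
Proof.
rewrite /r_E ev_linfun// => k x y.
rewrite !vlift_at linearP -[X in row_mx X _](addr0 0) -add_row_mx.
rewrite -[X in row_mx X _ + _](scaler0 _ k) -scale_row_mx.
by rewrite evDr evZr.
Qed.

Lemma Phi_E_lin m (e0 : E m) a (w w' : CB (tot E) (Tot e0)) :
  Phi_E (a *: w + w') = a *: Phi_E w + Phi_E w'.
Proof.
rewrite /Phi_E; congr pair; first by rewrite /= linearP.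
apply: ev_inj => v.
rewrite -[RHS]/(ev (a *: r_E w.2 + r_E w'.2) v) evDl evZl !r_EE.
by rewrite -[LHS]/(ev (a *: w.2 + w'.2) _) evDl evZl.
Qed.

(** Sigma splits Phi_E: the projection kills core lifts, and what remains is the image
    of (Te X, d ell_eps), namely (X, eps). *)
Lemma Phi_E_Sigma m (u : AB E m) (e0 : E m) : Phi_E (Sigma Delta u e0) = u.
Proof.
have [nu [e [Cn Ce <- <-]]] := sections_through u e0.
rewrite SigmaE// /Phi_E tangent_proj_at sigma1E// row_mxKl.
rewrite [RHS]surjective_pairing; congr pair.
apply: ev_inj => v; rewrite r_EE sigma2E// vlift_at row_mxKl row_mxKr.
by rewrite dloc0 dot0l ev0r subr0 add0r (ev_dot hE _ _ (tt0 m) (tm0 m)).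
Qed.

Lemma vertP m (e0 : E m) (v : TB (tot E) (Tot e0)) :
  vertical v <-> exists a, v = vlift e0 a.
Proof.
rewrite /vertical /mkset tangent_proj_at; split=> [v0|[a ->]]; last first.
  by rewrite vlift_at row_mxKl.
exists ((tmap (t0 m) m)^-1%VF (rsubmx (v : 'rV[R]_(n + rank E)))).
rewrite vlift_at (tmapVK hE)//; apply: etrans (esym (hsubmxK (v : 'rV[R]_(n + rank E)))) _.
by rewrite v0.
Qed.

(** The vertical vectors are the vertical lifts, and r_E theta is the restriction of
    theta to these. *)
Lemma vertical_sum_annP m (e0 : E m) (w : CB (tot E) (Tot e0)) :
  vertical_sum_ann w <-> Phi_E w = 0.
Proof.
split=> [[h1 h2]|h].
  rewrite /Phi_E; congr pair; first exact: h1.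
  apply: ev_inj => a; rewrite r_EE ev0l; apply: h2; apply/vertP; by exists a.
have h1 : tangent_map (@Defs.proj _ _ _ E) (Tot e0 : tot E) w.1 = 0 by exact: (congr1 fst h).
have h2 : r_E w.2 = 0 by exact: (congr1 snd h).
by split=> // _ /vertP[a ->]; rewrite -r_EE h2 ev0l.
Qed.

Lemma Phi_core_lift m (e0 : E m) (tau : BB E m) : Phi_E (core_lift tau e0) = 0.
Proof.
rewrite /Phi_E; congr pair.
  by rewrite tangent_proj_at -[(core_lift tau e0).1]/(vlift e0 tau.1) vlift_at row_mxKl.
apply: ev_inj => a; rewrite r_EE ev0l /ev comp_lfunE tangent_proj_at vlift_at row_mxKl.
by rewrite linear0.
Qed.

(** A covector that vanishes on vertical vectors factors through Tq_E. *)
Lemma vertical_core_lift m (e0 : E m) (w : CB (tot E) (Tot e0)) :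
  Phi_E w = 0 -> exists tau : BB E m, w = core_lift tau e0.
Proof.
move=> /vertical_sum_annP[/vertP[a w1] w2].
pose g (X : TB M m) : R^o := ev w.2 (row_mx X 0 : 'rV[R]_(n + rank E)).
have lg : linear g.
  move=> k X Y; rewrite /g -[X in row_mx _ X](addr0 0) -add_row_mx.
  by rewrite -[X in row_mx _ X + _](scaler0 _ k) -scale_row_mx evDr evZr.
exists (a, linfun g : TsB M m); apply: CB_ext; first by rewrite w1.
move=> v; rewrite -[v in LHS](hsubmxK (v : 'rV[R]_(n + rank E))).
rewrite -[X in row_mx X _](addr0) -[X in row_mx _ X](add0r) -add_row_mx evDr.
rewrite [X in _ + X]w2 ?addr0; last first.
  by rewrite /vertical /mkset tangent_proj_at row_mxKl.
by rewrite /core_lift /= {2}/ev comp_lfunE tangent_proj_at linfunE.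
Qed.

(** This adjunction between core lifts and Phi_E makes the kernel of Phi_E its own
    orthogonal, and determines the orthogonal of L_Delta. *)
Lemma cpair_core_lift m (e0 : E m) (tau : BB E m) (w : CB (tot E) (Tot e0)) :
  cpair (core_lift tau e0) w = pairing (Phi_E w) tau.
Proof.
rewrite /cpair /pairing addrC /Phi_E; congr (_ + _).
  by rewrite r_EE.
by rewrite /core_lift /= /ev comp_lfunE.
Qed.

Lemma cpairC (x : tot E) (w w' : CB (tot E) x) : cpair w w' = cpair w' w.
Proof. by rewrite /cpair addrC. Qed.

Lemma cpairDl (x : tot E) (w w' z : CB (tot E) x) : cpair (w + w') z = cpair w z + cpair w' z.
Proof.
rewrite /cpair -[(w + w').1]/(w.1 + w'.1) -[(w + w').2]/(w.2 + w'.2) evDl evDr.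
by rewrite addrACA.
Qed.

Lemma cpairNl (x : tot E) (w z : CB (tot E) x) : cpair (- w) z = - cpair w z.
Proof.
by rewrite /cpair -[(- w).1]/(- w.1) -[(- w).2]/(- w.2) evNl evNr opprD.
Qed.

Lemma rV_separated k (v : 'rV[R]_k) :
  (forall phi : dual_space 'rV[R]_k, ev phi v = 0) -> v = 0.
Proof.
move=> H; apply/rowP => i; rewrite mxE.
have := H (linfun (fun u : 'rV[R]_k => u ord0 i : R^o)).
by rewrite ev_linfun// => a x y; rewrite !mxE.
Qed.

Lemma pairing_injl m (nu : AB E m) : (forall tau : BB E m, pairing nu tau = 0) -> nu = 0.
Proof.
move=> H; rewrite [LHS]surjective_pairing; congr pair.
  apply: rV_separated => phi; have := H (0, phi).
  by rewrite /pairing /= ev0r add0r.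
apply: ev_inj => a; have := H (a, 0).
by rewrite /pairing /= ev0l addr0 => ->; rewrite ev0l.
Qed.

Lemma pairing_injr m (tau : BB E m) : (forall nu : AB E m, pairing nu tau = 0) -> tau = 0.
Proof.
move=> H; rewrite [LHS]surjective_pairing; congr pair; last first.
  apply: ev_inj => X; have := H (X, 0).
  by rewrite /pairing /= ev0l add0r => ->; rewrite ev0l.
apply: (tmap_inj hE (tt0 m) (tm0 m)); rewrite linear0.
apply: rV_separated => phi; have := H (0, (phi \o tmap (t0 m) m)%VF).
by rewrite /pairing /= ev0r addr0 /ev comp_lfunE.
Qed.

End SigmaTheory.
(** * The dull bracket and the isotropy of L_Delta *)

Lemma theP (T : Type) (x0 : T) (P : T -> Prop) : (exists x, P x) -> P (the x0 P).
Proof. by move=> h; rewrite /the; case: pselect => // h'; exact: projT2 (cid h'). Qed.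

(** Locked for the same reason as [dloc]. *)
HB.lock Definition dval (R : realType) (n : nat) (M : premanifold R n)
    (f : M -> R) (m : M) (v : 'rV[R]_n) : R := ev (differential f m) (v : TB M m).

Section FunctionDifferentials.
Context {R : realType} {n : nat} {M : premanifold R n}.
Hypothesis hM : is_manifold M.
Let aM := manifold_atlas hM.

Lemma dval_lin a (f g : M -> R) m v : smooth_fun f -> smooth_fun g ->
  dval (fun y => a * f y + g y) m v = a * dval f m v + dval g m v.
Proof.
move=> Cf Cg; rewrite dval.unlock.
have df := fun_differentiable (atlas_chart_at aM m) (cdom_chart_at aM m) Cf.
have dg := fun_differentiable (atlas_chart_at aM m) (cdom_chart_at aM m) Cg.
have H := is_diffD (is_diffZ a (differentiableP df)) (differentiableP dg).
apply: etrans (differential_at _ _) (etrans _ (esym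
  (congr2 (fun p q => a * p + q) (differential_at f v) (differential_at g v)))).
exact: (congr1 (fun h => h v) (@diff_val _ _ _ _ _ _ _ H)).
Qed.

Lemma dvalM (f g : M -> R) m v : smooth_fun f -> smooth_fun g ->
  dval (fun y => f y * g y) m v = f m * dval g m v + dval f m v * g m.
Proof.
move=> Cf Cg; rewrite dval.unlock.
have df := fun_differentiable (atlas_chart_at aM m) (cdom_chart_at aM m) Cf.
have dg := fun_differentiable (atlas_chart_at aM m) (cdom_chart_at aM m) Cg.
have H := is_diff_scale df dg.
apply: etrans (differential_at _ _) (etrans _ (esym
  (congr2 (fun p q => f m * p + q * g m) (differential_at g v) (differential_at f v)))).
apply: etrans (congr1 (fun h => h v) (@diff_val _ _ _ _ _ _ _ H)) _.
by rewrite /comp (cmapK aM)//; [exact: atlas_chart_at|exact: cdom_chart_at].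
Qed.

(** A linear function of the coordinates, cut off by a bump function. *)
Lemma differential_through m (theta : TsB M m) :
  exists f : M -> R, smooth_fun f /\ differential f m = theta.
Proof.
set c := chart_at M m.
have ac : atlas M c by exact: atlas_chart_at.
have cm : cdom c m by exact: cdom_chart_at.
have oU : mopen (cdom c) by exact: mopen_cdom.
have [chi [V [K [Cchi oV Vm chi1 [VK KU oK chi0]]]]] := bump hM oU cm.
pose th : 'Hom('rV[R]_n, R^o) := theta.
exists (fun y => chi y * th (cmap c y)); split.
  apply: (smooth_on_cut hM (W := R^o) oU KU oK chi0 Cchi).
  apply: (smooth_on_comp_chart aM (c := c) (B := setT) (g := th : 'rV[R]_n -> R^o)) => //.
  exact: Cinf_linear.
apply: ev_inj => v; rewrite differential_at.
have oN : open (cimg c V) by exact: open_cimg.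
have H := is_diff_linear (th : {linear 'rV[R]_n -> R^o}) (cmap c m).
apply: etrans (esym (eq_diff v oN (cimg_cmap cm Vm) (f := th : 'rV[R]_n -> R^o) _ _)) _.
- move=> z /(cimgP aM _ _ ac)[k1 k2 k3]; rewrite /comp chi1// mul1r.
  by rewrite k3.
- by have [] := H.
- exact: (congr1 (fun h => h v) (@diff_val _ _ _ _ _ _ _ H)).
Qed.

Lemma lie_funE (X : section (TB M)) f m : lie_fun X f m = dval f m (X m).
Proof. by rewrite dval.unlock. Qed.

Lemma smooth_lie (X : section (TB M)) (f : M -> R) : smooth_section X ->
  smooth_fun f -> smooth_fun (lie_fun X f).
Proof.
move=> CX Cf; apply: (smooth_ev aM (TB_vbundle aM) (mopenT aM)) => //.
exact: (smooth_differential aM (mopenT aM) Cf).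
Qed.

End FunctionDifferentials.

Section Dull.
Context {R : realType} {n : nat} {M : premanifold R n}.
Hypothesis hM : is_manifold M.
Let aM := manifold_atlas hM.
Variable E : prebundle M.
Hypothesis hE : is_vbundle E.
Let aT := tot_atlas aM hE.
Let hT := TB_vbundle aM.
Let hd := dual_vbundle aM hE.
Let hAB := dsum_vbundle aM hT hd.
Let hBB := dsum_vbundle aM hE (dual_vbundle aM hT).
Variable Delta : section (AB E) -> section (BB E) -> section (BB E).
Hypothesis hD : is_dorfman Delta.

Lemma pairingPr m (nu : AB E m) a (tau tau' : BB E m) :
  pairing nu (a *: tau + tau') = a * pairing nu tau + pairing nu tau'.
Proof.
rewrite /pairing -[(a *: tau + tau').1]/(a *: tau.1 + tau'.1).
rewrite -[(a *: tau + tau').2]/(a *: tau.2 + tau'.2) !evDr !evDl evZr evZl.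
ring.
Qed.

Lemma pairingPl m (nu nu' : AB E m) a (tau : BB E m) :
  pairing (a *: nu + nu') tau = a * pairing nu tau + pairing nu' tau.
Proof.
rewrite /pairing -[(a *: nu + nu').1]/(a *: nu.1 + nu'.1).
rewrite -[(a *: nu + nu').2]/(a *: nu.2 + nu'.2) !evDr !evDl evZr evZl.
ring.
Qed.

Lemma pairing0r m (nu : AB E m) : pairing nu 0 = 0.
Proof. by rewrite /pairing ev0r ev0l addr0. Qed.

Lemma pairing0l m (tau : BB E m) : pairing 0 tau = 0.
Proof. by rewrite /pairing ev0r ev0l addr0. Qed.

Lemma pairingNl m (nu : AB E m) (tau : BB E m) : pairing (- nu) tau = - pairing nu tau.
Proof. by rewrite -[- nu]addr0 -scaleN1r pairingPl pairing0l addr0 mulN1r. Qed.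

Lemma pairingZr m (nu : AB E m) a (tau : BB E m) :
  pairing nu (a *: tau) = a * pairing nu tau.
Proof. by rewrite -[a *: tau]addr0 pairingPr pairing0r addr0. Qed.

Lemma smooth_pairing U (nu : section (AB E)) (tau : section (BB E)) : mopen U ->
  smooth_section_on U nu -> smooth_section_on U tau ->
  smooth_on (W := R^o) U (fun y => pairing (nu y) (tau y)).
Proof.
move=> oU /(smooth_section_on_dsum aM hT hd _ oU)[Cn1 Cn2].
move=> /(smooth_section_on_dsum aM hE (dual_vbundle aM hT) _ oU)[Ct1 Ct2].
apply: smooth_onD => //; first exact: (smooth_ev aM hE).
exact: (smooth_ev aM hT).
Qed.

(** The pairings with a local frame of E + T^*M are the coordinates of nu. *)
Lemma smooth_by_pairing (nu : section (AB E)) :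
  (forall tau, smooth_section tau -> smooth_fun (fun y => pairing (nu y) (tau y))) ->
  smooth_section nu.
Proof.
move=> H; apply: (smooth_section_on_triv aM hAB (mopenT aM)) => x _.
set c := chart_at M x; set t := triv_at E x.
have ac : atlas M c by exact: atlas_chart_at.
have tt : trivs E t by exact: (trivs_at hE).
have tc : trivs (TB M) (tangent_triv c) by exists c.
have td : trivs (dual E) (dual_triv t) by exists t.
have tcd : trivs (TsB M) (dual_triv (tangent_triv c)) by exists (tangent_triv c).
pose tA : triv (AB E) (rank (AB E)) := dsum_triv (tangent_triv c) (dual_triv t).
pose tB : triv (BB E) (rank (BB E)) := dsum_triv t (dual_triv (tangent_triv c)).
have ttA : trivs (AB E) tA by exists (tangent_triv c) => //; exists (dual_triv t).
have ttB : trivs (BB E) tB by exists t => //; exists (dual_triv (tangent_triv c)).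
have tAx : tdom tA x by split; [exact: (cdom_chart_at aM)|exact: (tdom_at hE)].
have tBx : tdom tB x by split; [exact: (tdom_at hE)|exact: (cdom_chart_at aM)].
have [V [s [oV Vx Vt Cs sE]]] := cst_sections hM hBB ttB tBx.
exists tA, V; split => //.
have oN : mopen (V `&` tdom tA) by apply: mopenI => //; exact: (mopen_tdom hAB).
have sc w y : V y -> row_mx (tmap t y (s w y).1)
    (tmap (dual_triv (tangent_triv c)) y (s w y).2) = w.
  move=> Vy; have /= := dsum_trivE t (dual_triv (tangent_triv c) : triv (TsB M) n) (s w y).
  by rewrite sE// => <-; apply: (tmapVK hBB ttB); exact: Vt.
have pE w y : V y -> pairing (nu y) (s w y) =
    dot (tmap (dual_triv t) y (nu y).2) (lsubmx (w : 'rV[R]_(rank E + n)))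
    + dot (rsubmx (w : 'rV[R]_(rank E + n))) (tmap (tangent_triv c) y (nu y).1).
  move=> Vy; have [ty cy] := Vt _ Vy.
  rewrite /pairing (ev_dot hE _ _ tt ty) (ev_dot hT _ _ tc cy).
  by rewrite -[in RHS](sc w y Vy) row_mxKl row_mxKr.
have CsN w : smooth_on (W := R^o) (V `&` tdom tA) (fun y => pairing (nu y) (s w y)).
  by apply: smooth_on_sub (H _ (Cs w)) => y.
apply: (iffRL (smooth_on_rV _ oN)) => i.
have [j ->|j ->] := @split_ordP n (rank E) i.
  apply: (eq_smooth_on aM oN) (CsN (row_mx 0 (delta_mx 0 j) : 'rV[R]_(rank E + n))) => y [Vy _].
  rewrite pE// row_mxKl row_mxKr dot0r add0r dot_deltal.
  by rewrite (dsum_trivE (tangent_triv c : triv (TB M) n) (dual_triv t : triv (dual E)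
      (rank E))) row_mxEl.
apply: (eq_smooth_on aM oN) (CsN (row_mx (delta_mx 0 j) 0 : 'rV[R]_(rank E + n))) => y [Vy _].
rewrite pE// row_mxKl row_mxKr dot0l addr0 dot_deltar.
by rewrite (dsum_trivE (tangent_triv c : triv (TB M) n) (dual_triv t : triv (dual E)
    (rank E))) row_mxEr.
Qed.

(** The functional of tau which the dull bracket represents through the pairing. *)
Definition dull_fun (nu1 nu2 : section (AB E)) (tau : section (BB E)) (m : M) : R :=
  lie_fun (anchor nu1) (fun m => pairing (nu2 m) (tau m)) m
  - pairing (nu2 m) (Delta nu1 tau m).

Lemma dull_fun_lin nu1 nu2 a tau tau' m :
  smooth_section nu1 -> smooth_section nu2 -> smooth_section tau -> smooth_section tau' ->
  dull_fun nu1 nu2 (fun y => a *: tau y + tau' y) m =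
  a * dull_fun nu1 nu2 tau m + dull_fun nu1 nu2 tau' m.
Proof.
move=> C1 C2 Ct Ct'; rewrite /dull_fun (DeltaPr hD)// pairingPr !lie_funE.
rewrite (_ : (fun y => pairing (nu2 y) (a *: tau y + tau' y)) =
   (fun y => a * pairing (nu2 y) (tau y) + pairing (nu2 y) (tau' y))); last first.
  by apply/funext => y; rewrite pairingPr.
have Cp t : smooth_section t -> smooth_fun (fun y => pairing (nu2 y) (t y)).
  exact: (smooth_pairing (mopenT aM) C2).
rewrite (dval_lin hM _ _ _ (Cp _ Ct) (Cp _ Ct')).
move: (dval _ _ _) (dval _ _ _) (pairing _ _) (pairing _ _) => x y z w; ring.
Qed.

Lemma dull_fun_homog nu1 nu2 f tau m :
  smooth_section nu1 -> smooth_section nu2 -> smooth_fun f -> smooth_section tau ->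
  dull_fun nu1 nu2 (fun y => f y *: tau y) m = f m * dull_fun nu1 nu2 tau m.
Proof.
move=> C1 C2 Cf Ct; rewrite /dull_fun (DeltaZr hD)// pairingPr pairingZr !lie_funE.
rewrite (_ : (fun y => pairing (nu2 y) (f y *: tau y)) =
   (fun y => f y * pairing (nu2 y) (tau y))); last first.
  by apply/funext => y; rewrite pairingZr.
rewrite dvalM//; last exact: (smooth_pairing (mopenT aM)).
move: (dval _ _ _) (dval _ _ _) (pairing _ _) (pairing _ _) => x y z w; ring.
Qed.

Lemma dull_fun_tensorial nu1 nu2 m tau tau' : smooth_section nu1 ->
  smooth_section nu2 -> smooth_section tau -> smooth_section tau' ->
  tau m = tau' m -> dull_fun nu1 nu2 tau m = dull_fun nu1 nu2 tau' m.
Proof.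
move=> C1 C2 Ct Ct'.
apply: (tensorial hM hBB (W := R^o) (Phi := fun tau => dull_fun nu1 nu2 tau m)) => //.
  by move=> a s s' Cs Cs'; exact: dull_fun_lin.
by move=> f s Cf Cs; exact: dull_fun_homog.
Qed.

Lemma smooth_dull_fun nu1 nu2 tau : smooth_section nu1 -> smooth_section nu2 ->
  smooth_section tau -> smooth_fun (dull_fun nu1 nu2 tau).
Proof.
move=> C1 C2 Ct.
have CX : smooth_section (anchor nu1) by have [] := iffLR (smooth_pairE hM hE nu1) C1.
apply: smooth_onD; [exact: mopenT| |apply: smooth_onN; first exact: mopenT].
  by apply: (smooth_lie hM) => //; exact: (smooth_pairing (mopenT aM)).
apply: (smooth_pairing (mopenT aM)) => //.
by have [H _ _ _ _] := hD; exact: H.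
Qed.

(** The functional is tensorial in tau by the Leibniz rule for Delta, so it is given by
    a linear form on each fibre, and the pairing is non-degenerate. *)
Lemma dull_bracket_exists nu1 nu2 : smooth_section nu1 -> smooth_section nu2 ->
  exists beta : section (AB E), smooth_section beta /\
    forall tau, smooth_section tau -> forall m,
      pairing (beta m) (tau m) = dull_fun nu1 nu2 tau m.
Proof.
move=> C1 C2.
have H m (tau0 : BB E m) := section_through hM hBB tau0.
pose thr m (tau0 : BB E m) : section (BB E) := projT1 (cid (H m tau0)).
have Cthr m (tau0 : BB E m) : smooth_section (thr m tau0) by exact: (projT2 (cid (H m tau0))).1.
have thrE m (tau0 : BB E m) : thr m tau0 m = tau0 by exact: (projT2 (cid (H m tau0))).2.
pose K m (tau0 : BB E m) := dull_fun nu1 nu2 (thr m tau0) m.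
have KE tau m : smooth_section tau -> K m (tau m) = dull_fun nu1 nu2 tau m.
  by move=> Ct; apply: dull_fun_tensorial => //; rewrite thrE.
have Klin m a (t t' : BB E m) : K m (a *: t + t') = a * K m t + K m t'.
  rewrite /K -dull_fun_lin//; apply: dull_fun_tensorial => //; last by rewrite !thrE.
  by apply: (smooth_sectionD aM hBB) => //; exact: (smooth_sectionZc aM hBB).
(* the coordinate forms, dual to the standard basis of T_mM = R^n *)
pose cf m (i : 'I_n) : TsB M m := linfun (fun v : 'rV[R]_n => v ord0 i : R^o).
have cfE m i (v : TB M m) : ev (cf m i) v = (v : 'rV[R]_n) ord0 i.
  by rewrite ev_linfun// => a x y; rewrite !mxE.
pose beta : section (AB E) := fun m =>
  (\row_i K m (0, cf m i), linfun (fun e : E m => K m (e, 0) : R^o)).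
have betaE m (tau : BB E m) : pairing (beta m) tau = K m tau.
  rewrite /pairing /beta /= ev_linfun; last first.
    move=> a x y; rewrite -[RHS]Klin; congr (K m).
    by congr pair; rewrite /= scaler0 addr0.
  have K0 : K m 0 = 0.
    by have := Klin m (-1) 0 0; rewrite scaleN1r oppr0 addr0 mulN1r addNr.
  have Kth (th : TsB M m) : ev th (\row_i K m (0, cf m i)) = K m (0, th).
    have -> : (0, th) = \sum_(i < n) ev th (delta_mx 0 i : 'rV[R]_n) *:
        ((0, cf m i) : BB E m) :> BB E m.
      have Es (r : seq 'I_n) : \sum_(i <- r) ev th (delta_mx 0 i : 'rV[R]_n) *:
          ((0, cf m i) : BB E m) = (0, \sum_(i <- r) ev th
              (delta_mx 0 i : 'rV[R]_n) *: cf m i) :> BB E m.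
        elim: r => [|i r IH]; first by rewrite !big_nil.
        rewrite !big_cons IH; congr pair; by rewrite /= scaler0 addr0.
      rewrite Es; congr pair; apply: ev_inj => v.
      rewrite [v in LHS](row_sum_delta (v : 'rV[R]_n)).
      rewrite /ev linear_sum sum_lfunE; apply: eq_bigr => i _.
      rewrite -[RHS]/(ev (ev th (delta_mx 0 i : 'rV[R]_n) *: cf m i) v) evZl cfE.
      by rewrite -[LHS]/(ev th (v ord0 i *: delta_mx 0 i)) evZr mulrC.
    rewrite {1}/ev linear_row.
    have Ks (r : seq 'I_n) (a : 'I_n -> R) (x : 'I_n -> BB E m) :
        K m (\sum_(i <- r) a i *: x i) = \sum_(i <- r) a i * K m (x i).
      by elim: r => [|i r IH]; rewrite ?big_nil// !big_cons Klin IH.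
    rewrite Ks; apply: eq_bigr => i _; by rewrite mxE mulrC.
  rewrite Kth -[X in _ + X]mul1r addrC -Klin; congr (K m).
  rewrite [RHS]surjective_pairing; congr pair; rewrite /= ?scaler0 ?add0r//.
  by rewrite addr0 scale1r.
exists beta; split => [|tau Ct m]; last by rewrite betaE KE.
apply: smooth_by_pairing => tau Ct.
have -> : (fun y => pairing (beta y) (tau y)) = dull_fun nu1 nu2 tau.
  by apply/funext => y; rewrite betaE KE.
exact: smooth_dull_fun.
Qed.

Lemma dull_bracketP nu1 nu2 tau m : smooth_section nu1 -> smooth_section nu2 ->
  smooth_section tau ->
  pairing (dull_bracket Delta nu1 nu2 m) (tau m) = dull_fun nu1 nu2 tau m.
Proof.
move=> C1 C2 Ct; have [_] := theP (fun m => 0 : AB E m) (dull_bracket_exists C1 C2).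
by move=> /(_ _ Ct m) <-.
Qed.

Lemma ev_sigma nu1 nu2 (e : section E) m : smooth_section nu1 -> smooth_section nu2 ->
  smooth_section e ->
  ev (sigma_value Delta nu1 e m).2 (sigma_value Delta nu2 e m).1 =
  lie_fun (anchor nu2) (fun y => pairing (nu1 y) (core e y)) m
  - ev (nu1 m).2 (Delta nu2 (core e) m).1 - ev (Delta nu1 (core e) m).2 (nu2 m).1.
Proof.
move=> C1 C2 Ce; rewrite (sigma2E hM hE)// (sigma1E hM hE)// row_mxKl row_mxKr.
congr (_ - _).
rewrite (_ : (fun y => pairing _ _) = (fun y => ev (nu1 y).2 (e y))); last first.
  by apply/funext => y; rewrite /pairing /core /= ev0l addr0.
have /(smooth_pairE hM hE)[_ C12] := C1.
have tt := trivs_at hE m; have tm := tdom_at hE m.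
rewrite /lie_fun (differential_ev aM hE tt tm)//.
by rewrite /vpart dotDr dotNr addrA (ev_dot hE _ _ tt tm).
Qed.

(** The right-hand side is the pairing of [[nu1, nu2]] + [[nu2, nu1]] with (e, 0), see
    [dull_bracketP]. The derivatives of e in the tangent parts and those of eps in the
    cotangent parts combine into derivatives of <nu1, (e, 0)> and <nu2, (e, 0)>. *)
Lemma cpair_sigma nu1 nu2 (e : section E) m : smooth_section nu1 -> smooth_section nu2 ->
  smooth_section e ->
  cpair (sigma_value Delta nu1 e m) (sigma_value Delta nu2 e m) =
  dull_fun nu1 nu2 (core e) m + dull_fun nu2 nu1 (core e) m.
Proof.
move=> C1 C2 Ce; rewrite /cpair !ev_sigma// /dull_fun /pairing.
ring.
Qed.

(** As Delta_nu (0, df) = (0, d(X(f))), the functional has the value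
    X1(X2(f)) - X2(X1(f)) on (0, df), which is skew-symmetric whatever Delta is. *)
Lemma dull_fun_exact nu1 nu2 f m :
  smooth_section nu1 -> smooth_section nu2 -> smooth_fun f ->
  dull_fun nu1 nu2 (exact E f) m + dull_fun nu2 nu1 (exact E f) m = 0.
Proof.
move=> C1 C2 Cf.
have pe (nu : section (AB E)) g :
    (fun y => pairing (nu y) (exact E g y)) = lie_fun (anchor nu) g.
  by apply/funext => y; rewrite /pairing /exact /= ev0r add0r.
have [_ _ _ _ He] := hD.
rewrite /dull_fun !pe !He//.
have pe' (nu : section (AB E)) g : pairing (nu m) (exact E g m) = lie_fun (anchor nu) g m.
  by rewrite -[LHS]/((fun y => pairing (nu y) (exact E g y)) m) pe.
rewrite !pe'; ring.
Qed.

Lemma smooth_exact f : smooth_fun f -> smooth_section (exact E f).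
Proof.
move=> Cf; apply/(smooth_section_on_dsum aM hE (dual_vbundle aM hT) _ (mopenT aM)).
split; first exact: smooth_section0.
exact: (smooth_differential aM (mopenT aM) Cf).
Qed.

Lemma L_DeltaP m (e0 : E m) (w : CB (tot E) (Tot e0)) :
  L_Delta Delta w <-> exists u : AB E m, w = Sigma Delta u e0.
Proof. by split=> [[u _ <-]|[u ->]]; exists u. Qed.

(** At a point every element of E + T^*M is a sum (e, 0) + (0, df). The symmetric part
    of the dull bracket is tested on the first kind by L_Delta, through [cpair_sigma],
    and vanishes on the second kind by [dull_fun_exact]. *)
Theorem skew_isotropic : dull_skew Delta <-> isotropic (L_Delta Delta).
Proof.
split=> [sk [m e0] w /L_DeltaP[u ->] _ /L_DeltaP[u' ->]|iso nu1 nu2 C1 C2 m].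
  have [nu1 [e [C1 Ce <- <-]]] := sections_through hM hE u e0.
  have [nu2 [_ [C2 _ <- _]]] := sections_through hM hE u' e0.
  rewrite !(SigmaE hM hE hD)// cpair_sigma//.
  have Cc := smooth_core hM hE Ce.
  rewrite -!dull_bracketP// (sk _ _ C1 C2 m).
  by rewrite pairingNl addNr.
apply/eqP; rewrite -addr_eq0; apply/eqP; apply: (pairing_injl) => tau0.
have [e [Ce em]] := section_through hM hE tau0.1.
have [f [Cf fm]] := differential_through hM tau0.2.
have -> : tau0 = 1 *: core e m + exact E f m.
  rewrite scale1r [LHS]surjective_pairing -em -fm.
  by congr pair; rewrite /= ?addr0 ?add0r.
have Cc := smooth_core hM hE Ce; have Cx := smooth_exact Cf.
rewrite pairingPr mul1r.
have pD tau : smooth_section tau -> pairing (dull_bracket Delta nu1 nu2 m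
    + dull_bracket Delta nu2 nu1 m) (tau m) = dull_fun nu1 nu2 tau m + dull_fun nu2 nu1 tau m.
  by move=> Ct; rewrite -[X in X + _]scale1r pairingPl mul1r !dull_bracketP.
rewrite !pD// dull_fun_exact// addr0 -cpair_sigma//.
rewrite -!(SigmaE hM hE hD)//.
by apply: (iso (Tot (e m))); apply/L_DeltaP; eexists.
Qed.

End Dull.

(** * Subbundles and coordinate formula for the exterior derivative *)

Section Subbundles.
Context {R : realType} {n : nat} {M : premanifold R n}.

(** The images of the standard basis form the required frames. *)
Lemma subbundle_param (E : prebundle M) (D : forall m, set (E m)) r :
  (forall x, exists (U : set M) (Lam : forall y, 'rV[R]_r -> E y),
    [/\ mopen U, U x, (forall w, smooth_section_on U (fun y => Lam y w)) &
      forall y, U y -> [/\ linear (Lam y), injective (Lam y) &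
        forall w, D y w <-> exists u, w = Lam y u]]) ->
  is_subbundle D.
Proof.
move=> H; exists r => x; have [U [Lam [oU Ux CL HL]]] := H x.
exists U, (fun i y => Lam y (delta_mx 0 i)); split => // y /HL[linL injL DL].
pose LM := GRing.isLinear.Build R _ _ _ (Lam y) linL.
pose L : {linear 'rV[R]_r -> E y} := HB.pack (Lam y) LM.
have LE u : Lam y u = \sum_(i < r) u ord0 i *: Lam y (delta_mx 0 i) by exact: (linear_row L u).
pose X : r.-tuple (E y) := [tuple Lam y (delta_mx 0 i) | i < r].
have XE (i : 'I_r) : X`_i = Lam y (delta_mx 0 i) by rewrite -tnth_nth tnth_mktuple.
have -> : [seq Lam y (delta_mx 0 i) | i <- enum 'I_r] = X by [].
split.
  apply/freeP => k Hk i.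
  have : Lam y (\row_i k i) = Lam y 0.
    rewrite LE (_ : Lam y 0 = 0); last exact: (linear0 L).
    by rewrite -[RHS]Hk; apply: eq_bigr => j _; rewrite mxE XE.
  by move=> /injL/rowP/(_ i); rewrite !mxE.
apply/seteqP; split=> w.
  move=> /DL[u ->]; rewrite /= LE; apply: memv_suml => i _; apply: memvZ.
  by apply: memv_span; apply: (map_f (fun i => Lam y (delta_mx 0 i))); rewrite mem_enum.
move=> /= wX; apply/DL; exists (\row_i coord X i w).
apply: etrans (coord_span (X := X) wX) _; rewrite LE; apply: eq_bigr => i _.
by rewrite mxE XE.
Qed.

Lemma full_subbundle (aM : is_atlas M) (E : prebundle M) (hE : is_vbundle E)
    (D : forall m, set (E m)) : (forall m, D m = setT) -> is_subbundle D.
Proof.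
move=> DT; apply: (@subbundle_param E D (rank E)) => x.
have tt := trivs_at hE x; set t := triv_at E x in tt.
exists (tdom t), (fun y w => (tmap t y)^-1%VF w); split.
- exact: (mopen_tdom hE).
- exact: (tdom_at hE).
- by move=> w; exact: smooth_section_on_cst.
- move=> y ty; split.
  + by move=> a u v; rewrite linearP.
  + exact: (can_inj (tmapVK hE tt ty)).
  + move=> w; rewrite DT; split=> // _; exists (tmap t y w).
    by rewrite (tmapK hE).
Qed.

End Subbundles.

Section ExteriorDerivative.
Context {R : realType} {p : nat} {N : premanifold R p}.
Hypothesis aN : is_atlas N.
Let hT := TB_vbundle aN.

Lemma eq_diff0 (W : normedModType R) k (O : set 'rV[R]_k) (f : 'rV[R]_k -> W) z v :
  open O -> O z -> (forall y, O y -> f y = 0) -> 'd f z v = 0.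
Proof.
move=> oO Oz f0.
have H : is_diff z (fun _ : 'rV[R]_k => 0 : W) 0 by exact: is_diff_cst.
apply: etrans (esym (eq_diff v oO Oz (f := fun _ => 0 : W) _ _)) _.
- by move=> y /f0.
- by have [] := H.
- exact: (congr1 (fun h => h v) (@diff_val _ _ _ _ _ _ _ H)).
Qed.

Lemma local_form_diff (theta : section (TsB N)) x u v : smooth_section theta ->
  'd (local_form (chart_at N x) theta v) (cmap (chart_at N x) x) u =
  dot ('d (loc (E := TsB N) (chart_at N x) (dual_triv (tangent_triv (chart_at N x))) theta)
          (cmap (chart_at N x) x) u) v.
Proof.
move=> Ct; set c := chart_at N x.
have ac : atlas N c by exact: atlas_chart_at.
have cx : cdom c x by exact: cdom_chart_at.
have tc : trivs (TB N) (tangent_triv c) by exists c.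
have td : trivs (TsB N) (dual_triv (tangent_triv c)) by exists (tangent_triv c).
have dl := loc_differentiable (E := TsB N) ac td cx cx (mopenT aN) I Ct.
have dv : differentiable (fun _ : 'rV[R]_p => v) (cmap c x) by exact: differentiable_cst.
have H := is_diff_dot dl dv.
have oN : open (cimg c setT) by apply: open_cimg => //; exact: mopenT.
apply: etrans (esym (eq_diff u oN (cimg_cmap cx I) (f := fun z => dot (loc (E := TsB N) c
    (dual_triv (tangent_triv c)) theta z) v : R^o) _ _)) _.
- move=> z /(cimgP aN _ _ ac)[k1 k2 k3].
  rewrite /local_form (ev_dot hT _ _ tc k1); congr dot.
  by rewrite (tmapVK hT tc k1).
- by have [] := H.
apply: etrans (congr1 (fun h => h u) (@diff_val _ _ _ _ _ _ _ H)) _.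
have Hc := is_diff_cst v (cmap c x).
have E0 : 'd (fun _ : 'rV[R]_p => v) (cmap c x) u = 0.
  exact: (congr1 (fun h => h u) (@diff_val _ _ _ _ _ _ _ Hc)).
exact: (etrans (congr2 +%R erefl (etrans (congr1 (dot _) E0) (dot0r _))) (addr0 _)).
Qed.

Lemma extdE (theta : section (TsB N)) x u v : smooth_section theta ->
  extd theta (u : TB N x) (v : TB N x) =
  dot ('d (loc (E := TsB N) (chart_at N x) (dual_triv (tangent_triv (chart_at N x))) theta)
          (cmap (chart_at N x) x) u) v
  - dot ('d (loc (E := TsB N) (chart_at N x) (dual_triv (tangent_triv (chart_at N x))) theta)
          (cmap (chart_at N x) x) v) u.
Proof. by move=> Ct; rewrite /extd; congr (_ - _); exact: local_form_diff. Qed.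

Lemma interior_extdE (X : section (TB N)) (theta : section (TsB N)) x v :
  smooth_section theta ->
  ev (interior_extd X theta x) v = extd theta (X x) v.
Proof.
move=> Ct; rewrite /interior_extd ev_linfun// => a u w.
rewrite !extdE// linearP dotDr dotZr dotDl dotZl.
rewrite /GRing.scale/=; ring.
Qed.

End ExteriorDerivative.

(** * The vertical Dirac structure and the complement L_Delta *)

Section LinearStructure.
Context {R : realType} {n : nat} {M : premanifold R n}.
Hypothesis hM : is_manifold M.
Let aM := manifold_atlas hM.
Variable E : prebundle M.
Hypothesis hE : is_vbundle E.
Let aT := tot_atlas aM hE.
Let hT := TB_vbundle aM.
Let hd := dual_vbundle aM hE.
Let hAB := dsum_vbundle aM hT hd.
Let hTT := TB_vbundle aT.
Let hdT := dual_vbundle aT hTT.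
Let hCB := dsum_vbundle aT hTT hdT.

(** By [cpair_core_lift], an element w is orthogonal to all core lifts if and only if
    Phi_E w pairs to zero with E + T^*M, that is Phi_E w = 0. *)
Lemma vertical_orth (x : tot E) :
  vertical_sum_ann (x := x) = orth (fun y : tot E => vertical_sum_ann (x := y)) (x := x).
Proof.
case: x => m e0; apply/seteqP; split=> w.
  move=> /(vertical_sum_annP hM hE) w0 w' /(vertical_sum_annP hM hE).
  move=> /(vertical_core_lift hM hE)[tau ->].
  by rewrite cpairC (cpair_core_lift hM hE) w0 pairing0l.
move=> H; apply/(vertical_sum_annP hM hE); apply: pairing_injl => tau.
rewrite -(cpair_core_lift hM hE) cpairC; apply: H.
by apply/(vertical_sum_annP hM hE); exact: (Phi_core_lift hM hE).
Qed.

Lemma vertical_charts c t m (e0 : E m) (v : TB (tot E) (Tot e0)) :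
  atlas M c -> trivs E t -> cdom c m -> tdom t m ->
  vertical v <-> lsubmx (tmap (tangent_triv (tot_chart c t : chart R (tot E) (n + rank E)))
      (Tot e0) v) = 0.
Proof.
move=> ac tt cm tm; rewrite -(tangent_projE aM hE ac tt v cm tm).
have tc : trivs (TB M) (tangent_triv c) by exists c.
rewrite /vertical /mkset; split=> [->|]; first by rewrite linear0.
by rewrite -{1}(linear0 (tmap (tangent_triv c) m)) => /(tmap_inj hT tc cm).
Qed.

Lemma vertical_subbundle : is_subbundle (fun x : tot E => vertical_sum_ann (x := x)).
Proof.
apply: (@subbundle_param _ _ _ (CB (tot E)) _ (rank E + n)) => x0.
set c := chart_at M (base x0); set t := triv_at E (base x0).
have ac : atlas M c by exact: atlas_chart_at.
have tt : trivs E t by exact: (trivs_at hE).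
pose C : chart R (tot E) (n + rank E) := tot_chart c t.
have aC : atlas (tot E) C by exact: atlas_tot_chart.
have tC : trivs (TB (tot E)) (tangent_triv C) by exists C.
have tdC : trivs (TsB (tot E)) (dual_triv (tangent_triv C)) by exists (tangent_triv C).
pose T := dsum_triv (tangent_triv C : triv (TB (tot E)) (n + rank E))
   (dual_triv (tangent_triv C) : triv (TsB (tot E)) (n + rank E)).
have tT : trivs (CB (tot E)) T.
  by exists (tangent_triv C) => //; exists (dual_triv (tangent_triv C)).
(* vertical vectors have coordinates (0, a), their annihilators (th, 0) *)
pose iota (w : 'rV[R]_(rank E + n)) : 'rV[R]_((n + rank E) + (n + rank E)) :=
  row_mx (row_mx 0 (lsubmx w)) (row_mx (rsubmx w) 0).
have iota_lin : linear iota.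
  move=> a u v; rewrite /iota !linearP /= !scale_row_mx !add_row_mx.
  by rewrite !scaler0 !addr0.
have iota_inj : injective iota.
  move=> u v /eq_row_mx[/eq_row_mx[_ h1] /eq_row_mx[h2 _]].
  by rewrite -[u]hsubmxK -[v]hsubmxK h1 h2.
exists (cdom C), (fun y w => (tmap T y)^-1%VF (iota w)); split.
- exact: (mopen_cdom aT).
- by split; [exact: (cdom_chart_at aM)|exact: (tdom_at hE)].
- move=> w; have := smooth_section_on_cst hCB (iota w) tT.
  by rewrite (_ : tdom T = cdom C)//= setIid.
move=> y Cy; have Ty : tdom T y by split.
split.
- by move=> a u v; rewrite iota_lin linearP.
- by move=> u v /(can_inj (tmapVK hCB tT Ty))/iota_inj.
move=> w; split; last first.
  move=> [u ->] {w}; have := tmapVK hCB tT Ty (iota u).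
  move: ((tmap T y)^-1%VF (iota u)) => w'.
  rewrite (dsum_trivE (tangent_triv C : triv (TB (tot E)) (n + rank E))
    (dual_triv (tangent_triv C) : triv (TsB (tot E)) (n + rank E))).
  move=> /eq_row_mx[h1 h2].
  move: y Cy Ty w' h1 h2 => [m e0] [cm tm] Ty w' h1 h2.
  split; first by apply/(vertical_charts _ ac tt cm tm); rewrite h1 row_mxKl.
  move=> v /(vertical_charts _ ac tt cm tm) v0.
  rewrite (ev_dot hTT _ _ tC (conj cm tm)) h2.
  rewrite -[X in dot _ X]hsubmxK v0 dot_row_mx dot0l addr0.
  by rewrite dot0r.
move=> [h1 h2].
move: y Cy Ty w h1 h2 => [m e0] [cm tm] Ty w /(vertical_charts _ ac tt cm tm) h1 h2.
pose W1 := tmap (tangent_triv C) (Tot e0) w.1.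
pose W2 := tmap (dual_triv (tangent_triv C)) (Tot e0) w.2.
exists (row_mx (rsubmx W1) (lsubmx W2)).
apply: (tmap_inj hCB tT Ty); rewrite (tmapVK hCB tT Ty).
rewrite (dsum_trivE (tangent_triv C : triv (TB (tot E)) (n + rank E))
    (dual_triv (tangent_triv C) : triv (TsB (tot E)) (n + rank E))).
rewrite /iota row_mxKl row_mxKr; congr row_mx.
  by rewrite -[LHS]hsubmxK h1.
rewrite -[LHS]hsubmxK; congr row_mx; apply: rV_separated => phi.
have /= := h2 ((tmap (tangent_triv C) (Tot e0))^-1%VF (row_mx 0 (\row_i ev phi (delta_mx 0 i)))).
move=> H; have {}H : dot W2 (row_mx 0 (\row_i ev phi (delta_mx 0 i))) = 0.
  rewrite -[RHS]H; last first.
    by apply/(vertical_charts _ ac tt cm tm); rewrite (tmapVK hTT tC (conj cm tm)) row_mxKl.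
  by rewrite (ev_dot hTT _ _ tC (conj cm tm)) (tmapVK hTT tC (conj cm tm)).
rewrite -[RHS]H -[X in dot X _]hsubmxK dot_row_mx dot0r add0r.
rewrite /ev linear_row /dot; apply: eq_bigr => i _; by rewrite mxE.
Qed.

(** The base coordinates of a vertical field vanish on the whole chart, and so do
    their derivatives. *)
Lemma vertical_section_zero (X : section (TB (tot E))) x :
  (forall y, vertical (X y)) -> smooth_section X ->
  forall u, lsubmx ('d (local_vf (chart_at (tot E) x) X) (cmap (chart_at (tot E) x) x) u) = 0.
Proof.
move=> HX CX u; set C := chart_at (tot E) x.
have aC : atlas (tot E) C by exact: (atlas_chart_at aT).
have Cx : cdom C x by exact: (cdom_chart_at aT).
have tC : trivs (TB (tot E)) (tangent_triv C) by exists C.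
have dX := loc_differentiable aC tC Cx Cx (mopenT aT) I CX.
have oO : open (cimg C setT) by apply: open_cimg => //; exact: (mopenT aT).
apply: etrans (esym (diff_lin_comp (lsubmx : {linear 'rV[R]_(n + rank E) -> 'rV[R]_n}) u dX)) _.
apply: (eq_diff0 u oO (cimg_cmap Cx I)) => z /(cimgP aT _ _ aC)[k1 _ _].
rewrite /loc /comp; move: (cinv C z) k1 => [m e0] [cm tm].
apply/(vertical_charts _ (atlas_chart_at aM _) (trivs_at hE _) cm tm).
exact: HX.
Qed.

Lemma ann_section_zero (theta : section (TsB (tot E))) x :
  (forall y v, vertical v -> ev (theta y) v = 0) -> smooth_section theta ->
  forall u, rsubmx ('d (loc (E := TsB (tot E)) (chart_at (tot E) x)
     (dual_triv (tangent_triv (chart_at (tot E) x))) theta)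
          (cmap (chart_at (tot E) x) x) u) = 0 :> 'rV[R]_(rank E).
Proof.
move=> Ht Ct u; set C := chart_at (tot E) x.
have aC : atlas (tot E) C by exact: (atlas_chart_at aT).
have Cx : cdom C x by exact: (cdom_chart_at aT).
have tC : trivs (TB (tot E)) (tangent_triv C) by exists C.
have td : trivs (TsB (tot E)) (dual_triv (tangent_triv C)) by exists (tangent_triv C).
have dt := loc_differentiable (E := TsB (tot E)) aC td Cx Cx (mopenT aT) I Ct.
have oO : open (cimg C setT) by apply: open_cimg => //; exact: (mopenT aT).
apply: etrans (esym (diff_lin_comp (rsubmx : {linear 'rV[R]_(n + rank E) -> 'rV[R]_(rank E)})
    u dt)) _.
apply: (eq_diff0 u oO (cimg_cmap Cx I)) => z /(cimgP aT _ _ aC)[k1 _ _].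
rewrite /loc /comp; move: (cinv C z) k1 => y Cy; apply/rowP => j; rewrite !mxE.
rewrite dual_trivE; apply: Ht.
move: y Cy => [m e0] [cm tm].
apply/(vertical_charts _ (atlas_chart_at aM _) (trivs_at hE _) cm tm).
rewrite (tmapVK hTT tC (conj cm tm)); apply/rowP => i; rewrite !mxE.
by rewrite eqxx /= (_ : (lshift _ i == rshift n j) = false)// eq_lrshift.
Qed.

Lemma vertical_sub (x : tot E) (a b : 'rV[R]_(n + rank E)) :
  lsubmx a = 0 -> lsubmx b = 0 -> vertical (a - b : TB (tot E) x).
Proof.
case: x => m e0 a0 b0; rewrite /vertical /mkset (tangent_proj_at hM hE).
by rewrite linearB /= a0 b0 subrr.
Qed.

(** In coordinates the fields are (0, a) and the forms (th, 0), and so are their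
    derivatives. Hence [X, Y] has no base component, the two-forms d theta vanish on
    pairs of vertical vectors, and the function eta(X) is zero. *)
Lemma vertical_dirac : is_dirac (fun x : tot E => vertical_sum_ann (x := x)).
Proof.
split; first by split; [exact: vertical_subbundle|move=> x; exact: vertical_orth].
move=> s1 s2 Cs1 Cs2 H1 H2 x.
have /(smooth_section_on_dsum aT hTT hdT _ (mopenT aT))[CX Ct] := Cs1.
have /(smooth_section_on_dsum aT hTT hdT _ (mopenT aT))[CY Ce] := Cs2.
have VX y : vertical (s1 y).1 by case: (H1 y).
have VY y : vertical (s2 y).1 by case: (H2 y).
have At y v : vertical v -> ev (s1 y).2 v = 0 by case: (H1 y) => _; exact.
have Ae y v : vertical v -> ev (s2 y).2 v = 0 by case: (H2 y) => _; exact.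
have dotV (theta : section (TsB (tot E))) u (v : TB (tot E) x) :
    (forall y v, vertical v -> ev (theta y) v = 0) -> smooth_section theta -> vertical v ->
    dot ('d (loc (E := TsB (tot E)) (chart_at (tot E) x)
     (dual_triv (tangent_triv (chart_at (tot E) x))) theta)
          (cmap (chart_at (tot E) x) x) u) v = 0.
  move=> Ht Cth Vv; rewrite -[X in dot X _](hsubmxK (_ : 'rV[R]_(n + rank E))).
  rewrite ann_section_zero//.
  have v0 : lsubmx (v : 'rV[R]_(n + rank E)) = 0.
    by move: x v Vv => [m e0] v; rewrite /vertical /mkset (tangent_proj_at hM hE).
  by rewrite -[X in dot _ X](hsubmxK (v : 'rV[R]_(n + rank E))) v0 dot_row_mx dot0r dot0l addr0.
split.
  have HX u := vertical_section_zero x VX CX u.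
  have HY u := vertical_section_zero x VY CY u.
  by apply: vertical_sub; [exact: HY|exact: HX].
move=> v Vv; rewrite -[(courant_bracket s1 s2 x).2]/(interior_extd (fun y => (s1 y).1)
    (fun y => (s2 y).2) x
   + differential (fun y => ev (s2 y).2 (s1 y).1) x - interior_extd (fun y => (s2 y).1)
       (fun y => (s1 y).2) x).
rewrite !evDl evNl.
have ext0 (X : section (TB (tot E))) (theta : section (TsB (tot E))) :
    vertical (X x) -> (forall y v, vertical v -> ev (theta y) v = 0) ->
    smooth_section theta -> ev (interior_extd X theta x) v = 0.
  move=> Xx Ht Cth; apply: etrans (interior_extdE aT _ _ Cth) _.
  apply: etrans (extdE aT _ _ Cth) _.
  apply: etrans (congr2 (fun a b => a - b) (dotV theta _ _ Ht Cth Vv) (dotV theta _ _ Ht Cth Xx)) _.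
  exact: subrr.
apply: etrans (congr2 (fun a b => a + _ - b) (ext0 _ _ (VX x) Ae Ce) (ext0 _ _ (VY x) At Ct)) _.
have -> : (fun y => ev (s2 y).2 (s1 y).1) = fun=> 0 by apply/funext => y; exact: Ae.
rewrite subr0 add0r differential_at.
exact: (eq_diff0 v (O := setT) openT).
Qed.

Variable Delta : section (AB E) -> section (BB E) -> section (BB E).
Hypothesis hD : is_dorfman Delta.

(** The coordinates of the pull-back are those of theta, completed by zeros. *)
Lemma smooth_pullback (U : set M) (theta : section (TsB M)) : mopen U ->
  smooth_section_on U theta ->
  smooth_section_on (E := TsB (tot E)) (over U)
   (fun x : tot E => ((theta (base x) : 'Hom(TB M (base x), R^o)) \o tangent_map
       (@Defs.proj _ _ _ E) x)%VF).
Proof.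
move=> oU Ct; have oU' := mopen_over aM hE oU.
apply: (smooth_section_on_triv aT hdT) => // x0 Ux0.
set c := chart_at M (base x0); set t := triv_at E (base x0).
have ac : atlas M c by exact: atlas_chart_at.
have tt : trivs E t by exact: (trivs_at hE).
pose C : chart R (tot E) (n + rank E) := tot_chart c t.
have aC : atlas (tot E) C by exact: atlas_tot_chart.
have tC : trivs (TB (tot E)) (tangent_triv C) by exists C.
have tc : trivs (TB M) (tangent_triv c) by exists c.
have tdc : trivs (TsB M) (dual_triv (tangent_triv c)) by exists (tangent_triv c).
exists (dual_triv (tangent_triv C)), (over U); split => //.
- by exists (tangent_triv C).
- by split; [exact: (cdom_chart_at aM)|exact: (tdom_at hE)].
have oN : mopen (over U `&` tdom (dual_triv (tangent_triv C))).
  by apply: (mopenI aT) => //; exact: (mopen_cdom aT).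
have oV : mopen (U `&` cdom c) by apply: (mopenI aM) => //; exact: (mopen_cdom aM).
have Cth : smooth_on (U `&` cdom c) (fun m => tmap (dual_triv (tangent_triv c)) m (theta m)).
  exact: (Ct _ tdc).
have Cf := smooth_on_proj aM hE oV Cth.
apply: (@eq_smooth_on _ _ _ aT _ _ (fun x : tot E => row_mx
   (tmap (dual_triv (tangent_triv c)) (base x) (theta (base x)))
       (0 : 'rV[R]_(rank E)))) => //; last first.
  apply: smooth_on_row_mx => //; last exact: smooth_on_cst.
  by apply: smooth_on_sub Cf => y [Uy [cy _]].
move=> [m e0] [Um [cm tm]].
apply/rowP => i; rewrite dual_trivE.
rewrite /ev comp_lfunE -[RHS]/(ev (theta m) _) (ev_dot hT _ _ tc cm).
rewrite (tangent_projE aM hE ac tt _ cm tm) (tmapVK hTT tC (conj cm tm)).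
have [j ->|j ->] := split_ordP i.
  have -> : lsubmx (delta_mx 0 (lshift (rank E) j) : 'rV[R]_(n + rank E)) = delta_mx 0 j.
    by apply/rowP => k; rewrite !mxE (inj_eq (@lshift_inj _ _)).
  by rewrite dot_deltar row_mxEl.
have -> : lsubmx (delta_mx 0 (rshift n j) : 'rV[R]_(n + rank E)) = 0.
  by apply/rowP => k; rewrite !mxE eq_lrshift.
by rewrite row_mxEr mxE dot0r.
Qed.

Lemma Delta_core_sum nu (b : 'I_(rank E) -> section E) (w : 'I_(rank E) -> R) m :
  smooth_section nu -> (forall j, smooth_section (b j)) ->
  Delta nu (core (fun y => \sum_(j < rank E) w j *: b j y)) m =
  \sum_(j < rank E) w j *: Delta nu (core (b j)) m.
Proof.
move=> Cn Cb.
have Cs (r : seq 'I_(rank E)) : smooth_section (fun y => \sum_(j <- r) w j *: b j y).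
  by apply: (@smooth_section_sum _ _ _ aM _ hE _ r (fun j y => w j *: b j y)) => j;
      exact: (smooth_sectionZc aM hE).
have C0 : smooth_section (fun y => 0 : E y) by exact: smooth_section0.
have H (r : seq 'I_(rank E)) : Delta nu (core (fun y => \sum_(j <- r) w j *: b j y)) m =
  \sum_(j <- r) w j *: Delta nu (core (b j)) m.
  elim: r => [|j r IH].
    rewrite big_nil (_ : (fun y => _) = (fun y => 0 : E y)); last first.
      by apply: functional_extensionality_dep => y; rewrite big_nil.
    have := Delta_core_lin hM hE hD (-1) m Cn C0 C0.
    rewrite scaleN1r addNr (_ : (fun y => _ *: _ + _) = (fun y => 0 : E y))//.
    by apply: functional_extensionality_dep => y; rewrite scaler0 addr0.
  rewrite big_cons -IH -(Delta_core_lin hM hE hD)//.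
  congr (Delta nu (core _) m); apply: functional_extensionality_dep => y.
  by rewrite big_cons.
exact: H.
Qed.

(** Near a point, take global sections b_j which form a frame there, with constant
    coordinates. The point of E with coordinates w lies on the section e(w), the sum
    of the w_j b_j, so Sigma may be computed with e(w); as w is constant along e(w),
    the derivative of e(w) vanishes in coordinates and Delta_nu (e(w), 0) is the sum of
    the w_j Delta_nu (b_j, 0). The result is smooth in w and in the base point. *)
Lemma smooth_Sigma nu : smooth_section nu ->
  smooth_section (E := CB (tot E)) (fun x : tot E => Sigma Delta (nu (base x)) (vec x)).
Proof.
move=> Cn; have /(smooth_pairE hM hE)[Cn1 Cn2] := Cn.
apply: (smooth_section_on_local aT hCB); first exact: (mopenT aT).
move=> x0 _; set c := chart_at M (base x0); set t := triv_at E (base x0).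
have ac : atlas M c by exact: atlas_chart_at.
have tt : trivs E t by exact: (trivs_at hE).
have c0 : cdom c (base x0) by exact: (cdom_chart_at aM).
have t0 : tdom t (base x0) by exact: (tdom_at hE).
pose C : chart R (tot E) (n + rank E) := tot_chart c t.
have aC : atlas (tot E) C by exact: atlas_tot_chart.
have tC : trivs (TB (tot E)) (tangent_triv C) by exists C.
have [V [b [oV Vx Vt Cb bE]]] := cst_sections hM hE tt t0.
pose e (w : 'rV[R]_(rank E)) : section E :=
  fun y => \sum_(j < rank E) w ord0 j *: b (delta_mx 0 j) y.
have Ce w : smooth_section (e w).
  by apply: (@smooth_section_sum _ _ _ aM _ hE _ _ (fun j y => w ord0 j *: b
      (delta_mx 0 j) y)) => j; exact: (smooth_sectionZc aM hE).
have eE w y : V y -> e w y = (tmap t y)^-1%VF w.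
  by move=> Vy; rewrite lfun_rowE; apply: eq_bigr => j _; rewrite bE.
pose om (x : tot E) := tmap t (base x) (vec x).
pose U := V `&` cdom c.
have oU : mopen U by apply: (mopenI aM) => //; exact: (mopen_cdom aM).
have oU' := mopen_over aM hE oU.
have UC : over U `<=` tdom (tangent_triv C) by move=> x [Vx' cx]; split => //; exact: Vt.
have Com : smooth_on (over U) om.
  by apply: smooth_on_sub (smooth_on_vec_triv aM hE tt) => x [/Vt].
have eom (x : tot E) : over U x -> vec x = e (om x) (base x).
  by move=> [Vb _]; rewrite eE// (tmapK hE)//; exact: Vt.
pose Dj j := Delta nu (core (b (delta_mx 0 j))).
have CDj j : smooth_section (Dj j).
  by have [H _ _ _ _] := hD; apply: H => //; exact: (smooth_core hM hE).
have CDj1 j : smooth_section (E := E) (fun m => (Dj j m).1).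
  by have [] := iffLR (smooth_section_on_dsum aM hE (dual_vbundle aM hT) _ (mopenT aM)) (CDj j).
have CDj2 j : smooth_section (E := TsB M) (fun m => (Dj j m).2).
  by have [] := iffLR (smooth_section_on_dsum aM hE (dual_vbundle aM hT) _ (mopenT aM)) (CDj j).
have DE w m : Delta nu (core (e w)) m = \sum_(j < rank E) w ord0 j *: Dj j m.
  by apply: Delta_core_sum.
have DE1 w m : (Delta nu (core (e w)) m).1 = \sum_(j < rank E) w ord0 j *: (Dj j m).1.
  by rewrite DE; elim/big_rec2 : _ => // j x y _ <-.
have DE2 w m : (Delta nu (core (e w)) m).2 = \sum_(j < rank E) w ord0 j *: (Dj j m).2.
  by rewrite DE; elim/big_rec2 : _ => // j x y _ <-.
exists (over U); split => //.
apply/(smooth_section_on_dsum aT hTT hdT _ oU'); split.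
  apply: (smooth_section_on_triv aT hTT) => // x Ux.
  exists (tangent_triv C), (over U); split => //; first exact: UC.
  have -> : over U `&` tdom (tangent_triv C) = over U by apply: setIidl.
  have tcc : trivs (TB M) (tangent_triv c) by exists c.
  apply: (@eq_smooth_on _ _ _ aT _ _ (fun x : tot E => row_mx
     (tmap (tangent_triv c) (base x) (nu (base x)).1)
     (- \sum_(j < rank E) om x ord0 j *: tmap t (base x) (Dj j (base x)).1))) => //.
    move=> [m e0] Um; have [Vm cm] := Um; have tm := Vt _ Vm.
    have /= e0E := eom _ Um.
    set w := om (Tot e0) in e0E *.
    rewrite -[RHS]/(tmap (tangent_triv C) (Tot e0) (Sigma Delta (nu m) e0).1).
    rewrite e0E (SigmaE hM hE hD)//.
    have -> : (sigma_value Delta nu (e w) m).1 = tangent_map (fun y => Tot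
        (e w y) : tot E) m (nu m).1
        - vlift (e w m) (Delta nu (core (e w)) m).1 by [].
    apply: etrans _ (esym (linearB (tmap (tangent_triv C) (Tot (e w m))) _ _)).
    apply: etrans _ (esym (congr2 (fun a b => a - b)
      (tangent_sectionE aM hE ac tt (nu m).1 cm tm oV Vm (smooth_section_on_sub
          (fun _ _ => I) (Ce w)))
      (vliftE aM hE ac tt (e w m) (Delta nu (core (e w)) m).1 cm tm))).
    rewrite opp_row_mx oppr0 add_row_mx addr0; congr row_mx.
    have oN : open (cimg c V) by exact: open_cimg.
    have H : is_diff (cmap c m) (fun _ : 'rV[R]_n => w) 0 by exact: is_diff_cst.
    set X' := tmap _ _ (nu m).1.
    have -> : 'd ((fun y => tmap t y (e w y)) \o cinv c) (cmap c m) X' = 0.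
      apply: etrans (esym (eq_diff X' oN (cimg_cmap cm Vm) (f := fun _ => w) _ _)) _.
      - move=> z /(cimgP aM _ _ ac)[k1 k2 k3]; rewrite /comp eE//.
        by rewrite (tmapVK hE tt)//; exact: Vt.
      - by have [] := H.
      - exact: (congr1 (fun h => h X') (@diff_val _ _ _ _ _ _ _ H)).
    rewrite add0r; congr (- _); rewrite DE1 linear_sum; apply: eq_bigr => j _.
    by rewrite linearZ.
  apply: smooth_on_row_mx => //.
    apply: (smooth_on_proj aM hE (f := fun m => tmap (tangent_triv c) m (nu m).1)) => //.
    by apply: (smooth_tmap tcc) (smooth_section_on_sub (fun _ _ => I) Cn1) => y [].
  apply: (smooth_onN) => //; apply: smooth_on_sum => // j _.
  apply: smooth_onZ => //.
    exact: (iffLR (smooth_on_rV _ oU') Com j).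
  apply: (smooth_on_proj aM hE (f := fun m => tmap t m (Dj j m).1)) => //.
  apply: (smooth_tmap tt) (smooth_section_on_sub (fun _ _ => I) (CDj1 j)) => y [Vy _].
  exact: Vt.
apply: (@eq_smooth_section_on _ _ _ aT _ hdT _ (fun x : tot E =>
   differential (ell (fun y => (nu y).2)) x + (-1) *: \sum_(j < rank E) om x ord0 j *:
    ((((Dj j (base x)).2 : 'Hom(TB M (base x), R^o)) \o tangent_map
        (@Defs.proj _ _ _ E) x)%VF : TsB (tot E) x))) => //.
  move=> [m e0] Um; have [Vm cm] := Um; have tm := Vt _ Vm.
  have /= e0E := eom _ Um.
  set w := om (Tot e0) in e0E *.
  rewrite -[RHS]/((Sigma Delta (nu m) e0).2) e0E (SigmaE hM hE hD)//.
  rewrite -[RHS]/(differential (ell (fun y => (nu y).2)) (Tot (e w m) : tot E)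
  - (core_lift (Delta nu (core (e w)) m) (e w m)).2).
  rewrite scaleN1r; congr (_ - _).
  apply: ev_inj => v; rewrite -[RHS]/(ev _ v) /core_lift /= [in RHS]/ev comp_lfunE DE2.
  rewrite sum_lfunE /ev sum_lfunE; apply: eq_bigr => j _.
  by rewrite !scale_lfunE comp_lfunE.
apply: (smooth_section_onD aT hdT) => //.
  apply: (smooth_differential aT) => //; apply: smooth_ell => //.
  exact: smooth_section_on_sub Cn2.
apply: (smooth_section_onZ aT hdT) => //; first exact: smooth_on_cst.
apply: (@smooth_section_on_sum _ _ _ aT _ hdT _ _ _ _ (fun j (x : tot E) => om x ord0 j *:
    ((((Dj j (base x)).2 : 'Hom(TB M (base x), R^o)) \o tangent_map
        (@Defs.proj _ _ _ E) x)%VF : TsB (tot E) x))) => // j _.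
apply: (smooth_section_onZ aT hdT) => //.
  exact: (iffLR (smooth_on_rV _ oU') Com j).
apply: (@smooth_pullback U (fun m => (Dj j m).2)) => //.
exact: smooth_section_on_sub (CDj2 j).
Qed.

(** Let nu run through sections with constant coordinates; the injectivity comes from
    [Phi_E_Sigma]. *)
Lemma L_subbundle : is_subbundle (L_Delta Delta).
Proof.
apply: (@subbundle_param _ _ _ (CB (tot E)) _ (n + rank E)) => x0.
have tA := trivs_at hAB (base x0); have tA0 := tdom_at hAB (base x0).
set T := triv_at (dsum (TB M) (dual E)) (base x0) in tA tA0.
have [V [s [oV Vx Vt Cs sE]]] := cst_sections hM hAB tA tA0.
exists (over V), (fun y w => Sigma Delta (s w (base y)) (vec y)); split => //.
- exact: (mopen_over aM hE).
- by move=> w; apply: smooth_section_on_sub (smooth_Sigma (Cs w)).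
move=> [m e0] Vm; have {}Vm : V m by [].
split.
- move=> a u v; rewrite -(Sigma_lin hM hE hD); congr Sigma.
  by rewrite !sE// linearP.
- move=> u v /(congr1 (fun z : CB (tot E) (Tot e0) => Phi_E z));
    rewrite !(Phi_E_Sigma hM hE hD) !sE//.
  by move/(can_inj (tmapVK hAB tA (Vt _ Vm))).
- move=> w; split=> [[u _ <-]|[u ->]]; last by exists (s u m).
  exists (tmap T m u); congr Sigma; rewrite sE//.
  by rewrite (tmapK hAB tA)//; exact: Vt.
Qed.

(** For w orthogonal to L_Delta, the difference Sigma (Phi_E w) - w lies in the kernel of
    Phi_E, hence is the core lift of some tau, and it is orthogonal to L_Delta. By
    [cpair_core_lift] this tau pairs to zero with TM + E^* , so that w = Sigma (Phi_E w). *)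
Lemma L_orth (iso : isotropic (L_Delta Delta)) (x : tot E) :
  L_Delta Delta (x := x) = orth (fun y : tot E => L_Delta Delta (x := y)) (x := x).
Proof.
apply/seteqP; split; first exact: iso.
case: x => m e0 w wL; apply/L_DeltaP; exists (Phi_E w).
have : Phi_E (-1 *: Sigma Delta (Phi_E w) e0 + w) = 0.
  by rewrite (Phi_E_lin hM hE) (Phi_E_Sigma hM hE hD) scaleN1r addNr.
move=> /(vertical_core_lift hM hE)[tau Et].
have tau0 : tau = 0.
  apply: (pairing_injr hE) => nu.
  have := cpair_core_lift hM hE tau (Sigma Delta nu e0).
  rewrite (Phi_E_Sigma hM hE hD) -Et => <-.
  rewrite scaleN1r cpairDl cpairNl.
  have H1 : cpair (Sigma Delta (Phi_E w) e0) (Sigma Delta nu e0) = 0.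
    by apply: (iso (Tot e0)); apply/L_DeltaP; eexists.
  have H2 : cpair w (Sigma Delta nu e0) = 0.
    by apply: wL; apply/L_DeltaP; eexists.
  by rewrite H1 H2 oppr0 addr0.
have : core_lift tau e0 = 0.
  rewrite tau0; apply: CB_ext; first by rewrite -[LHS]/(vlift e0 0)
      (vlift_at hM hE) linear0 row_mx0.
  move=> v; rewrite ev0l /core_lift /= /ev comp_lfunE.
  by rewrite zero_lfunE.
rewrite -Et scaleN1r addrC => /eqP; rewrite subr_eq0 => /eqP; exact.
Qed.

Lemma isotropic_maximal : isotropic (L_Delta Delta) -> maximally_isotropic (L_Delta Delta).
Proof.
move=> iso; split => // x W Wiso LW w wW.
rewrite L_orth// => w' Lw'; apply: Wiso => //; exact: LW.
Qed.

Lemma vertical_L_direct :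
  direct_sum (fun x : tot E => vertical_sum_ann (x := x)) (L_Delta Delta).
Proof.
case=> m e0 w.
exists (w - Sigma Delta (Phi_E w) e0, Sigma Delta (Phi_E w) e0); split.
  split => /=; last by rewrite subrK.
    apply/(vertical_sum_annP hM hE).
    rewrite addrC -scaleN1r (Phi_E_lin hM hE) (Phi_E_Sigma hM hE hD).
    by rewrite scaleN1r addNr.
  by apply/L_DeltaP; eexists.
move=> [a b] /= [/(vertical_sum_annP hM hE) a0 /L_DeltaP[u bE] wE].
have -> : Phi_E w = u.
  by rewrite wE -[a]scale1r (Phi_E_lin hM hE) a0 scaler0 add0r bE (Phi_E_Sigma hM hE hD).
by rewrite wE bE addrK.
Qed.

Lemma L_almost_dirac : isotropic (L_Delta Delta) -> is_almost_dirac (L_Delta Delta).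
Proof. by move=> iso; split; [exact: L_subbundle|exact: L_orth]. Qed.

Lemma Phi_E_L_full m :
  [set u | exists (e0 : E m) (w : CB (tot E) (Tot e0)),
     L_Delta Delta w /\ Phi_E w = u] = setT.
Proof.
apply/seteqP; split=> // u _; exists 0, (Sigma Delta u 0).
by split; [apply/L_DeltaP; exists u|exact: (Phi_E_Sigma hM hE hD)].
Qed.

End LinearStructure.

(** * Addition over TM + E^* and linearity of L_Delta *)

Section TangentSum.
Context {R : realType} {n : nat} {M : premanifold R n}.
Hypothesis hM : is_manifold M.
Let aM := manifold_atlas hM.
Variable E : prebundle M.
Hypothesis hE : is_vbundle E.
Let aT := tot_atlas aM hE.

(** The projections and the addition of the fibred product are given by one linear map
    in all coordinates, which is its own differential. *)
Lemma tangent_map_linear (F : tot (dsum E E) -> tot E) m (e e' : E m)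
    (L : {linear 'rV[R]_(rank E + rank E) -> 'rV[R]_(rank E)})
    (z : TB (tot (dsum E E)) (fpair e e')) :
  (forall y, base (F y) = base y) ->
  (forall y (p : E y * E y), tdom (triv_at E m) y ->
    cmap (tot_chart (chart_at M m) (triv_at E m)) (F (Tot (F := dsum E E) p)) =
    row_mx (cmap (chart_at M m) y)
      (L (row_mx (tmap (triv_at E m) y p.1) (tmap (triv_at E m) y p.2))) :> 'rV[R]_(n + rank E)) ->
  tangent_map F (fpair e e') z =
    row_mx (lsubmx (z : 'rV[R]_(n + (rank E + rank E))))
      (L (rsubmx (z : 'rV[R]_(n + (rank E + rank E))))) :> 'rV[R]_(n + rank E).
Proof.
move=> Fb FE; set c := chart_at M m; set t := triv_at E m.
have ac : atlas M c := atlas_chart_at aM m.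
have tt : trivs E t := trivs_at hE m.
have cm : cdom c m := cdom_chart_at aM m.
have tm : tdom t m := tdom_at hE m.
pose G (y : 'rV[R]_(n + (rank E + rank E))) : 'rV[R]_(n + rank E) :=
  row_mx (lsubmx y) (L (rsubmx y)).
have linG : linear G.
  by move=> a u v; rewrite /G !linearP /= scale_row_mx add_row_mx.
pose LM := GRing.isLinear.Build _ _ _ _ G linG.
pose LG : {linear 'rV[R]_(n + (rank E + rank E)) -> 'rV[R]_(n + rank E)} := HB.pack G LM.
pose C := tot_chart c (dsum_triv t t).
have HG := is_diff_linear LG (cmap C (fpair e e')).
pose O := [set y : 'rV[R]_(n + (rank E + rank E)) | cimg c (tdom t) (lsubmx y)].
have oO : open O by apply: open_lsubmx_preimage; apply: open_cimg => //; exact: (mopen_tdom hE).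
have Ox : O (cmap C (fpair e e')) by rewrite /O /= row_mxKl; exact: cimg_cmap.
have cF : chart_at (tot E) (F (fpair e e')) = tot_chart c t by rewrite /= Fb.
apply: etrans (lfunE _ z) _; rewrite cF.
apply: etrans (esym (eq_diff (z : 'rV[R]_(n + (rank E + rank E))) oO Ox (f := LG) _ _)) _.
- move=> y Oy; have {}Oy : cimg c (tdom t) (lsubmx y) by [].
  move: Oy => /(cimgP aM _ _ ac)[k1 k2 k3].
  set p : E (cinv c (lsubmx y)) * E (cinv c (lsubmx y)) :=
     ((tmap t (cinv c (lsubmx y)))^-1%VF (lsubmx (rsubmx y)),
      (tmap t (cinv c (lsubmx y)))^-1%VF (rsubmx (rsubmx y))).
  have Ep : cinv C y = Tot (F := dsum E E) p.
    exact: (f_equal (fun q : dsum E E (cinv c (lsubmx y)) => Tot q)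
      (dsum_triv_inv hE hE (rsubmx y) tt tt k2 k2)).
  symmetry; apply: etrans (congr1 (fun q => cmap (tot_chart c t) (F q) : 'rV[R]_(n + rank E)) Ep) _.
  apply: etrans (FE _ p k2) _; rewrite !(tmapVK hE tt k2) hsubmxK.
  by rewrite k3.
- by have [] := HG.
exact: (congr1 (fun h => h z) (@diff_val _ _ _ _ _ _ _ HG)).
Qed.

Lemma tangent_fstE m (e e' : E m) (z : TB (tot (dsum E E)) (fpair e e')) :
  tangent_map (@ffst _ _ _ E) (fpair e e') z =
    row_mx (lsubmx (z : 'rV[R]_(n + (rank E + rank E))))
      (lsubmx (rsubmx (z : 'rV[R]_(n + (rank E + rank E))))) :> 'rV[R]_(n + rank E).
Proof.
apply: (tangent_map_linear (L := lsubmx : {linear 'rV[R]_(rank E + rank E) -> 'rV[R]_(rank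
    E)})) => //.
by move=> y p ty; rewrite /= row_mxKl.
Qed.

Lemma tangent_sndE m (e e' : E m) (z : TB (tot (dsum E E)) (fpair e e')) :
  tangent_map (@fsnd _ _ _ E) (fpair e e') z =
    row_mx (lsubmx (z : 'rV[R]_(n + (rank E + rank E))))
      (rsubmx (rsubmx (z : 'rV[R]_(n + (rank E + rank E))))) :> 'rV[R]_(n + rank E).
Proof.
apply: (tangent_map_linear (L := rsubmx : {linear 'rV[R]_(rank E + rank E) -> 'rV[R]_(rank
    E)})) => //.
by move=> y p ty; rewrite /= row_mxKr.
Qed.

Lemma tangent_addE m (e e' : E m) (z : TB (tot (dsum E E)) (fpair e e')) :
  tangent_map (@fadd _ _ _ E) (fpair e e') z =
    row_mx (lsubmx (z : 'rV[R]_(n + (rank E + rank E))))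
      (lsubmx (rsubmx (z : 'rV[R]_(n + (rank E + rank E)))) +
       rsubmx (rsubmx (z : 'rV[R]_(n + (rank E + rank E))))) :> 'rV[R]_(n + rank E).
Proof.
pose G (u : 'rV[R]_(rank E + rank E)) : 'rV[R]_(rank E) := lsubmx u + rsubmx u.
have linG : linear G.
  by move=> a u v; rewrite /G !linearP /= scalerDr addrACA.
pose LM := GRing.isLinear.Build _ _ _ _ G linG.
pose LG : {linear 'rV[R]_(rank E + rank E) -> 'rV[R]_(rank E)} := HB.pack G LM.
apply: (tangent_map_linear (L := LG)) => //.
by move=> y p ty; rewrite /= /G row_mxKl row_mxKr linearD.
Qed.

(** A tangent vector of the fibred product is a vector X of the base with two fibre
    components, which the tangent maps of the projections read off. *)
Lemma is_tangent_sumP m (e e' : E m) (X : 'rV[R]_n) (a a' : 'rV[R]_(rank E)) v w u :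
  v = row_mx X a :> 'rV[R]_(n + rank E) -> w = row_mx X a' :> 'rV[R]_(n + rank E) ->
  is_tangent_sum (e := e) (e' := e') v w u <->
  u = row_mx X (a + a') :> 'rV[R]_(n + rank E).
Proof.
move=> vE wE; split=> [[z [h1 h2 h3]]|uE].
  have [l1 l2] := eq_row_mx (etrans (esym (tangent_fstE z)) (etrans h1 vE)).
  have [_ l3] := eq_row_mx (etrans (esym (tangent_sndE z)) (etrans h2 wE)).
  by apply: etrans (esym h3) (etrans (tangent_addE z) _); rewrite l1 l2 l3.
exists (row_mx X (row_mx a a') : 'rV[R]_(n + (rank E + rank E))); split.
- by apply: etrans (tangent_fstE _) (etrans _ (esym vE)); rewrite row_mxKr !row_mxKl.
- by apply: etrans (tangent_sndE _) (etrans _ (esym wE)); rewrite row_mxKl !row_mxKr.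
- by apply: etrans (tangent_addE _) (etrans _ (esym uE)); rewrite row_mxKr !row_mxKl row_mxKr.
Qed.

Variable Delta : section (AB E) -> section (BB E) -> section (BB E).
Hypothesis hD : is_dorfman Delta.

(** Choose sections f and f' through the two points: Sigma at e + e' is computed with
    f + f', and both [vpart] and Delta_nu (f, 0) are additive in f, for a fixed nu. *)
Lemma L_add_closed m (e e' : E m) (w : CB (tot E) (Tot e)) (w' : CB (tot E) (Tot e'))
    (s : CB (tot E) (Tot (e + e'))) :
  L_Delta Delta w -> L_Delta Delta w' -> Phi_E w = Phi_E w' ->
  is_tangent_sum w.1 w'.1 s.1 -> is_cotangent_sum w.2 w'.2 s.2 ->
  L_Delta Delta s.
Proof.
move=> /L_DeltaP[u wE] /L_DeltaP[u' wE']; rewrite wE wE'.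
rewrite !(Phi_E_Sigma hM hE hD) => uu'; subst u'.
move=> s1 s2; apply/L_DeltaP; exists u.
have [nu [f [Cn Cf nuE fE]]] := sections_through hM hE u e.
have [f' [Cf' fE']] := section_through hM hE e'.
subst u e e'.
move: s1 s2; rewrite !(SigmaE hM hE hD)// => s1 s2.
(* the factor 1 brings the sum into the form of the linearity lemmas *)
pose g : section E := fun y => 1 *: f y + f' y.
have Cg : smooth_section g.
  by apply: (smooth_sectionD aM hE) => //; exact: (smooth_sectionZc aM hE).
have vg : vpart Delta nu g m = vpart Delta nu f m + vpart Delta nu f' m.
  by rewrite /g (vpart_lin hM hE hD)// scale1r.
have Dg : Delta nu (core g) m = Delta nu (core f) m + Delta nu (core f') m.
  by rewrite /g (Delta_core_lin hM hE hD)// scale1r.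
have gm : f m + f' m = g m by rewrite /g scale1r.
have tg : tmap (triv_at E m) m (g m) = tmap (triv_at E m) m (f m) + tmap (triv_at E m) m (f' m).
  by rewrite -gm linearD.
have E1 := sigma1E hM hE Delta nu m Cf.
have E1' := sigma1E hM hE Delta nu m Cf'.
have S1 : s.1 = row_mx (nu m).1 (vpart Delta nu g m) :> 'rV[R]_(n + rank E).
  by rewrite vg; exact: iffLR (is_tangent_sumP _ E1 E1') s1.
have S2 (v : 'rV[R]_(n + rank E)) : ev s.2 v = ev (sigma_value Delta nu g m).2 v.
  (* any splitting of the fibre component of v into two summands would do *)
  pose v1 : 'rV[R]_(n + rank E) := row_mx (lsubmx v) (rsubmx v).
  pose v2 : 'rV[R]_(n + rank E) := row_mx (lsubmx v) 0.
  have vs : is_tangent_sum (e := f m) (e' := f' m) v1 v2 v.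
    by apply: (iffRL (is_tangent_sumP _ erefl erefl)); rewrite addr0 hsubmxK.
  apply: etrans (s2 _ _ _ vs) _.
  apply: etrans (congr2 (fun a b => a + b) (@sigma2E _ _ _ hM E hE Delta nu f m v1 Cn)
    (@sigma2E _ _ _ hM E hE Delta nu f' m v2 Cn))
    (etrans _ (esym (@sigma2E _ _ _ hM E hE Delta nu g m v Cn))).
  rewrite tg Dg !row_mxKl !row_mxKr dot0r dotDr.
  rewrite -[X in _ = _ - X]/(ev ((Delta nu (core f) m).2 + (Delta nu (core f') m).2) _) evDl.
  move: (dot _ _) (dot _ _) (dot _ _) (ev _ _) (ev _ _) => x1 x2 x3 x4 x5.
  ring.
clear s2 s1 wE wE'; rewrite gm in s S1 S2 *.
rewrite (SigmaE hM hE hD)//.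
apply: CB_ext S2; apply: etrans S1 _.
exact: esym (sigma1E hM hE Delta nu m Cg).
Qed.

Lemma L_linear_subbundle : is_linear_subbundle (L_Delta Delta).
Proof.
split; first exact: (L_subbundle hM hE hD).
  apply: (full_subbundle aM (dsum_vbundle aM (TB_vbundle aM) (dual_vbundle aM hE))) => m.
  exact: (Phi_E_L_full hM hE hD).
by move=> m e e' w w' s; exact: L_add_closed.
Qed.

End TangentSum.

Theorem corollary4p6 (R : realType) (n : nat) (M : premanifold R n)
    (E : prebundle M) (Delta : section (AB E) -> section (BB E) -> section (BB E))
    (hM : is_manifold M) (hE : is_vbundle E) (hDelta : is_dorfman Delta) :
  (dull_skew Delta <-> maximally_isotropic (L_Delta Delta)) /\
  (dull_skew Delta ->
     [/\ direct_sum (vertical_sum_ann (E := E)) (L_Delta Delta),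
         is_dirac (vertical_sum_ann (E := E)),
         is_almost_dirac (L_Delta Delta) &
         is_linear_subbundle (L_Delta Delta)]).
Proof.
have skewP := skew_isotropic hM hE hDelta.
split; first split.
- by move=> /skewP; exact: (isotropic_maximal hM hE hDelta).
- by move=> [iso _]; exact/skewP.
move=> /skewP iso; split.
- exact: (vertical_L_direct hM hE hDelta).
- exact: (vertical_dirac hM hE).
- exact: (L_almost_dirac hM hE hDelta iso).
- exact: (L_linear_subbundle hM hE hDelta).
Qed.
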